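(* Let $(a_k)_{k\in\mathbb{N}}$ be a sequence with $a_k>0$ for all $k\in\mathbb{N}$, let $\mu=\mu_{ac}+\mu_{disc}$ with $\mu_{ac}=x^2\mathbf 1_{(0,1)}\,dx$ and $\mu_{disc}=\sum_{k=1}^\infty a_k\delta_k$, let $F=[0,1]\cup\mathbb{N}$ be the support of $\mu$, and let $\check{\mathcal{E}}$ be the trace of the Bessel Dirichlet form $\mathcal{E}$ (case $n=3$) with respect to $\mu$. Let $\mathcal{Q}$ be the quadratic form in $L^2(F,\mu)$ with domain $$\check{\mathcal{D}}_{max}=\Big\{\psi\in L^2(F,\mu):\ \psi\in AC[0,1],\ \int_0^1(\psi'(x))^2\,d\mu_{ac}+\sum_{k=1}^\infty k(k+1)(\psi(k+1)-\psi(k))^2<\infty\Big\},$$ given by $$\mathcal{Q}[\psi]=\int_0^1(\psi'(x))^2\,d\mu_{ac}+\sum_{k=1}^\infty k(k+1)(\psi(k+1)-\psi(k))^2,\qquad \psi\in\check{\mathcal{D}}_{max}.$$ 1. It holds $\check{\mathcal{E}}=\overline{\mathcal{Q}|_{\operatorname{ran}J}}$, i.e. $\check{\mathcal{E}}$ is the closure of the restriction of $\mathcal{Q}$ to $\operatorname{ran}J$. 2. If $\mu_{disc}(\mathbb{N})=\infty$, then $\check{\mathcal{E}}=\mathcal{Q}$.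
   Context: $\mathbb{N}=\{1,2,\dots\}$ and $I=(0,\infty)$; $AC(I)$ and $AC[0,1]$ denote the spaces of absolutely continuous functions on $I$ and on $[0,1]$, respectively. Let $dm=2x^2\,dx$ on $I$. The Bessel Dirichlet form (case $n=3$) is the form in $L^2(I,m)$ with $$\mathcal{D}=\{u\in AC(I)\cap L^2(I,m):\ \int_0^\infty (u'(x))^2x^2\,dx<\infty\},\qquad \mathcal{E}[u]=\int_0^\infty (u'(x))^2x^2\,dx .$$ For $\lambda>0$, $\mathcal{E}_\lambda[u]=\mathcal{E}[u]+\lambda\int_I u^2\,dm$. Trace with respect to $\mu$: let $D(J)=\{u\in\mathcal{D}:u|_F\in L^2(F,\mu)\}$ and $J:D(J)\to L^2(F,\mu)$, $Ju=u|_F$ (the point $0$ is $\mu$-null). For $\lambda>0$ let $P_\lambda$ be the orthogonal projection in $(\mathcal{D},\mathcal{E}_\lambda)$ onto the $\mathcal{E}_\lambda$-orthogonal complement of $\ker J=\{u\in\mathcal{D}:u|_{(0,1)}=0,\ u(k)=0\ \forall k\in\mathbb{N}\}$, and set $\check{\mathcal{E}}_\lambda[Ju]:=\mathcal{E}_\lambda[P_\lambda u]$ for $u\in D(J)$. Each $\check{\mathcal{E}}_\lambda$ is a closed form in $L^2(F,\mu)$ with domain $\operatorname{ran}J$, and the family is monotone increasing in $\lambda$. The trace form $\check{\mathcal{E}}$ is by definition the Mosco limit of $\check{\mathcal{E}}_\lambda$ as $\lambda\downarrow0$.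
   Formalization: AC(I) and AC[0,1] are read as local absolute continuity on (0,∞) and on (0,1]; with AC up to 0 the form Q is not closed and claim 2 fails (e.g. ψ = x^(-1/4) near 0, cut off to vanish at 1 and on ℕ). *)

(* Defs.v *)
From HB Require Import structures.
From mathcomp Require Import all_boot all_order all_algebra.
From mathcomp Require Import all_classical all_reals all_analysis.
From mathcomp Require Import measurable_realfun.

Set Implicit Arguments.
Unset Strict Implicit.
Unset Printing Implicit Defensive.
Import Order.TTheory GRing.Theory Num.Theory.
Import numFieldNormedType.Exports.
Local Open Scope classical_set_scope.
Local Open Scope ring_scope.

(** * Absolute continuity *)

Definition abs_cont {R : realType} (A : set R) (f : R -> R) : Prop :=
  forall e : R, 0 < e -> exists2 d : R, 0 < d &
    forall (n : nat) (s t : 'I_n -> R),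
      (forall i, s i <= t i /\ `[s i, t i] `<=` A) ->
      trivIset setT (fun i => `]s i, t i[%classic) ->
      \sum_(i < n) (t i - s i) < d ->
      \sum_(i < n) `|f (t i) - f (s i)| < e.

(* AC(I) and AC[0, 1] are read as [loc_abs_cont] on ]0, +oo[ and on ]0, 1]: the
   point 0 is a null set, and functions of finite energy, such as
   [x `^ (- 4^-1)] near 0, may be unbounded there.  With absolute continuity up
   to 0 the forms below would not be closed. *)
Definition loc_abs_cont {R : realType} (A : set R) (f : R -> R) : Prop :=
  forall s t : R, `[s, t] `<=` A -> abs_cont `[s, t] f.

(** * Measures with a density *)

Section density.
Context {R : realType}.
Variables (w : R -> R) (w_ge0 : forall x, 0 <= w x)
          (mw : measurable_fun setT w).

Definition density of (forall x, 0 <= w x) & measurable_fun setT w :=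
  fun A : set (measurableTypeR R) =>
    (\int[lebesgue_measure]_(x in A) (w x)%:E)%E.

Local Notation nu := (density w_ge0 mw).

Let density0 : nu set0 = 0%E.
Proof. by rewrite /density integral_set0. Qed.

Let density_ge0 A : (0 <= nu A)%E.
Proof. by apply: integral_ge0 => x _; rewrite lee_fin. Qed.

Let density_sigma_additive : semi_sigma_additive nu.
Proof.
apply: semi_sigma_additive_nng_induced => //.
exact/measurable_EFinP.
Qed.

HB.instance Definition _ := isMeasure.Build _ _ _ nu
  density0 density_ge0 density_sigma_additive.

End density.

(** * Extended-valued quadratic forms in [L^2] *)

(* Elements of [L^2] are represented by square-integrable functions.  A form is
   a functional with value [+oo] off its domain.  All functionals below are
   invariant under modification on null sets. *)
Notation L2 mu := (LfunType mu (lee1n 2)).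

Section forms.
Context d (T : measurableType d) (R : realType).
Variable mu : {measure set T -> \bar R}.
Implicit Types (s : nat -> L2 mu) (f g : L2 mu) (q Q : L2 mu -> \bar R).

Definition L2_cvg s f : Prop :=
  ('N[mu]_2[EFin \o (s n - f)%R] @[n --> \oo] --> 0)%E.

Definition L2_weak_cvg s f : Prop := forall g : L2 mu,
  \int[mu]_x (s n x * g x) @[n --> \oo] --> \int[mu]_x (f x * g x).

Definition mosco_limit (q : R -> L2 mu -> \bar R) Q : Prop :=
  forall lam : nat -> R, (forall n, 0 < lam n) -> lam @ \oo --> 0 ->
    (forall s f, L2_weak_cvg s f ->
      (Q f <= limn_einf (fun n => q (lam n) (s n)))%E) /\
    (forall f, exists2 s, L2_cvg s f &
      (limn_esup (fun n => q (lam n) (s n)) <= Q f)%E).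

Definition restrict_form q (S : set (L2 mu)) : L2 mu -> \bar R :=
  fun f => if `[< S f >] then q f else +oo%E.

Definition form_approx q s f : Prop :=
  [/\ forall n, (q (s n) < +oo)%E,
      forall e : R, 0 < e -> exists N, forall n m, (N <= n)%N -> (N <= m)%N ->
        (q (s n - s m)%R <= e%:E)%E
    & L2_cvg s f].

(* The second clause expresses both that [q] is closable and what the values of
   the closure are. *)
Definition is_closure q Q : Prop :=
  (forall f, (Q f < +oo)%E <-> exists s, form_approx q s f) /\
  (forall s f, form_approx q s f -> q (s n) @[n --> \oo] --> Q f).

End forms.

(** * The Bessel Dirichlet form, n = 3 *)

Section bessel.
Context {R : realType}.
Implicit Types (u v w : R -> R) (lam : R).

Definition speed (x : R) : R := 2 * x ^+ 2.

Lemma speed_ge0 x : 0 <= speed x.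
Proof. by rewrite mulr_ge0 ?sqr_ge0. Qed.

Lemma measurable_speed : measurable_fun setT speed.
Proof. by apply: measurable_funM => //; exact: measurable_funX. Qed.

Definition bessel_speed : {measure set (measurableTypeR R) -> \bar R} :=
  density speed_ge0 measurable_speed.

Definition bessel_dom u : Prop :=
  [/\ loc_abs_cont `]0, +oo[ u,
      (\int[bessel_speed]_(x in `]0%R, +oo[) (u x ^+ 2)%:E < +oo)%E
    & (\int[lebesgue_measure]_(x in `]0%R, +oo[)
         (derive1 u x ^+ 2 * x ^+ 2)%:E < +oo)%E].

Definition bessel_form u v : R :=
  \int[lebesgue_measure]_(x in `]0%R, +oo[) (derive1 u x * derive1 v x * x ^+ 2).

Definition bessel_form_lam lam u v : R :=
  bessel_form u v + lam * \int[bessel_speed]_(x in `]0%R, +oo[) (u x * v x).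

Definition orth_compl lam (S : set (R -> R)) : set (R -> R) :=
  [set v | bessel_dom v /\ forall w, S w -> bessel_form_lam lam v w = 0].

(* [v] is the orthogonal projection of [u] onto [S] in the domain with the
   inner product [bessel_form_lam lam] *)
Definition is_orth_proj lam (S : set (R -> R)) u v : Prop :=
  S v /\ orth_compl lam S (u \- v).

End bessel.

(** * The measure [mu] and the trace *)

Section trace.
Context {R : realType}.

Definition weight (x : R) : R := x ^+ 2 * \1_(`]0, 1[%classic : set R) x.

Lemma weight_ge0 x : 0 <= weight x.
Proof. by rewrite mulr_ge0 ?sqr_ge0. Qed.

Lemma measurable_weight : measurable_fun setT weight.
Proof. by apply: measurable_funM => //; exact: measurable_funX. Qed.

Definition mu_ac : {measure set (measurableTypeR R) -> \bar R} :=
  density weight_ge0 measurable_weight.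

Variable a : nat -> {posnum R}.

(* Only the values [a k] with [1 <= k] are used. *)
Definition mu_disc : {measure set (measurableTypeR R) -> \bar R} :=
  mseries (fun k => mscale (a k)%:num%:nng (dirac (k%:R : measurableTypeR R)))
          1.

Definition mu : {measure set (measurableTypeR R) -> \bar R} :=
  measure_add mu_ac mu_disc.

Definition posnats : set R := [set k%:R | k in [set k | (0 < k)%N]].

(* [mu] is carried by [F = [0, 1] `|` posnats] and does not charge 0, so
   [L2 mu] is L^2(F, mu), and [f] matters here only on [`]0, 1] `|` posnats]. *)
Definition is_version (f : R -> R) (psi : L2 mu) : Prop :=
  {ae mu, forall x, f x = psi x}.

Definition ran_J : set (L2 mu) :=
  [set psi | exists2 u, bessel_dom u & is_version u psi].

Definition ker_J : set (R -> R) :=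
  [set u | [/\ bessel_dom u, forall x, 0 < x < 1 -> u x = 0
             & forall x, posnats x -> u x = 0]].

(* [e] does not depend on the choice of [u] and [v]; the value is [+oo] off
   [ran_J]. *)
Definition trace_lam (lam : R) (psi : L2 mu) : \bar R :=
  xget +oo%E [set e | exists u v,
    [/\ bessel_dom u, is_version u psi,
        is_orth_proj lam (orth_compl lam ker_J) u v
      & e = (bessel_form_lam lam v v)%:E]].

Definition is_trace_form (E : L2 mu -> \bar R) : Prop :=
  mosco_limit trace_lam E.

Definition max_energy (f : R -> R) : \bar R :=
  (\int[mu_ac]_(x in `]0%R, 1%R[) (derive1 f x ^+ 2)%:E +
   \sum_(1 <= k <oo) ((k * k.+1)%:R * (f k.+1%:R - f k%:R) ^+ 2)%:E)%E.

(* At most one value of [max_energy] occurs, since versions that are continuous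
   on ]0, 1] agree on ]0, 1] and on the atoms.  The domain is the set where
   this is [< +oo]. *)
Definition max_form (psi : L2 mu) : \bar R :=
  xget +oo%E [set e | exists f,
    [/\ is_version f psi, loc_abs_cont `]0, 1] f & e = max_energy f]].

End trace.

(* Main.v *)
Require Import Defs.
From HB Require Import structures.
From mathcomp Require Import all_boot all_order all_algebra.
From mathcomp Require Import all_classical all_reals all_analysis.
From mathcomp Require Import measurable_realfun ring lra.

(** Harmonic functions for the Bessel form are [A + B / x].  In the scale
    [- 1 / x] the gap between the atoms [k] and [k.+1] has length
    [1 / (k * k.+1)], so that interpolating harmonically between two atoms
    costs [k * k.+1] times the squared jump.  This is why [max_form] is the
    natural candidate for the trace.  One restriction remains: a function in
    the Bessel domain tends to 0 along the atoms, since its oscillation beyond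
    [k] is of order [k ^ (- 1 / 2)] and it is square-integrable for the weight
    [2 x ^+ 2].  The trace is [trace_form], which is [max_form] on functions
    with this property and [+oo] elsewhere.

    For [lam > 0] the projection of [u] agrees with [u] on [`]0, 1]] and at
    the atoms, and on each gap it solves [(x ^+ 2 v')' = 2 lam x ^+ 2 v].  The
    solutions are explicit ([exists_piece]), and gluing them gives a function
    of the domain, orthogonal to [ker_J] ([pw_orth], [bessel_dom_pw]).  It
    computes the value of [trace_lam] ([trace_lamE]) and minimizes the form
    among all extensions ([trace_lam_min]).

    Lower bound.  By Cauchy-Schwarz on each cell, every Bessel energy dominates
    the sums of [(u t - u s) ^+ 2 / (s^-1 - t^-1)] over disjoint cells, whose
    supremum over cells of [`]0, 1]] and gaps is the energy in [max_form]
    ([bessel_dom_energy], [max_energy_le]).  Hence [trace_form] is a lower bound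
    for every [trace_lam].  In this discrete form the energy is lower
    semicontinuous for pointwise convergence, and functions of bounded energy
    are equicontinuous on compact parts of [`]0, 1]], which improves weak
    convergence in L2 to pointwise convergence ([weak_energy_lsc],
    [trace_form_lsc]).  Lower semicontinuity gives the lower bound in Mosco
    convergence.

    Upper bound.  Soft thresholding of the values at the atoms approximates a
    function of finite energy, in energy and in L2, by functions that vanish at
    all but finitely many atoms ([finite_support_approx]).  For these the
    harmonic extension lies in the Bessel domain, so that [trace_lam] exceeds
    [max_form] by at most a multiple of [lam] ([finite_support_trace]).  A
    diagonal sequence recovers the limit form ([trace_form_mosco]).  The same
    approximants show that [ran_J] is a core, and lower semicontinuity makes
    the form closed ([trace_form_closure]).  Mosco limits are unique, so the
    statements hold for any trace form.  If the atoms have infinite mass, a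
    square-integrable sequence of finite energy tends to 0
    ([max_form_vanishing]), and [trace_form] is [max_form].

    All of this rests on the fundamental theorem of calculus for absolutely
    continuous functions ([abs_cont_ftc]), obtained from total variation,
    Stieltjes measures and the Radon-Nikodym theorem. *)

Set Implicit Arguments.
Unset Strict Implicit.
Unset Printing Implicit Defensive.
Import Order.TTheory GRing.Theory Num.Theory.
Import numFieldNormedType.Exports.
Local Open Scope classical_set_scope.
Local Open Scope ring_scope.

(** * Integration up to null sets *)

Section ae_integral.
Context d (T : measurableType d) (R : realType).
Variable mu : {measure set T -> \bar R}.
Implicit Types (f g : T -> \bar R) (D : set T).
Import HBNNSimple.

(** No measurability is assumed: a lower integral is a supremum over simple
    functions, and a simple function loses nothing when it is cut off on a
    measurable null set. *)
Lemma le_integralT_ae f g : (forall x, 0 <= f x)%E -> (forall x, 0 <= g x)%E ->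
  {ae mu, forall x, (f x <= g x)%E} ->
  (\int[mu]_x f x <= \int[mu]_x g x)%E.
Proof.
move=> f0 g0 [N [mN N0 fgN]].
rewrite !ge0_integralTE//; apply: ge_ereal_sup => _ [h hf <-].
have mNC : measurable (~` N) by exact: measurableC.
apply: ereal_sup_ubound; exists (proj_nnsfun h mNC).
  move=> x /=; rewrite /proj_nnsfun mindicE; have [xN|xN] := boolP (x \in ~` N).
    rewrite mulr1; apply: le_trans (hf x) _; apply: contrapT => fgx.
    by move: xN; rewrite inE; apply; exact: fgN.
  by rewrite mulr0.
rewrite -!integralT_nnsfun; apply: ae_eq_integral => //.
- by apply/measurable_EFinP; exact: measurable_funP.
- by apply/measurable_EFinP; exact: measurable_funP.
exists N; split => // x /= H; apply: contrapT => Nx; apply: H => _.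
by rewrite /proj_nnsfun/= mindicE mem_set// mulr1.
Qed.

(** The energy integrates [derive1 u], which need not be measurable where [u]
    fails to be differentiable, so that equality almost everywhere has to
    suffice by itself. *)
Lemma ae_congr_integral D f g : {ae mu, forall x, D x -> f x = g x} ->
  (\int[mu]_(x in D) f x = \int[mu]_(x in D) g x)%E.
Proof.
have key (h k : T -> \bar R) : {ae mu, forall x, D x -> h x = k x} ->
    {ae mu, forall x, (h \_ D) x = (k \_ D) x}.
  apply: filterS => x hk.
  by rewrite !patchE; case: ifPn => // /set_mem /hk.
have ge0 (h k : T -> \bar R) : (forall x, 0 <= h x)%E -> (forall x, 0 <= k x)%E ->
    {ae mu, forall x, h x = k x} -> (\int[mu]_x h x = \int[mu]_x k x)%E.
  move=> h0 k0 hk; apply/eqP; rewrite eq_le; apply/andP; split.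
    by apply: le_integralT_ae => //; apply: filterS hk => x ->.
  by apply: le_integralT_ae => //; apply: filterS hk => x ->.
move=> /key fg; rewrite integral_mkcond [RHS]integral_mkcond.
rewrite integralE [RHS]integralE; congr (_ - _)%E; apply: ge0 => //.
  apply: filterS fg => x fgx.
  by rewrite !funeposE fgx.
apply: filterS fg => x fgx.
by rewrite !funenegE fgx.
Qed.

Lemma ae_congr_Rintegral D (f g : T -> R) :
  {ae mu, forall x, D x -> f x = g x} ->
  \int[mu]_(x in D) f x = \int[mu]_(x in D) g x.
Proof.
move=> fg; congr fine; apply: ae_congr_integral.
apply: filterS fg => x fgx Dx.
by rewrite fgx.
Qed.

Lemma ae_eq_integrable D f g : measurable_fun D g -> ae_eq mu D f g ->
  mu.-integrable D f -> mu.-integrable D g.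
Proof.
move=> mg fg /integrableP[mf fi]; apply/integrableP; split => //.
rewrite -(@ae_congr_integral _ (abse \o f))//.
apply: filterS fg => x fgx Dx.
by rewrite /= fgx.
Qed.

Lemma ae_eq_le_integrable D f g : measurable D -> measurable_fun D g ->
  {ae mu, forall x, D x -> (`|g x| <= `|f x|)%E} ->
  mu.-integrable D f -> mu.-integrable D g.
Proof.
move=> mD mg fg /integrableP[mf fi]; apply/integrableP; split => //.
apply: le_lt_trans fi; rewrite integral_mkcond [leRHS]integral_mkcond.
apply: le_integralT_ae => [x|x|].
- by rewrite patchE; case: ifP.
- by rewrite patchE; case: ifP.
apply: filterS fg => x fgx.
by rewrite !patchE; case: ifPn => // /set_mem; exact: fgx.
Qed.

End ae_integral.

(** * Integrals against a density *)

Section density_integral.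
Context {R : realType}.
Variables (w : R -> R) (w_ge0 : forall x, 0 <= w x)
          (mw : measurable_fun setT w).
Local Notation leb := (@lebesgue_measure R).
Local Notation nu := (density w_ge0 mw : {measure set (measurableTypeR R) -> \bar R}).
Implicit Types (D : set (measurableTypeR R)).
Import HBNNSimple.

(** Monotone convergence reduces the identity to indicators of measurable
    sets, where it is the definition of the density. *)
Lemma ge0_integral_density D (f : R -> \bar R) : measurable D ->
  measurable_fun D f -> (forall x, D x -> 0 <= f x)%E ->
  (\int[nu]_(x in D) f x = \int[leb]_(x in D) (f x * (w x)%:E))%E.
Proof.
move=> mD mf f0.
rewrite integral_mkcond [RHS]integral_mkcond.
set g := f \_ D.
have mg : measurable_fun setT g by exact/(measurable_restrictT f mD).
have g0 x : (0 <= g x)%E by rewrite /g patchE; case: ifPn => // /set_mem; exact: f0.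
transitivity (\int[leb]_x (g x * (w x)%:E))%E; last first.
  by apply: eq_integral => x _; rewrite /g !patchE; case: ifPn; rewrite ?mul0e.
have mw' : measurable_fun setT (EFin \o w) by exact/measurable_EFinP.
pose h := nnsfun_approx measurableT mg.
have mh n : measurable_fun setT (EFin \o h n).
  by apply/measurable_EFinP; exact: measurable_funP.
have hg x : g x = lim ((EFin \o h n) x @[n --> \oo]).
  by apply/esym/cvg_lim => //; apply: cvg_nnsfun_approx.
have -> : (\int[nu]_x g x = limn (fun n => \int[nu]_x (EFin \o h n) x))%E.
  rewrite -monotone_convergence//.
  - by apply: eq_integral => x _; exact: hg.
  - by move=> n x _ /=; rewrite lee_fin.
  - by move=> x _ m n mn; rewrite lee_fin; exact/lefP/nd_nnsfun_approx.
have -> : (\int[leb]_x (g x * (w x)%:E) =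
    limn (fun n => \int[leb]_x ((EFin \o h n) x * (w x)%:E)))%E.
  rewrite -monotone_convergence//.
  - apply: eq_integral => x _; apply/esym/cvg_lim => //.
    by apply: cvgeZr => //; exact: cvg_nnsfun_approx.
  - by move=> n; exact: emeasurable_funM.
  - by move=> n x _ /=; rewrite mule_ge0 ?lee_fin.
  - move=> x _ m n mn /=; rewrite lee_wpmul2r ?lee_fin//.
    exact/lefP/nd_nnsfun_approx.
congr (limn _); apply/funext => n.
have -> : (\int[nu]_x (EFin \o h n) x = \int[nu]_x (h n x)%:E)%E by [].
rewrite integralT_nnsfun sintegralE.
transitivity (\int[leb]_x (\sum_(y \in range (h n))
    (y * \1_(h n @^-1` [set y]) x)%:E * (w x)%:E))%E; last first.
  apply: eq_integral => x _.
  rewrite -ge0_mule_fsuml => [|y]; last exact: nnfun_muleindic_ge0.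
  by rewrite fsumEFin // -(fimfunE _ x).
rewrite ge0_integral_fsum//; last 2 first.
  - move=> y; apply: emeasurable_funM => //; apply/measurable_EFinP.
    exact: measurable_funM.
  - by move=> y x _; rewrite mule_ge0 ?lee_fin//; exact: nnfun_muleindic_ge0.
apply: eq_fsbigr => r /set_mem rh.
have r0 : 0 <= r by case: rh => x _ <-.
have mA : measurable (h n @^-1` [set r]) by [].
rewrite /density -ge0_integralZl//; last 2 first.
  - exact: measurable_funTS.
  - by move=> x _; rewrite lee_fin.
rewrite [LHS]integral_mkcond.
apply: eq_integral => x _; rewrite patchE indicE; case: ifPn => _.
  by rewrite mulr1.
by rewrite mulr0 mul0e.
Qed.

Lemma density_null (A : set (measurableTypeR R)) :
  measurable A -> leb A = 0%E -> nu A = 0%E.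
Proof.
move=> mA A0; apply: null_set_integral => //.
by apply/measurable_EFinP; exact: measurable_funTS.
Qed.

Lemma ae_density (P : R -> Prop) :
  {ae leb, forall x, P x} -> {ae nu, forall x, P x}.
Proof.
move=> [N [mN N0 PN]]; exists N; split => //; exact: density_null.
Qed.

Lemma Rintegral_density D (f : R -> R) : measurable D -> measurable_fun D f ->
  leb.-integrable D (EFin \o (fun x => f x * w x)) ->
  \int[nu]_(x in D) f x = \int[leb]_(x in D) (f x * w x).
Proof.
move=> mD mf fi; congr fine.
have mf' : measurable_fun D (EFin \o f) by exact/measurable_EFinP.
rewrite integralE [RHS]integralE; congr (_ - _)%E.
  rewrite ge0_integral_density//; last exact: measurable_funepos.
  apply: eq_integral => x _; rewrite !funeposE.
  by rewrite maxe_pMl// ?lee_fin// mul0e.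
rewrite ge0_integral_density//; last exact: measurable_funeneg.
apply: eq_integral => x _; rewrite !funenegE.
by rewrite maxe_pMl// ?lee_fin// mul0e EFinM mulNe.
Qed.

End density_integral.

(** * Absolutely continuous functions *)

(* Splits the innermost conditional first, so that no branch condition keeps a
   conditional that [lra] cannot read. *)
Ltac minmax := rewrite ?/Order.max ?/Order.min;
  repeat match goal with |- context [if (?x < ?y)%R then _ else _] =>
    lazymatch x with context [if _ then _ else _] => fail | _ =>
    lazymatch y with context [if _ then _ else _] => fail | _ =>
      case: (ltP x y) => ? end end end; lra.

Section abs_cont_basics.
Context {R : realType}.
Implicit Types (A B : set R) (f g : R -> R) (a b : R).

Lemma itvoo_meetP a b c d :
  (`]a, b[ `&` `]c, d[ !=set0) <-> [/\ a < b, a < d, c < b & c < d].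
Proof.
split=> [[x [] /=]|[ab ad cb cd]].
  rewrite !in_itv/= => /andP[ax xb] /andP[cx xd].
  by split; [exact: lt_trans xb|exact: lt_trans xd|exact: lt_trans xb|exact: lt_trans xd].
by exists ((Order.max a c + Order.min b d) / 2); split; rewrite /= in_itv/=; minmax.
Qed.

Lemma itvcc_ends A s t : s <= t -> `[s, t] `<=` A -> A s /\ A t.
Proof. by move=> st stA; split; apply: stA; rewrite /= in_itv/= lexx st. Qed.

Lemma abs_cont_fin A f : abs_cont A f -> forall e, 0 < e -> exists2 d, 0 < d &
  forall (I : finType) (s t : I -> R),
    (forall i, s i <= t i /\ `[s i, t i] `<=` A) ->
    trivIset setT (fun i => `]s i, t i[%classic) ->
    \sum_(i : I) (t i - s i) < d ->
    \sum_(i : I) `|f (t i) - f (s i)| < e.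
Proof.
move=> fA e /fA[d d0 H]; exists d => // I s t stA tst.
have reI (F : I -> R) : \sum_(i : I) F i = \sum_(i < #|I|) F (enum_val i).
  by rewrite -big_enum_val.
rewrite !reI => sd; apply: H => //.
move=> i j _ _ /(tst _ _ Logic.I Logic.I); exact: enum_val_inj.
Qed.

Lemma abs_contS A B f : B `<=` A -> abs_cont A f -> abs_cont B f.
Proof.
move=> BA fA e /fA[d d0 H]; exists d => // n s t st; apply: H => i.
by have [? stB] := st i; split=> //; exact: subset_trans stB BA.
Qed.

(** A nondecreasing contraction maps disjoint cells to disjoint cells of no
    greater total length. *)
Lemma abs_cont_comp A B f (phi : R -> R) : abs_cont A f ->
  {homo phi : x y / x <= y} ->
  (forall x y, x <= y -> phi y - phi x <= y - x) ->
  (forall x y, `[x, y] `<=` B -> `[phi x, phi y] `<=` A) ->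
  abs_cont B (f \o phi).
Proof.
move=> fA ndphi phi1 phiBA e /fA[d d0 H]; exists d => // n s t st tst sd.
have phi_lt x y : phi x < phi y -> x < y.
  by move=> xy; rewrite ltNge; apply/negP => /ndphi; rewrite leNgt xy.
apply: H.
- by move=> i; have [sti Bi] := st i; split; [exact: ndphi|exact: phiBA].
- move=> i j _ _ /itvoo_meetP[/phi_lt ? /phi_lt ? /phi_lt ? /phi_lt ?].
  by apply: (tst i j) => //; exact/itvoo_meetP.
- by apply: le_lt_trans sd; apply: ler_sum => i _; apply: phi1; case: (st i).
Qed.

Lemma abs_cont_le2 A f g h : abs_cont A f -> abs_cont A g ->
  (exists2 M, 0 < M & forall x y, x <= y -> `[x, y] `<=` A ->
     `|h y - h x| <= M * (`|f y - f x| + `|g y - g x|)) ->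
  abs_cont A h.
Proof.
move=> fA gA [M M0 hM] e e0.
have eM : 0 < e / (2 * M) by rewrite divr_gt0// mulr_gt0.
have [d d0 Hf] := fA _ eM; have [d' d'0 Hg] := gA _ eM.
exists (Num.min d d'); first by rewrite lt_min d0.
move=> n s t st tst; rewrite lt_min => /andP[sd sd'].
have := Hf _ _ _ st tst sd; have := Hg _ _ _ st tst sd' => Hg' Hf'.
apply: (@le_lt_trans _ _ (M * (\sum_i `|f (t i) - f (s i)| + \sum_i `|g (t i) - g (s i)|))).
  rewrite -big_split/= mulr_sumr; apply: ler_sum => i _.
  by have [? ?] := st i; exact: hM.
rewrite (_ : e = M * (e / (2 * M) + e / (2 * M))); last by field; rewrite gt_eqF.
by rewrite ltr_pM2l// ltrD.
Qed.

Lemma abs_contD A f g : abs_cont A f -> abs_cont A g -> abs_cont A (f \+ g).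
Proof.
move=> fA gA; apply: (abs_cont_le2 fA gA); exists 1 => // x y _ _; rewrite mul1r/=.
by rewrite (_ : _ - _ = (f y - f x) + (g y - g x)); [exact: ler_normD|ring].
Qed.

Lemma abs_contB A f g : abs_cont A f -> abs_cont A g -> abs_cont A (f \- g).
Proof.
move=> fA gA; apply: (abs_cont_le2 fA gA); exists 1 => // x y _ _; rewrite mul1r/=.
by rewrite (_ : _ - (_ - _) = (f y - f x) - (g y - g x)); [exact: ler_normB|ring].
Qed.

Lemma abs_cont_eq A f g : {in A, f =1 g} -> abs_cont A f -> abs_cont A g.
Proof.
move=> fg fA; apply: (abs_cont_le2 fA fA); exists 1 => // x y xy xyA.
by have [Ax Ay] := itvcc_ends xy xyA; rewrite mul1r -!fg ?lerDl// inE.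
Qed.

Lemma abs_contM A f g (M : R) : abs_cont A f -> abs_cont A g ->
  (forall x, A x -> `|f x| <= M) -> (forall x, A x -> `|g x| <= M) ->
  abs_cont A (f \* g).
Proof.
move=> fA gA fM gM; apply: (abs_cont_le2 fA gA); exists (Num.max M 1).
  by rewrite lt_max ltr01 orbT.
move=> x y xy xyA /=.
rewrite (_ : _ - _ = g y * (f y - f x) + f x * (g y - g x)); last by ring.
have [Ax Ay] := itvcc_ends xy xyA.
apply: (le_trans (ler_normD _ _)); rewrite [X in _ <= X]mulrDr !normrM lerD// ler_wpM2r//.
  by rewrite le_max gM.
by rewrite le_max fM.
Qed.

Lemma lipschitz_abs_cont A f (M : R) :
  (forall x y, x <= y -> `[x, y] `<=` A -> `|f y - f x| <= M * (y - x)) ->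
  abs_cont A f.
Proof.
move=> fM.
have idA : abs_cont A (@idfun R).
  move=> e e0; exists e => // n s t st _; apply: le_lt_trans.
  by apply: ler_sum => i _; rewrite ger0_norm// subr_ge0; case: (st i).
apply: (abs_cont_le2 idA idA); exists (Num.max M 1).
  by rewrite lt_max ltr01 orbT.
move=> x y xy xyA /=; apply: (le_trans (fM _ _ xy xyA)).
rewrite ger0_norm ?subr_ge0//.
have : M <= Num.max M 1 by rewrite le_max lexx.
have : 1 <= Num.max M 1 by rewrite le_max lexx orbT.
move: (Num.max M 1) => K; have : 0 <= y - x by rewrite subr_ge0.
by move=> *; nra.
Qed.

(** [f x = f (min x b) + f (max x b) - f b], and both clampings are
    contractions. *)
Lemma abs_cont_glue a b c f : a <= b -> b <= c ->
  abs_cont `[a, b] f -> abs_cont `[b, c] f -> abs_cont `[a, c] f.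
Proof.
move=> ab bc fab fbc.
have f1 : abs_cont `[a, c] (f \o (fun x => Num.min x b)).
  apply: abs_cont_comp fab _ _ _ => [x y xy|x y xy|x y].
  - by minmax.
  - by minmax.
  case: (leP x y) => [xy xyac z|yx _ z]; last by rewrite /= !in_itv/=; minmax.
  by have [] := itvcc_ends xy xyac; rewrite /= !in_itv/=; minmax.
have f2 : abs_cont `[a, c] (f \o (fun x => Num.max x b)).
  apply: abs_cont_comp fbc _ _ _ => [x y xy|x y xy|x y].
  - by minmax.
  - by minmax.
  case: (leP x y) => [xy xyac z|yx _ z]; last by rewrite /= !in_itv/=; minmax.
  by have [] := itvcc_ends xy xyac; rewrite /= !in_itv/=; minmax.
have f3 : abs_cont `[a, c] (cst (f b)).
  by apply: (@lipschitz_abs_cont _ _ 0) => x y _ _; rewrite subrr normr0 mul0r.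
apply: abs_cont_eq (abs_contB (abs_contD f1 f2) f3) => x _ /=.
by case: (leP x b) => _; ring.
Qed.

(** A single cell already tests continuity. *)
Lemma abs_cont_unif a b f : abs_cont `[a, b] f -> forall e, 0 < e ->
  exists2 d, 0 < d & forall x y, a <= x <= b -> a <= y <= b -> `|x - y| < d ->
    `|f x - f y| < e.
Proof.
move=> /abs_cont_fin fab e /fab[d d0 H]; exists d => // x y.
wlog xy : x y / x <= y => [hw xab yab|].
  case/orP: (le_total x y) => xy; first exact: hw.
  by rewrite distrC [in X in _ -> X]distrC; exact: hw.
move=> /andP[ax xb] /andP[ay yb]; rewrite ler0_norm ?subr_le0// opprB => xyd.
have := H unit (fun=> x) (fun=> y); rewrite !big_const !card_unit/= !addr0 distrC.
apply => //.
- move=> _; split=> // z; rewrite /= !in_itv/=; lra.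
- by move=> [] [].
Qed.

Lemma abs_cont_continuous a b f : abs_cont `[a, b] f ->
  {within `[a, b], continuous f}.
Proof.
move=> /abs_cont_unif fab; apply/subspace_continuousP => x /= xab.
apply/cvgrPdist_lt => e /fab[d d0 H].
rewrite near_withinE; near=> y => yab; apply: H.
- by move: xab; rewrite in_itv.
- by move: yab; rewrite /= in_itv.
- by near: y; exact: cvgr_dist_lt.
Unshelve. all: by end_near. Qed.

Lemma abs_cont_bounded a b f : abs_cont `[a, b] f ->
  exists M, forall x, x \in `[a, b] -> `|f x| <= M.
Proof.
case: (leP a b) => [ab fab|ba _]; last first.
  by exists 0 => x; rewrite in_itv/=; lra.
have cf := abs_cont_continuous fab.
have [c _ Hc] := EVT_max ab cf; have [c' _ Hc'] := EVT_min ab cf.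
exists (Num.max `|f c| `|f c'|) => x xab.
have := Hc _ xab; have := Hc' _ xab.
rewrite le_max !ler_norml.
have := ler_norm (f c); have := lerNnormlW (lexx `|f c'|).
lra.
Qed.

Lemma abs_contM_itv a b f g : abs_cont `[a, b] f -> abs_cont `[a, b] g ->
  abs_cont `[a, b] (f \* g).
Proof.
move=> fab gab.
have [M HM] := abs_cont_bounded fab; have [M' HM'] := abs_cont_bounded gab.
apply: (@abs_contM _ _ _ (Num.max M M')) => // x xab.
  by rewrite le_max HM.
by rewrite le_max HM'// orbT.
Qed.

End abs_cont_basics.

(** * Total variation of an absolutely continuous function *)

Section total_variation.
Context {R : realType}.
Implicit Types (f : R -> R) (a b : R).

Lemma itv_partition_nth_homo a b (l : seq R) : itv_partition a b l ->
  {homo nth b (a :: l) : i j / (i <= j)%N >-> i <= j}.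
Proof.
move=> abl; have [pl /eqP lb] := abl.
apply: (homo_leq lexx le_trans) => i; case: (ltnP i (size l)) => il.
  by move/(pathP b) : pl => /(_ _ il) /ltW.
rewrite [X in _ <= X]nth_default//= (_ : nth _ _ _ = b)//.
move: il; rewrite leq_eqVlt => /predU1P[<-|il].
  by rewrite -last_nth lb.
by rewrite nth_default.
Qed.

Lemma itv_partition_nth_last a b (l : seq R) m : itv_partition a b l ->
  (size l <= m)%N -> nth b (a :: l) m = b.
Proof.
move=> [pl /eqP lb]; rewrite leq_eqVlt => /predU1P[<-|il].
  by rewrite -last_nth lb.
by rewrite nth_default.
Qed.

Lemma variation_ord a b f l m : itv_partition a b l -> (size l <= m)%N ->
  variation a b f l =
  \sum_(j < m) `|f (nth b (a :: l) j.+1) - f (nth b (a :: l) j)|.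
Proof.
move=> abl lm; rewrite /variation -(big_mkord xpredT (fun j => `|f (nth b (a :: l) j.+1) - f (nth b (a :: l) j)|)).
rewrite (big_cat_nat (leq0n _) lm)//= [X in _ = _ + X]big_nat_cond [X in _ = _ + X]big1 ?addr0//.
move=> j /andP[/andP[lj jm] _].
rewrite (itv_partition_nth_last abl lj).
by have /= -> := itv_partition_nth_last abl (leqW lj); rewrite subrr normr0.
Qed.

(** Partitions of the cells of a family, padded to a common length by
    repeating right ends, make up a single family of cells of the same total
    length. *)
Lemma variation_family a b f e d :
  (forall (I : finType) (s t : I -> R),
    (forall i, s i <= t i /\ `[s i, t i] `<=` `[a, b]) ->
    trivIset setT (fun i => `]s i, t i[%classic) ->
    \sum_(i : I) (t i - s i) < d ->
    \sum_(i : I) `|f (t i) - f (s i)| < e) ->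
  forall n (s t : 'I_n -> R) (l : 'I_n -> seq R),
    (forall i, s i <= t i /\ `[s i, t i] `<=` `[a, b]) ->
    trivIset setT (fun i => `]s i, t i[%classic) ->
    \sum_i (t i - s i) < d ->
    (forall i, itv_partition (s i) (t i) (l i)) ->
    \sum_i variation (s i) (t i) f (l i) < e.
Proof.
move=> H n s t l st tst sd sl.
pose m := \max_i size (l i).
have lm i : (size (l i) <= m)%N by exact: leq_bigmax.
pose p (i : 'I_n) j := nth (t i) (s i :: l i) j.
have ndp i := itv_partition_nth_homo (sl i).
have p0 i : p i 0%N = s i by [].
have pm i : p i m = t i by exact: itv_partition_nth_last.
have pst i j : s i <= p i j <= t i.
  rewrite -{1}(p0 i) ndp//= -(pm i); case: (leqP j m) => jm; first exact: ndp.
  by rewrite {1}/p (itv_partition_nth_last (sl i)) ?pm// (leq_trans (lm i))// ltnW.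
under eq_bigr do rewrite (variation_ord f (sl _) (lm _)).
rewrite pair_bigA/=; apply: (H ('I_n * 'I_m)%type (fun ij => p ij.1 ij.2) (fun ij => p ij.1 ij.2.+1)) => [[i j]|[i j] [i' j'] _ _|].
- have [sti stA] := st i; split; first exact: (ndp i).
  apply: subset_trans stA => x; rewrite /= !in_itv/=.
  by have := pst i j; have := pst i j.+1; rewrite /p; lra.
- move=> /itvoo_meetP [h1 h2 h3 h4].
  change (is_true (p i j < p i j.+1)) in h1; change (is_true (p i j < p i' j'.+1)) in h2.
  change (is_true (p i' j' < p i j.+1)) in h3; change (is_true (p i' j' < p i' j'.+1)) in h4.
  have ii : i = i'.
    apply: tst => //; apply/itvoo_meetP.
    have := pst i j; have := pst i j.+1; have := pst i' j'; have := pst i' j'.+1.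
    by move=> *; split; lra.
  rewrite -ii in h2 h3 h4 *; congr (_, _); apply/val_inj => /=.
  apply/eqP; rewrite eqn_leq; apply/andP; split; rewrite leqNgt; apply/negP.
    by move=> /(ndp i); rewrite leNgt => /negP; apply.
  by move=> /(ndp i); rewrite leNgt => /negP; apply.
- rewrite -(pair_bigA _ (fun i (j : 'I_m) => p i (nat_of_ord j).+1 - p i j))/=.
  apply: le_lt_trans sd; apply: ler_sum => i _.
  by rewrite -(big_mkord xpredT (fun j => p i j.+1 - p i j)) telescope_sumr// pm p0.
Qed.

(** Partitions that are optimal up to [r / n.+1] in each of the [n] cells lose
    at most [r] in total. *)
Lemma total_variation_family a b f : abs_cont `[a, b] f ->
  forall e, 0 < e -> exists2 d, 0 < d & forall n (s t : 'I_n -> R),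
    (forall i, s i <= t i /\ `[s i, t i] `<=` `[a, b]) ->
    trivIset setT (fun i => `]s i, t i[%classic) ->
    \sum_i (t i - s i) < d ->
    (\sum_i total_variation (s i) (t i) f <= e%:E)%E.
Proof.
move=> /abs_cont_fin fab e /fab[d d0 /variation_family H]; exists d => // n s t st tst sd.
have TV1 i : (total_variation (s i) (t i) f <= e%:E)%E.
  apply: ge_ereal_sup => _ [_ [l sl <-] <-]; rewrite lee_fin ltW//.
  have := H 1%N (fun=> s i) (fun=> t i) (fun=> l); rewrite !big_ord1; apply => //.
    by move=> u v _ _ _; rewrite (ord1 u) (ord1 v).
  apply: le_lt_trans sd; rewrite (bigD1 i)//= lerDl sumr_ge0// => j _.
  by rewrite subr_ge0; case: (st j).
apply/lee_addgt0Pr => r r0.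
have rn : 0 < r / n.+1%:R by rewrite divr_gt0.
have : forall i, exists l, itv_partition (s i) (t i) l /\
    (total_variation (s i) (t i) f <= (variation (s i) (t i) f l)%:E + (r / n.+1%:R)%:E)%E.
  move=> i; have TVfin : total_variation (s i) (t i) f \is a fin_num.
    rewrite ge0_fin_numE; last by apply: total_variation_ge0; case: (st i).
    exact: le_lt_trans (TV1 i) (ltry _).
  have [_ [_ [l sl <-] <-] lt] := ub_ereal_sup_adherent rn TVfin.
  by exists l; split=> //; rewrite -leeBlDr//; exact: ltW.
move=> /choice[l Hl].
apply: (@le_trans _ _ (\sum_(i < n) ((variation (s i) (t i) f (l i))%:E + (r / n.+1%:R)%:E))%E).
  by apply: lee_sum => i _; case: (Hl i).
rewrite big_split/= sumEFin sumEFin -EFinD -EFinD lee_fin lerD//.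
  by apply/ltW/H => // i; case: (Hl i).
rewrite sumr_const card_ord -[leLHS]mulr_natr -mulrA ger_pMr// mulrC ler_pdivrMr//.
by rewrite mul1r ler_nat.
Qed.

(** Cells of length below [d] have variation at most 1, and finitely many of
    them cover the interval. *)
Lemma abs_cont_TV_fin a b f : abs_cont `[a, b] f ->
  forall x y, a <= x -> x <= y -> y <= b -> total_variation x y f \is a fin_num.
Proof.
move=> /total_variation_family /(_ _ ltr01) [d d0 H] x y ax xy yb.
rewrite ge0_fin_numE ?total_variation_ge0//.
have short u v : a <= u -> u <= v -> v <= b -> v - u < d -> (total_variation u v f <= 1%:E)%E.
  move=> au uv vb uvd.
  have := H 1%N (fun=> u) (fun=> v); rewrite !big_ord1; apply => //.
    by move=> _; split=> // z; rewrite /= !in_itv/=; lra.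
  by move=> i j _ _ _; rewrite (ord1 i) (ord1 j).
have [n] : exists n, y - x <= n%:R * (d / 2).
  exists (Num.bound ((y - x) / (d / 2))).
  rewrite -ler_pdivrMr ?divr_gt0//; apply/ltW/archi_boundP.
  by rewrite divr_ge0// ?subr_ge0// divr_ge0// ltW.
elim: n y xy yb => [|n IH] y xy yb.
  rewrite mul0r subr_le0 => yx; have <- : x = y by lra.
  by rewrite total_variationxx ltry.
rewrite -natr1 mulrDl mul1r => xyn.
have [ydx|xyd] := leP (y - d / 2) x.
  by rewrite (le_lt_trans (short x y _ _ _ _)) ?ltry//; lra.
rewrite (@total_variationD _ _ _ (y - d / 2)); [|lra|lra].
apply: lte_add_pinfty.
  by apply: IH; lra.
by rewrite (le_lt_trans (short _ y _ _ _ _)) ?ltry//; lra.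
Qed.

Lemma total_variation_abs_cont a b f : abs_cont `[a, b] f ->
  abs_cont `[a, b] (fun x => fine (total_variation a x f)).
Proof.
move=> fab e e0; have e2 : 0 < e / 2 by rewrite divr_gt0.
have [d d0 H] := total_variation_family fab e2; exists d => // n s t st tst sd.
have stab i : a <= s i /\ t i <= b.
  have [sti stA] := st i; have [] := itvcc_ends sti stA.
  by rewrite /= !in_itv/=; lra.
have fTV := abs_cont_TV_fin fab.
apply: (@le_lt_trans _ _ (e / 2)); last by lra.
rewrite -lee_fin; apply: le_trans (H _ _ _ st tst sd).
rewrite -sumEFin; apply: lee_sum => i _.
have [[sti _] [asi tib]] := (st i, stab i).
have sib : s i <= b by lra.
have ati : a <= t i by lra.
have -> : fine (total_variation a (t i) f) - fine (total_variation a (s i) f) =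
    fine (total_variation (s i) (t i) f).
  rewrite (@total_variationD _ a (t i) (s i))// fineD; [|exact: fTV|exact: fTV].
  by rewrite addrC addrA addNr add0r.
by rewrite ger0_norm ?fineK ?fTV// fine_ge0// total_variation_ge0.
Qed.

End total_variation.

(** * Stieltjes measures of absolutely continuous functions *)

Section stieltjes.
Context {R : realType}.
Implicit Types (a b : R) (f : R -> R).
Local Notation leb := (@lebesgue_measure R).

Lemma stieltjes_ocitv (W : cumulative R R) x y : x <= y ->
  lebesgue_stieltjes_measure W `]x, y] = (W y - W x)%:E.
Proof.
move=> xy; rewrite /lebesgue_stieltjes_measure/= /measure_extension.
by rewrite measurable_mu_extE/= ?wlength_itv_bnd//; exact: is_ocitv.
Qed.

Lemma is_interval_open_bounded (I : set R) : open I -> is_interval I ->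
  I !=set0 -> has_sup I -> has_inf I ->
  [/\ inf I <= sup I, `]inf I, sup I[ `<=` I & I `<=` `]inf I, sup I] ].
Proof.
move=> oI iI I0 sI nI.
have lI x : I x -> inf I <= x <= sup I by move=> Ix; rewrite ge_inf ?ub_le_sup//; [case: sI|case: nI].
split.
- by case: I0 => x /lI; lra.
- move=> x; rewrite /= in_itv/= => /andP[ix xs].
  have [y Iy yx] := inf_lt I0 ix; have [z Iz xz] := sup_gt I0 xs.
  by apply: (iI y z) => //; rewrite !ltW.
- move=> x Ix; have := lI x Ix; rewrite /= in_itv/= => /andP[+ ->].
  rewrite le_eqVlt => /predU1P[ix|->//].
  have /open_nbhs_nbhs/nbhs_ballP[e /= e0 He] : open_nbhs x I by split.
  have : I (x - e / 2).
    by apply: He; rewrite /ball/= opprB addrC subrK gtr0_norm; lra.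
  by move=> /lI; lra.
Qed.

(** Outer regularity puts the null set inside an open set of small Lebesgue
    measure; the components of the open set are the cells on which absolute
    continuity of [W] is used. *)
Lemma stieltjes_null (W : cumulative R R) a b (A : set (measurableTypeR R)) :
  abs_cont setT W -> measurable A -> leb A = 0%E -> A `<=` `]a, b] ->
  lebesgue_stieltjes_measure W A = 0%E.
Proof.
move=> Wac mA A0 Aab; pose nu : {measure set (measurableTypeR R) -> \bar R} := lebesgue_stieltjes_measure W.
change (nu A = 0%E).
apply/eqP; rewrite -measure_le0; apply/lee_addgt0Pr => e e0; rewrite add0e.
have [d d0 H] := Wac _ e0.
have [U [oU AU UAd]] : exists U : set R, [/\ open U, A `<=` U & (leb (U `\` A) < d%:E)%E].
  apply: lebesgue_regularity_outer => //.
  apply: (@le_lt_trans _ _ 0%E); last exact: ltry.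
  by rewrite le_eqVlt; apply/orP; left; apply/eqP; exact: A0.
have mU : measurable (U : set (measurableTypeR R)) by exact: open_measurable.
pose V := U `&` `]a - 1, b + 1[%classic.
have oV : open V by apply: openI => //; exact: interval_open.
have mV : measurable (V : set (measurableTypeR R)) by exact: open_measurable.
have AV : A `<=` V.
  by move=> x Ax; split; [exact: AU|move: (Aab _ Ax); rewrite /= !in_itv/=; lra].
have Vd : (leb V < d%:E)%E.
  rewrite -(setDUK AV) setUC measureU0//; last exact: measurableD.
  apply: (le_lt_trans _ UAd); apply: le_measure; rewrite ?inE//.
  - exact: measurableD.
  - exact: measurableD.
  - by apply: setSD => x [].
pose I := open_disjoint_itv oV.
have IV q : I q `<=` V by rewrite [X in _ `<=` X](open_disjoint_itv_bigcup oV); exact: bigcup_sup.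
have mI q : measurable (I q : set (measurableTypeR R)).
  by apply: open_measurable; exact: open_disjoint_itv_open.
have tI : trivIset setT I := @open_disjoint_itv_trivIset _ _ oV.
have : forall q, exists st : R * R,
    [/\ st.1 <= st.2, `]st.1, st.2[ `<=` I q, ((st.2 - st.1)%:E <= leb (I q))%E
      & (nu (I q) <= (W st.2 - W st.1)%:E)%E].
  move=> q; have [->|/set0P I0] := eqVneq (I q) set0.
    by exists (0, 0); split; rewrite /= ?subrr ?set_itvoo0 ?measure0.
  have Iab x : I q x -> a - 1 <= x <= b + 1.
    by move=> /IV[_]; rewrite /= in_itv/=; lra.
  have sI : has_sup (I q) by split=> //; exists (b + 1) => x /Iab; lra.
  have nI : has_inf (I q) by split=> //; exists (a - 1) => x /Iab; lra.
  have [st stI Ist] := is_interval_open_bounded (@open_disjoint_itv_open _ _ oV q)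
    (@open_disjoint_itv_is_interval _ _ oV q) I0 sI nI.
  exists (inf (I q), sup (I q)); split => //=.
    apply: (@le_trans _ _ (leb `]inf (I q), sup (I q)[)); last first.
      by apply: le_measure; rewrite ?inE//.
    rewrite lebesgue_measure_itv/= lte_fin; case: ltP => // ts.
    by rewrite lee_fin subr_le0.
  rewrite -stieltjes_ocitv//; apply: le_measure; rewrite ?inE//.
move=> /choice[st Hst].
have sumI (m : {measure set (measurableTypeR R) -> \bar R}) n :
    ((\sum_(q < n) m (I q))%R <= m V)%E.
  rewrite (open_disjoint_itv_bigcup oV) (measure_bigcup m setT I (fun q _ => mI q) tI).
  rewrite -(big_mkord xpredT (fun q => m (I q))).
  rewrite (eq_eseriesl (Q := xpredT)); last by move=> q; rewrite in_setT.
  exact: nneseries_lim_ge.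
have sumV n : ((\sum_(q < n) nu (I q))%R <= e%:E)%E.
  apply: (@le_trans _ _ (\sum_(q < n) (W (st q).2 - W (st q).1)%:E)%R).
    by apply: lee_sum => q _; case: (Hst q).
  rewrite sumEFin lee_fin ltW//.
  apply: le_lt_trans (H n (fun q => (st q).1) (fun q => (st q).2) _ _ _).
  - by apply: ler_sum => q _; rewrite ler_norm.
  - by move=> q; have [] := Hst q.
  - move=> q q' _ _ [x [xq xq']]; apply/val_inj/tI => //.
    by exists x; split; [have [_ + _ _] := Hst q; exact|have [_ + _ _] := Hst q'; exact].
  - rewrite -lte_fin -sumEFin; apply: le_lt_trans Vd; apply: le_trans (sumI _ n).
    by apply: lee_sum => q _; case: (Hst q).
apply: (@le_trans _ _ (nu V)); first by apply: le_measure; rewrite ?inE.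
rewrite (open_disjoint_itv_bigcup oV) (measure_bigcup nu setT I (fun q _ => mI q) tI).
rewrite (eq_eseriesl (Q := xpredT)); last by move=> q; rewrite in_setT.
apply: lime_le; first by apply: is_cvg_nneseries => q _ _; exact: measure_ge0.
by apply: nearW => n; rewrite big_mkord.
Qed.

(** Clamping the argument extends [f] to a bounded nondecreasing [W] on the
    line. Its Stieltjes measure is dominated by Lebesgue measure, and the
    density is given by the Radon-Nikodym theorem. *)
Lemma stieltjes_density a b f : a < b -> abs_cont `[a, b] f ->
  {in `[a, b] &, {homo f : x y / x <= y}} ->
  exists2 g : R -> R, leb.-integrable setT (EFin \o g) &
    forall x y, a <= x -> x <= y -> y <= b ->
      (f y - f x)%:E = (\int[leb]_(z in `]x, y]) (g z)%:E)%E.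
Proof.
move=> ab fac ndf.
pose W x := f (Num.max a (Num.min x b)).
have Wf x : a <= x -> x <= b -> W x = f x.
  by move=> ax xb; rewrite /W min_l// max_r.
have ndW : {homo W : x y / x <= y}.
  move=> x y xy; apply: ndf; rewrite ?in_itv/=.
  - by rewrite le_max lexx/= ge_max ltW//= ge_min lexx orbT.
  - by rewrite le_max lexx/= ge_max ltW//= ge_min lexx orbT.
  by minmax.
have Wac : abs_cont setT W.
  have fb : abs_cont [set x | x <= b] (f \o (fun x => Num.max a x)).
    apply: abs_cont_comp fac _ _ _ => [x y xy|x y xy|x y xyb z]; try by minmax.
    rewrite /= !in_itv/=; have [xy|yx] := leP x y; last by minmax.
    by have [_ /=] := itvcc_ends xy xyb; minmax.
  apply: (abs_cont_comp (phi := fun x => Num.min x b) fb) => [x y xy|x y xy|x y _ z].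
  - by minmax.
  - by minmax.
  - by rewrite /= !in_itv/=; minmax.
have rcW : right_continuous W.
  apply: right_continuousW => x.
  have /abs_cont_unif Wx : abs_cont `[x - 1, x + 1] W by apply: abs_contS Wac.
  apply/cvgrPdist_lt => e /Wx[d d0 Hd].
  near=> y; apply: Hd; first by lra.
    have : `|x - y| < 1 by near: y; exact: cvgr_dist_lt.
    by rewrite ltr_norml; lra.
  by near: y; exact: cvgr_dist_lt.
pose cW := isCumulative.Build _ _ _ W ndW rcW.
pose CW : cumulative R R := HB.pack W cW.
pose nu := lebesgue_stieltjes_measure CW.
have mab : measurable (`]a, b]%classic : set (measurableTypeR R)) by exact: measurable_itv.
have nuab : (nu `]a, b]%classic < +oo)%E by rewrite /nu stieltjes_ocitv ?ltry ?ltW.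
pose nu' : {finite_measure set (measurableTypeR R) -> \bar R} := mfrestr mab nuab.
have : nu' `<< leb.
  apply/null_content_dominatesP => A mA A0; rewrite /nu'/= /mfrestr/mrestr.
  apply: (@stieltjes_null CW a b) => //.
  - exact: measurableI.
  - by apply/eqP; rewrite -measure_le0 -A0; apply: le_measure; rewrite ?inE//; exact: measurableI.
move=> /radon_nikodym_sigma_finite[g [g0 gfin gint gE]].
exists (fine \o g).
  by apply: eq_integrable gint => // x _ /=; rewrite fineK.
move=> x y ax xy yb; rewrite -(@Wf x) ?(le_trans xy)// -(@Wf y) ?(le_trans ax)//.
rewrite -(@stieltjes_ocitv CW)//.
have -> : lebesgue_stieltjes_measure CW `]x, y]%classic = nu' `]x, y]%classic.
  rewrite /nu'/= /mfrestr/mrestr; congr (lebesgue_stieltjes_measure _ _).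
  by rewrite setIidl// => z; rewrite /= !in_itv/=; lra.
rewrite gE//.
by apply: eq_integral => z _ /=; rewrite fineK.
Unshelve. all: by end_near. Qed.

End stieltjes.

(** * The fundamental theorem of calculus *)

Section ftc_abs_cont.
Context {R : realType}.
Implicit Types (a b : R) (f u G : R -> R).
Local Notation leb := (@lebesgue_measure R).

Lemma ae_neq (r : R) : {ae leb, forall z, z != r}.
Proof.
exists [set r]; split; [exact: measurable_set1|exact: lebesgue_measure_set1|].
by move=> z /= /negP; rewrite negbK => /eqP.
Qed.

Lemma ae_itvcc (s t : R) (Q : R -> Prop) : {ae leb, forall x, s < x < t -> Q x} ->
  {ae leb, forall x, `[s, t]%classic x -> Q x}.
Proof.
move: (ae_neq s) (ae_neq t); apply: filterS3; first exact: (ae_filter_ringOfSetsType leb).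
move=> x xs xt H /=; rewrite in_itv/= => /andP[sx xt']; apply: H.
by rewrite !lt_neqAle eq_sym xs sx xt xt'.
Qed.

Lemma near_eq_derive1 f g (x : R) : (\near x, f x = g x) -> derive1 f x = derive1 g x.
Proof. by move=> fg; rewrite !derive1E; exact: near_eq_derive. Qed.

Lemma derive1_near_shift f F (x c l : R) : derivable F x 1 -> derive1 F x = l ->
  (\near x, F x + c = f x) -> derivable f x 1 /\ derive1 f x = l.
Proof.
move=> dF Fl Ff.
have dFc : derivable (F \+ cst c) x 1 by apply: derivableD => //; exact: derivable_cst.
split; first exact: near_eq_derivable Ff dFc.
by rewrite -(near_eq_derive1 Ff) derive1E deriveD// derive_cst addr0 -derive1E.
Qed.

(** With [T] the total variation of [f] from [a], both [T] and [T - f] are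
    nondecreasing and absolutely continuous, hence have densities. The
    difference of the densities is the derivative almost everywhere by
    Lebesgue's differentiation theorem. *)
Lemma abs_cont_ftc a b f : a < b -> abs_cont `[a, b] f ->
  exists g, [/\ leb.-integrable setT (EFin \o g),
    forall x y, a <= x -> x <= y -> y <= b ->
      f y - f x = \int[leb]_(z in `]x, y]) g z &
    {ae leb, forall x, a < x < b -> derivable f x 1 /\ derive1 f x = g x}].
Proof.
move=> ab fab.
pose T x := fine (total_variation a x f).
have fTV := abs_cont_TV_fin fab.
have Tac : abs_cont `[a, b] T by exact: total_variation_abs_cont.
have TD x y : a <= x -> x <= y -> y <= b -> T y - T x = fine (total_variation x y f).
  move=> ax xy yb.
  rewrite /T (@total_variationD _ a y x)// fineD; [|apply: fTV; lra|apply: fTV; lra].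
  by rewrite addrC addrA addNr add0r.
have Tge x y : a <= x -> x <= y -> y <= b -> `|f y - f x| <= T y - T x.
  move=> ax xy yb; rewrite TD// -lee_fin fineK; last exact: fTV.
  exact: total_variation_ge.
have ndT : {in `[a, b] &, {homo T : x y / x <= y}}.
  move=> x y; rewrite !in_itv/= => xab yab xy; rewrite -subr_ge0.
  by apply: le_trans (Tge x y _ _ _) => //; lra.
have ndN : {in `[a, b] &, {homo (T \- f) : x y / x <= y}}.
  move=> x y; rewrite !in_itv/= => xab yab xy.
  have : `|f y - f x| <= T y - T x by apply: Tge => //; lra.
  by rewrite ler_norml; lra.
have [g1 g1i g1E] := stieltjes_density ab Tac ndT.
have [g2 g2i g2E] := stieltjes_density ab (abs_contB Tac fab) ndN.
pose g x := g1 x - g2 x.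
have gi : leb.-integrable setT (EFin \o g) by exact: (@integrableB _ _ _ _ _ measurableT _ _ g1i g2i).
have sub (A : set (measurableTypeR R)) h : measurable A -> leb.-integrable setT h -> leb.-integrable A h.
  by move=> mA; exact: integrableS.
have fE x y : a <= x -> x <= y -> y <= b -> f y - f x = \int[leb]_(z in `]x, y]) g z.
  move=> ax xy yb; rewrite RintegralB//; [|exact: sub|exact: sub].
  have -> : \int[leb]_(z in `]x, y]) g1 z = T y - T x.
    by rewrite /Rintegral -g1E.
  have -> : \int[leb]_(z in `]x, y]) g2 z = (T y - f y) - (T x - f x).
    by rewrite /Rintegral -g2E.
  by ring.
exists g; split => //.
have locg : locally_integrable setT g.
  by have := @integrable_locally _ g setT measurableT gi; rewrite patch_setT.
have := @FTC1Ny _ g (fun y => sub _ _ (measurable_itv _) gi) locg.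
apply: filterS; first exact: (ae_filter_ringOfSetsType leb).
move=> x [dF FE] /andP[ax xb].
set F := (fun x => _) in dF FE.
apply: (derive1_near_shift (c := f a - F a) dF FE).
near=> y.
have ay : a < y by near: y; exact: lt_nbhsr.
have yb : y < b by near: y; exact: lt_nbhsl.
have := fE a y (lexx _) (ltW ay) (ltW yb).
rewrite -(@Rintegral_itvB _ g -oo%O (BRight y) a)//=; [|exact: sub|by rewrite bnd_simp ltW].
rewrite -/(F y) -/(F a) => h; clear -h; move: (F y) (F a) (f y) (f a) h => *; lra.
Unshelve. all: by end_near. Qed.

(** Equal to the derivative wherever that exists, and Borel when [f] is. *)
Definition dini f x : R :=
  fine (limn_esup (fun n => (n.+1%:R * (f (x + n.+1%:R^-1) - f x))%:E)).

Lemma diniE f (x : R) : derivable f x 1 -> derive1 f x = dini f x.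
Proof.
move=> df; rewrite /dini derive1E.
have u0 : (n.+1%:R^-1 : R) @[n --> \oo] --> (0 : R)^'.
  move=> A; rewrite /dnbhs /within /= => HA.
  have : \forall n \near \oo, (n.+1%:R^-1 : R) != 0 -> A (n.+1%:R^-1).
    exact: (@cvg_harmonic R _ HA).
  by apply: filterS => n; apply; rewrite invr_neq0.
have cf : (n.+1%:R * (f (x + n.+1%:R^-1) - f x)) @[n --> \oo] --> 'D_1 f x.
  have /= := cvg_comp _ _ u0 df; rewrite -/('D_1 f x); apply: cvg_trans.
  apply: near_eq_cvg; apply: nearW => n /=.
  by rewrite invrK /GRing.scale/= mulr1 (addrC _ x).
have : (n.+1%:R * (f (x + n.+1%:R^-1) - f x))%:E @[n --> \oo] --> ('D_1 f x)%:E.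
  by apply/fine_cvgP; split; [exact: nearW|exact: cf].
by move=> /cvg_limn_einf_sup[_ ->].
Qed.

Lemma measurable_dini f : measurable_fun setT f -> measurable_fun setT (dini f).
Proof.
move=> mf; apply: measurableT_comp => //.
apply: measurable_fun_limn_esup => n.
apply/measurable_EFinP/measurable_funM => //; apply: measurable_funB => //.
by apply: measurableT_comp => //; exact: measurable_funD.
Qed.

(** Two sets, because [A] may contain an end point: differentiability is local
    and lives on the interior [A0], whereas increments are taken up to the
    ends of [A]. *)
Definition has_density (A A0 : set R) u G : Prop :=
  [/\ measurable_fun setT G,
      {ae leb, forall x, A0 x -> derivable u x 1 /\ derive1 u x = G x} &
      forall x y, x <= y -> `[x, y] `<=` A ->
        leb.-integrable `[x, y] (EFin \o G) /\
        u y - u x = \int[leb]_(z in `[x, y]) G z].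

Lemma loc_abs_cont_measurable (A : set R) u (s t : nat -> R) :
  (forall n, `[s n, t n] `<=` A) ->
  (forall x, A x -> exists n, s n <= x <= t n) ->
  loc_abs_cont A u -> measurable (A : set (measurableTypeR R)) /\ measurable_fun A u.
Proof.
move=> stA Ast uA.
have AE : A = \bigcup_n `[s n, t n]%classic.
  apply/seteqP; split=> [x /Ast[n xst]|x [n _]]; last exact: stA.
  by exists n => //=; rewrite in_itv.
rewrite AE; split; first by apply: bigcup_measurable => n _; exact: measurable_itv.
apply/measurable_fun_bigcup => [n|n]; first exact: measurable_itv.
apply: subspace_continuous_measurable_fun; first exact: measurable_itv.
by apply: abs_cont_continuous; exact: uA.
Qed.

(** The intervals [`[s n, t n]] exhaust [A], and countably many exceptional
    null sets form a null set. *)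
Lemma loc_abs_cont_has_density (A A0 : set R) u (s t : nat -> R) :
  (forall n, `[s n, t n] `<=` A) ->
  (forall x, A x -> exists n, s n <= x <= t n) ->
  (forall x, A0 x -> exists n, s n < x < t n) ->
  open A0 -> A0 `<=` A -> (forall x y, `[x, y] `<=` A -> `]x, y[ `<=` A0) ->
  loc_abs_cont A u -> has_density A A0 u (dini (u \_ A)).
Proof.
move=> stA Ast A0st oA0 A0A AA0 uA.
have [mA muA] := loc_abs_cont_measurable stA Ast uA.
have mu : measurable_fun setT (u \_ A) by exact: (measurable_restrictT u mA).1 muA.
have aeD : {ae leb, forall x, A0 x -> derivable u x 1 /\ derive1 u x = dini (u \_ A) x}.
  have : {ae leb, forall x n, s n < x < t n -> derivable u x 1}.
    apply: ae_foralln => n; have [st|ts] := ltP (s n) (t n).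
      have [g [_ _]] := abs_cont_ftc st (uA _ _ (stA n)).
      apply: filterS; first exact: (ae_filter_ringOfSetsType leb).
      by move=> x H /H[].
    by apply: aeW => x; lra.
  apply: filterS; first exact: (ae_filter_ringOfSetsType leb).
  move=> x H A0x; have [n xn] := A0st _ A0x; have dux := H n xn; split => //.
  have uuA : \near x, u x = (u \_ A) x.
    have : \forall y \near x, A0 y by apply: open_nbhs_nbhs; split.
    by apply: filterS => y A0y; rewrite patchE mem_set//; exact: A0A.
  by rewrite (near_eq_derive1 uuA) diniE//; exact: near_eq_derivable uuA dux.
have mG : measurable_fun setT (dini (u \_ A)) by exact: measurable_dini.
split => // x y; rewrite le_eqVlt => /predU1P[<- _|xy xyA].
  rewrite set_itv1 subrr; split.
    apply/integrableP; split.
      by apply/measurable_EFinP; exact: measurable_funTS.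
    by rewrite integral_set1 ltry.
  by rewrite /Rintegral integral_set1.
have [g [gi gE gae]] := abs_cont_ftc xy (uA _ _ xyA).
have gG : ae_eq leb `[x, y]%classic (EFin \o g) (EFin \o dini (u \_ A)).
  apply: ae_itvcc; move: gae aeD; apply: filterS2; first exact: (ae_filter_ringOfSetsType leb).
  move=> z gz Gz xzy; have [_ gE'] := gz xzy.
  have [|_ GE] := Gz; first by apply: (AA0 x y) => //=; rewrite in_itv.
  by rewrite /= -gE' GE.
have mxy : measurable (`[x, y]%classic : set (measurableTypeR R)) by exact: measurable_itv.
have gixy : leb.-integrable `[x, y] (EFin \o g) by exact: integrableS gi.
have mGxy : measurable_fun `[x, y] (EFin \o dini (u \_ A)).
  by apply/measurable_EFinP; exact: measurable_funTS.
split; first exact: ae_eq_integrable gG gixy.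
rewrite (gE x y)// ?lexx// ?ltW//.
rewrite Rintegral_itv_obnd_cbnd; last by apply: integrableS gi => //; exact: measurable_itv.
rewrite /Rintegral; congr fine; apply: ae_eq_integral => //.
by move/integrableP: gixy => [].
Qed.

Lemma exhaust_pos (x : R) : 0 < x -> exists n : nat, n.+1%:R^-1 < x < n.+1%:R.
Proof.
move=> x0; have [k] := ltr_add_invr x0; rewrite add0r => kx.
pose m := Num.bound x; exists (maxn k m); apply/andP; split.
  apply: le_lt_trans kx; rewrite lef_pV2 ?posrE// ler_nat ltnS; exact: leq_maxl.
apply: (lt_le_trans (archi_boundP (ltW x0))); rewrite ler_nat.
by rewrite (leq_trans (leq_maxr k _))// leqnSn.
Qed.

Lemma measurable_pos u : loc_abs_cont `]0, +oo[ u ->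
  measurable_fun (`]0, +oo[%classic : set R) u.
Proof.
move=> uP; have [] // := @loc_abs_cont_measurable _ _ (fun n => n.+1%:R^-1) (fun n => n.+1%:R) _ _ uP.
- move=> n x; rewrite /= !in_itv/= andbT => /andP[+ _]; apply: lt_le_trans.
  by rewrite invr_gt0.
- move=> x; rewrite /= in_itv/= andbT => /exhaust_pos[n /andP[? ?]].
  by exists n; rewrite !ltW.
Qed.

Lemma has_density_pos u : loc_abs_cont `]0, +oo[ u ->
  has_density `]0, +oo[ `]0, +oo[ u (dini (u \_ `]0, +oo[)).
Proof.
apply: (@loc_abs_cont_has_density _ _ _ (fun n => n.+1%:R^-1) (fun n => n.+1%:R)) => //.
- move=> n x; rewrite /= !in_itv/= andbT => /andP[+ _]; apply: lt_le_trans.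
  by rewrite invr_gt0.
- move=> x; rewrite /= in_itv/= andbT => /exhaust_pos[n /andP[? ?]].
  by exists n; rewrite !ltW.
- by move=> x; rewrite /= in_itv/= andbT => /exhaust_pos.
- move=> x y xy z; rewrite /= in_itv/= => /andP[xz zy]; apply: xy.
  by rewrite /= in_itv/= !ltW.
Qed.

Lemma has_density_01 u : loc_abs_cont `]0, 1] u ->
  has_density `]0, 1] `]0, 1[ u (dini (u \_ `]0, 1])).
Proof.
have H (x : R) : 0 < x -> exists n : nat, n.+1%:R^-1 < x.
  by move=> /exhaust_pos[n /andP[? _]]; exists n.
apply: (@loc_abs_cont_has_density _ _ _ (fun n => n.+1%:R^-1) (fun n => 1)) => //.
- move=> n x; rewrite /= !in_itv/= => /andP[+ ->]; rewrite andbT; apply: lt_le_trans.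
  by rewrite invr_gt0.
- move=> x; rewrite /= in_itv/= => /andP[/H[n ?] ->].
  by exists n; rewrite andbT ltW.
- by move=> x; rewrite /= in_itv/= => /andP[/H[n ?] x1]; exists n; apply/andP.
- by move=> x; rewrite /= !in_itv/= => /andP[-> /ltW].
- move=> x y xy z; rewrite /= in_itv/= => /andP[xz zy].
  have xy' : x < y := lt_trans xz zy.
  have [] := itvcc_ends (ltW xy') xy; rewrite /= !in_itv/= => /andP[x0 _] /andP[_ y1].
  by rewrite (lt_trans x0 xz) (lt_le_trans zy y1).
Qed.

End ftc_abs_cont.

(** * Energy carried by a cell *)

Section energy_cells.
Context {R : realType}.
Implicit Types (a b : R) (f u g G : R -> R).
Local Notation leb := (@lebesgue_measure R).

(** Stated for a derivative known only almost everywhere, as happens for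
    products with a function that merely has a density. *)
Lemma abs_cont_ftc_ae a b f g : a < b -> abs_cont `[a, b] f ->
  measurable_fun `[a, b] g ->
  {ae leb, forall x, a < x < b -> derive1 f x = g x} ->
  leb.-integrable `[a, b] (EFin \o g) /\ \int[leb]_(x in `[a, b]) g x = f b - f a.
Proof.
move=> ab fab mg fg.
have [h [hi hE hae]] := abs_cont_ftc ab fab.
have hg : {ae leb, forall x, `[a, b]%classic x -> h x = g x}.
  apply: ae_itvcc; move: fg hae; apply: filterS2; first exact: (ae_filter_ringOfSetsType leb).
  by move=> x fgx hx abx; have [_ <-] := hx abx; exact: fgx.
have mab : measurable (`[a, b]%classic : set (measurableTypeR R)) by exact: measurable_itv.
have hiab : leb.-integrable `[a, b] (EFin \o h) by exact: integrableS hi.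
split.
  apply: ae_eq_integrable hiab; first exact/measurable_EFinP.
  by apply: filterS hg; [exact: (ae_filter_ringOfSetsType leb)|move=> x H /H /= ->].
rewrite -(ae_congr_Rintegral hg) (hE a b)// ?ltW//.
by rewrite Rintegral_itv_obnd_cbnd//; apply: integrableS hi => //; exact: measurable_itv.
Qed.

Lemma measurable_inv_pos : measurable_fun (`]0, +oo[%classic : set R) (fun x : R => x^-1).
Proof.
apply: open_continuous_measurable_fun; first exact: interval_open.
move=> x; rewrite inE/= in_itv/= andbT => x0.
by apply: cvgV; [rewrite gt_eqF|exact: cvg_id].
Qed.

Lemma inv_sub_ge0 a b : 0 < a -> a <= b -> 0 <= a^-1 - b^-1.
Proof. by move=> a0 ab; rewrite subr_ge0 lef_pV2// posrE (lt_le_trans a0). Qed.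

Lemma inv_sub_gt0 a b : 0 < a -> a < b -> 0 < a^-1 - b^-1.
Proof. by move=> a0 ab; rewrite subr_gt0 ltf_pV2// posrE (lt_trans a0). Qed.

Lemma inv_sub_le a b c : 0 < c -> c <= a -> a <= b -> a^-1 - b^-1 <= (b - a) / c ^+ 2.
Proof.
move=> c0 ca ab.
have a0 : 0 < a := lt_le_trans c0 ca; have b0 : 0 < b := lt_le_trans a0 ab.
have -> : a^-1 - b^-1 = (b - a) / (a * b) by field; rewrite !gt_eqF.
apply: ler_wpM2l; first by rewrite subr_ge0.
rewrite lef_pV2 ?posrE ?mulr_gt0 ?exprn_gt0// expr2.
by apply: ler_pM => //; [exact: ltW|exact: ltW|exact: le_trans ca ab].
Qed.

Lemma inv_abs_cont a b : 0 < a -> abs_cont `[a, b] (fun x => - x^-1).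
Proof.
move=> a0; apply: (@lipschitz_abs_cont _ _ _ (a ^- 2)) => x y xy xyab.
have [] := itvcc_ends xy xyab; rewrite /= in_itv/= => /andP[ax _] _.
rewrite opprK addrC ger0_norm ?inv_sub_ge0 ?(lt_le_trans a0)//.
by rewrite mulrC; exact: inv_sub_le.
Qed.

Lemma integral_inv_sqr a b : 0 < a -> a < b ->
  leb.-integrable `[a, b] (fun x => (x ^- 2)%:E) /\
  \int[leb]_(x in `[a, b]) x ^- 2 = a^-1 - b^-1.
Proof.
move=> a0 ab.
have [||] := abs_cont_ftc_ae (g := fun x => x ^- 2) ab (inv_abs_cont b a0).
- rewrite [X in measurable_fun _ X](_ : _ = fun x => x^-1 * x^-1); last first.
    by apply/funext => x; rewrite -expr2 exprVn.
  apply: measurable_funM; apply: measurable_funS measurable_inv_pos => //.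
  + by move=> x; rewrite /= !in_itv/= andbT => /andP[+ _]; exact: lt_le_trans.
  + by move=> x; rewrite /= !in_itv/= andbT => /andP[+ _]; exact: lt_le_trans.
- apply: aeW => x /andP[ax xb].
  have x0 : x != 0 by rewrite gt_eqF// (lt_trans a0).
  have := is_deriveN (is_deriveV x0 (is_derive_id x 1)).
  by move=> [_]; rewrite derive1E /GRing.scale/= mulr1 opprK.
by move=> ? ->; split => //; rewrite opprK addrC.
Qed.

Section cell.
Variables (A A0 : set R) (u G : R -> R).
Hypotheses (uG : has_density A A0 u G) (A_pos : A `<=` `]0, +oo[).

(** Cauchy-Schwarz in the scale [- 1 / x]: integrate
    [(G x * x - c / x) ^+ 2 >= 0], where [c] is the slope of [u] in that
    scale. *)
Lemma has_density_cell s t : s < t -> `[s, t] `<=` A ->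
  (((u t - u s) ^+ 2 / (s^-1 - t^-1))%:E <=
   \int[leb]_(x in `]s, t[) (G x ^+ 2 * x ^+ 2)%:E)%E.
Proof.
move=> st stA; have [mG _ uE] := uG.
have [Gi GE] := uE s t (ltW st) stA.
have s0 : 0 < s by have [/A_pos] := itvcc_ends (ltW st) stA; rewrite /= in_itv/= andbT.
have [Ii IE] := integral_inv_sqr s0 st.
have mGG (D : set (measurableTypeR R)) :
    measurable D -> measurable_fun D (fun x => (G x ^+ 2 * x ^+ 2)%:E).
  move=> mD; apply/measurable_EFinP; apply: measurable_funM.
    by apply: measurable_funX; exact: measurable_funTS.
  exact: measurable_funX.
have mst : measurable (`[s, t]%classic : set (measurableTypeR R)) by exact: measurable_itv.
rewrite -(@integral_itv_bndoo _ s t _ true false); last first.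
  by apply: mGG; exact: measurable_itv.
set D := s^-1 - t^-1; have D0 : 0 < D by exact: inv_sub_gt0.
pose c := (u t - u s) / D.
have [|] := leP +oo%E (\int[leb]_(x in `[s, t]) (G x ^+ 2 * x ^+ 2)%:E)%E.
  by rewrite leye_eq => /eqP ->; exact: leey.
move=> fin.
have Ei : leb.-integrable `[s, t] (fun x => (G x ^+ 2 * x ^+ 2)%:E).
  apply/integrableP; split; first exact: mGG.
  apply: le_lt_trans fin; rewrite le_eqVlt; apply/orP; left; apply/eqP.
  by apply: eq_integral => x _; rewrite gee0_abs// lee_fin mulr_ge0// sqr_ge0.
have cGi : leb.-integrable `[s, t] (EFin \o (fun x => (2 * c) * G x)).
  exact: (@integrableZl _ _ _ _ _ mst (2 * c) _ Gi).
have cIi : leb.-integrable `[s, t] (EFin \o (fun x => c ^+ 2 * x ^- 2)).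
  exact: (@integrableZl _ _ _ _ _ mst (c ^+ 2) _ Ii).
have Li : leb.-integrable `[s, t] (EFin \o (fun x => (2 * c) * G x - c ^+ 2 * x ^- 2)).
  exact: (@integrableB _ _ _ _ _ mst _ _ cGi cIi).
have LE : \int[leb]_(x in `[s, t]) ((2 * c) * G x - c ^+ 2 * x ^- 2) = (u t - u s) ^+ 2 / D.
  rewrite RintegralB// RintegralZl// RintegralZl// IE -GE -/D /c.
  by field; rewrite gt_eqF.
rewrite -LE /Rintegral fineK; last exact: (integrable_fin_num mst Li).
apply: le_integral => // x; rewrite inE/= in_itv/= => /andP[sx _].
have x0 : x != 0 by rewrite gt_eqF// (lt_le_trans s0).
rewrite lee_fin -subr_ge0.
rewrite (_ : _ - _ = (G x * x - c / x) ^+ 2); first exact: sqr_ge0.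
by field.
Qed.

Lemma has_density_cells (I : finType) (s t : I -> R) :
  measurable (A0 : set (measurableTypeR R)) ->
  (forall i, s i <= t i /\ `[s i, t i] `<=` A) ->
  (forall i, `]s i, t i[ `<=` A0) ->
  trivIset setT (fun i => `]s i, t i[%classic) ->
  ((\sum_i (u (t i) - u (s i)) ^+ 2 / ((s i)^-1 - (t i)^-1))%:E <=
   \int[leb]_(x in A0) (G x ^+ 2 * x ^+ 2)%:E)%E.
Proof.
move=> mA0 stA stA0 tst; have [mG _ _] := uG.
have mGG (D : set (measurableTypeR R)) :
    measurable D -> measurable_fun D (fun x => (G x ^+ 2 * x ^+ 2)%:E).
  move=> mD; apply/measurable_EFinP; apply: measurable_funM.
    by apply: measurable_funX; exact: measurable_funTS.
  exact: measurable_funX.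
have GG0 x : (0 <= (G x ^+ 2 * x ^+ 2)%:E)%E by rewrite lee_fin mulr_ge0// sqr_ge0.
pose F i : set (measurableTypeR R) := `]s i, t i[%classic.
have mF i : measurable (F i) by exact: measurable_itv.
apply: (@le_trans _ _ (\int[leb]_(x in \big[setU/set0]_(i <- index_enum I) F i) (G x ^+ 2 * x ^+ 2)%:E)%E).
  rewrite ge0_integral_bigsetU//.
  - rewrite -sumEFin; apply: lee_sum => i _; have [sti stAi] := stA i.
    move: sti; rewrite le_eqVlt => /predU1P[->|sti].
      by rewrite subrr expr0n mul0r; apply: integral_ge0.
    exact: has_density_cell.
  - exact: index_enum_uniq.
  - by apply: sub_trivIset tst.
  - by apply: mGG; exact: bigsetU_measurable.
apply: ge0_subset_integral => //.
- exact: bigsetU_measurable.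
- exact: mGG.
- by rewrite -bigcup_seq => x [i _]; exact: stA0.
Qed.

End cell.
End energy_cells.

(** * The energy as a supremum over cells *)

Section variational_energy.
Context {R : realType}.
Implicit Types (a b : R) (f u g G : R -> R) (C : R).
Local Notation leb := (@lebesgue_measure R).

(** The bound [C] on the energy over [A], in the scale [- 1 / x]. No
    derivative occurs, so the bound is stable under pointwise limits. *)
Definition var_le (A : set R) u C : Prop := forall (I : finType) (s t : I -> R),
  (forall i, s i <= t i /\ `[s i, t i] `<=` A) ->
  trivIset setT (fun i => `]s i, t i[%classic) ->
  \sum_i (u (t i) - u (s i)) ^+ 2 / ((s i)^-1 - (t i)^-1) <= C.

Lemma var_le_ge0 (A : set R) u C : var_le A u C -> 0 <= C.
Proof.
move=> /(_ void (fun=> 0) (fun=> 0)); rewrite big_pred0; last by case.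
by apply; case.
Qed.

Lemma var_le_cell (A : set R) u C s t : A `<=` `]0, +oo[ -> var_le A u C ->
  s <= t -> `[s, t] `<=` A ->
  (u t - u s) ^+ 2 <= C * (s^-1 - t^-1).
Proof.
move=> A0 uC; rewrite le_eqVlt => /predU1P[->|st] stA.
  by rewrite !subrr expr0n mulr0.
have s0 : 0 < s by have [/A0] := itvcc_ends (ltW st) stA; rewrite /= in_itv/= andbT.
rewrite -ler_pdivrMr; last exact: inv_sub_gt0.
have := uC unit (fun=> s) (fun=> t).
rewrite big_const card_unit/= addr0; apply => //.
- by move=> _; rewrite ltW.
- by move=> [] [].
Qed.

Lemma itvcc_01 (s t : R) : s <= t -> `[s, t] `<=` `]0, 1] ->
  [/\ 0 < s, s <= 1, 0 < t & t <= 1].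
Proof.
by move=> st stA; have [] := itvcc_ends st stA; rewrite /= !in_itv/= => /andP[-> ->] /andP[-> ->].
Qed.

(** Cauchy-Schwarz over a family of cells. Away from 0 the scale [- 1 / x] is
    Lipschitz, so that short families have small increments in scale. *)
Lemma var_le_loc_abs_cont u C : var_le `]0, 1] u C -> loc_abs_cont `]0, 1] u.
Proof.
move=> uC a b abA e e0; have C0 := var_le_ge0 uC.
have [ab|ba] := leP a b; last first.
  exists 1 => // n s t st _ _; rewrite big1// => i _.
  have [sti stab] := st i; have [] := itvcc_ends sti stab.
  by rewrite /= in_itv/=; lra.
have [a0 _ _ _] := itvcc_01 ab abA.
(* Young's inequality [2 c w <= w ^+ 2 / D + c ^+ 2 D] replaces
   Cauchy-Schwarz; a large [c] makes the bounded energy term small compared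
   with [2 c e]. *)
pose c := (C + 1) / e; have c0 : 0 < c by rewrite divr_gt0// ltr_wpDl.
exists (e * a ^+ 2 / c); first by rewrite divr_gt0// mulr_gt0// exprn_gt0.
move=> n s t st tst std.
have stA i : s i <= t i /\ `[s i, t i] `<=` `]0, 1].
  by have [? h] := st i; split=> //; exact: subset_trans h abA.
have as_ i : a <= s i.
  by have [sti stab] := st i; have [] := itvcc_ends sti stab; rewrite /= in_itv/= => /andP[].
have := uC 'I_n s t stA tst.
set V := (X in X <= C -> _) => VC.
have cell i : 2 * c * `|u (t i) - u (s i)| <=
    (u (t i) - u (s i)) ^+ 2 / ((s i)^-1 - (t i)^-1) + c ^+ 2 * ((t i - s i) / a ^+ 2).
  have [+ _] := st i; rewrite le_eqVlt => /predU1P[->|sti].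
    by rewrite !subrr normr0 expr0n !mul0r !mulr0 addr0.
  have D0 : 0 < (s i)^-1 - (t i)^-1.
    by apply: inv_sub_gt0 => //; exact: lt_le_trans (as_ i).
  apply: le_trans (_ : _ <= (u (t i) - u (s i)) ^+ 2 / ((s i)^-1 - (t i)^-1) + c ^+ 2 * ((s i)^-1 - (t i)^-1)) _; last first.
    by rewrite lerD2l ler_wpM2l ?sqr_ge0// inv_sub_le// ltW.
  rewrite -(real_normK (num_real (u (t i) - u (s i)))).
  move: D0; set D := (_ - _^-1); move: (`|_|) => w D0; rewrite -subr_ge0.
  rewrite (_ : _ - _ = (w - c * D) ^+ 2 / D); first by rewrite divr_ge0 ?sqr_ge0// ltW.
  by field; rewrite gt_eqF.
have : 2 * c * (\sum_i `|u (t i) - u (s i)|) <= C + c ^+ 2 * ((\sum_i (t i - s i)) / a ^+ 2).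
  rewrite mulr_sumr; apply: le_trans (ler_sum _ (fun i _ => cell i)) _.
  rewrite big_split/= lerD//.
  by rewrite -mulr_sumr -mulr_suml.
have c2 : 0 < 2 * c by rewrite mulr_gt0.
move=> h; rewrite -(ltr_pM2l c2); apply: (le_lt_trans h).
have -> : 2 * c * e = (C + 1) + c * e by rewrite /c; field; rewrite gt_eqF.
apply: ler_ltD; first by rewrite lerDl.
rewrite expr2 -mulrA ltr_pM2l// mulrA ltr_pdivrMr ?exprn_gt0//.
by rewrite mulrC -ltr_pdivlMr.
Qed.

Lemma truncn_grid (x : R) n : 0 < x < 1 ->
  let N : R := n.+1%:R in let i := Num.truncn (N * x) in
  [/\ (i < n.+1)%N, i%:R / N <= x & x < i.+1%:R / N].
Proof.
move=> /andP[x0 x1] N i; have N0 : 0 < N by rewrite ltr0n.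
have /truncn_itv/andP[iN Ni] : 0 <= N * x by rewrite mulr_ge0 ?ltW.
split.
- rewrite -(ltr_nat R); apply: le_lt_trans iN _.
  by rewrite -[ltRHS]mulr1 ltr_pM2l.
- by rewrite ler_pdivrMr// mulrC.
- by rewrite ltr_pdivlMr// mulrC.
Qed.

(** The quotient is a convex combination of two values of Caratheodory's slope
    function, which is continuous at [x]. *)
Lemma straddle_cvg u (x : R) (p q : nat -> R) : derivable u x 1 ->
  (forall n, p n <= x < q n) -> p @ \oo --> x -> q @ \oo --> x ->
  ((u (q n) - u (p n)) / (q n - p n)) @[n --> \oo] --> derive1 u x.
Proof.
move=> du pxq px qx.
have [+ _] := is_derive1_caratheodory u x (derive1 u x).
case; first by rewrite derive1E; apply/derivableP.
move=> g [gE gc gx].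
have cg r : r @ \oo --> x -> (g \o r) n @[n --> \oo] --> derive1 u x.
  by move=> rx; rewrite -gx; exact: continuous_cvg.
apply/cvgrPdist_le => e e0; near=> n.
have gp : `|derive1 u x - g (p n)| <= e.
  by near: n; move/cvgrPdist_le : (cg _ px); apply.
have gq : `|derive1 u x - g (q n)| <= e.
  by near: n; move/cvgrPdist_le : (cg _ qx); apply.
have /andP[pnx xqn] := pxq n.
have D0 : 0 < q n - p n by rewrite subr_gt0 (le_lt_trans pnx).
have -> : u (q n) - u (p n) = g (q n) * (q n - x) + g (p n) * (x - p n).
  by have := gE (q n); have := gE (p n); move=> *; lra.
move: gp gq; rewrite !ler_norml => /andP[gp1 gp2] /andP[gq1 gq2].
move: pnx xqn D0 gp1 gp2 gq1 gq2; move: (g (q n)) (g (p n)).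
move: (derive1 u x) (p n) (q n) => l pn qn gq gp pnx xqn D0 gp1 gp2 gq1 gq2.
have -> : l - (gq * (qn - x) + gp * (x - pn)) / (qn - pn) =
    ((l - gq) * (qn - x) + (l - gp) * (x - pn)) / (qn - pn) by field; rewrite gt_eqF.
by rewrite ler_pdivlMr// ler_pdivrMr//; apply/andP; split; nra.
Unshelve. all: by end_near. Qed.

(** Fatou's lemma on uniform grids: the squared slopes of [u] on the grid of
    mesh [1 / n.+1] converge a.e. to the energy density. *)
Lemma var_le_energy u G C : has_density `]0, 1] `]0, 1[ u G ->
  var_le `]0, 1] u C ->
  (\int[leb]_(x in `]0%R, 1%R[) (G x ^+ 2 * x ^+ 2)%:E <= C%:E)%E.
Proof.
move=> [mG uae _] uC.
pose N n : R := n.+1%:R; have N0 n : 0 < N n by rewrite ltr0n.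
pose p n i : R := i%:R / N n.
have p0 n i : 0 <= p n i by rewrite divr_ge0 ?ler0n// ltW.
have p1 n i : (i <= n.+1)%N -> p n i <= 1.
  by move=> iN; rewrite ler_pdivrMr// mul1r ler_nat.
have pS n i : p n i.+1 - p n i = (N n)^-1.
  by rewrite /p -natr1; field; rewrite gt_eqF.
have plt n i : p n i < p n i.+1 by rewrite -subr_gt0 pS invr_gt0.
(* The weight [p n i * p n i.+1] makes the integral over a grid cell equal to
   its share [(u q - u p) ^+ 2 / (p^-1 - q^-1)] of the discrete energy. *)
pose c n i : R := ((u (p n i.+1) - u (p n i)) / (p n i.+1 - p n i)) ^+ 2 * (p n i * p n i.+1).
have c0 n i : 0 <= c n i by rewrite mulr_ge0 ?sqr_ge0// mulr_ge0.
pose J n i : set (measurableTypeR R) := `[p n i, p n i.+1[%classic.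
have mJ n i : measurable (J n i) by exact: measurable_itv.
pose e n (x : R) := \sum_(i < n.+1) c n i * \1_(J n i) x.
have m01 : measurable (`]0%R, 1%R[%classic : set (measurableTypeR R)) by exact: measurable_itv.
have mJi n i (D : set (measurableTypeR R)) : measurable_fun D (fun x => (c n i * \1_(J n i) x)%:E).
  by apply/measurable_EFinP; apply: measurable_funM => //; exact: measurable_indic.
have eE n x : 0 < x < 1 -> e n x = c n (Num.truncn (N n * x)).
  move=> x01; have [lt le_ gt_] := truncn_grid n x01.
  rewrite /e (bigD1 (Ordinal lt))//= indicE mem_set; last by rewrite /J/= in_itv/= le_ gt_.
  rewrite mulr1 big1 ?addr0// => j jx; rewrite indicE memNset ?mulr0// /J/= in_itv/=.
  move=> /andP[jle jgt]; move/eqP : jx; apply; apply/val_inj => /=.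
  apply/esym/truncn_def; move: jle jgt; rewrite /p ler_pdivrMr// ltr_pdivlMr//.
  by rewrite mulrC => -> ->.
have eint n : (\int[leb]_(x in `]0%R, 1%R[) (e n x)%:E <= C%:E)%E.
  under eq_integral do rewrite /e -sumEFin.
  rewrite ge0_integral_sum//; last first.
    by move=> i x _; rewrite lee_fin mulr_ge0// indicE.
  (* The first grid cell starts at 0, outside [`]0, 1]]. It has weight 0 and
     is replaced by an empty cell. *)
  pose s (i : 'I_n.+1) := if i == 0%N :> nat then p n 1%N else p n i.
  have sp (i : 'I_n.+1) : p n i <= s i <= p n i.+1.
    by rewrite /s; case: eqP => [->|_]; rewrite ?lexx ?ltW.
  apply: (@le_trans _ _ (\sum_(i < n.+1) (u (p n i.+1) - u (s i)) ^+ 2 / ((s i)^-1 - (p n i.+1)^-1))%:E).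
    rewrite -sumEFin; apply: lee_sum => i _.
    under eq_integral do rewrite EFinM.
    rewrite ge0_integralZl_EFin//; last first.
      by apply/measurable_EFinP; exact: measurable_indic.
    rewrite integral_indic//.
    apply: (@le_trans _ _ ((c n i)%:E * leb (J n i))%E).
      by apply: lee_wpmul2l; rewrite ?lee_fin//; apply: measureIl.
    rewrite /J lebesgue_measure_itv/= lte_fin plt -EFinD -EFinM lee_fin.
    rewrite /s; case: eqP => [i0|/eqP i0].
      by rewrite /c i0 /p mul0r mul0r mulr0 mul0r subrr expr0n mul0r.
    have pi0 : 0 < p n i by rewrite divr_gt0// ltr0n lt0n.
    have pi1 : 0 < p n i.+1 by rewrite (lt_trans pi0).
    rewrite /c; move: (plt n i); rewrite -subr_gt0.
    move: (u (p n i.+1)) (u (p n i)) (p n i.+1) (p n i) pi0 pi1 => uq up q r r0 q0 qr.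
    have hr : r != 0 by rewrite gt_eqF.
    have hq : q != 0 by rewrite gt_eqF.
    have hqr : q - r != 0 by rewrite gt_eqF.
    have -> : r^-1 - q^-1 = (q - r) / (r * q) by field; rewrite ?hr ?hq.
    rewrite le_eqVlt; apply/orP; left; apply/eqP; field; rewrite ?hr ?hq ?hqr.
    by [].
  rewrite lee_fin; apply: uC => [i|i j _ _ /itvoo_meetP[h1 h2 h3 h4]].
    have /andP[s1 s2] := sp i; split => // x; rewrite /= !in_itv/= => /andP[sx xp].
    rewrite (le_trans xp (p1 _ _ _))// andbT; apply: lt_le_trans sx.
    rewrite /s; case: eqP => [_|/eqP i0]; rewrite divr_gt0// ltr0n// lt0n//.
  have ndp (k l : nat) : (k <= l)%N -> p n k <= p n l.
    by move=> kl; rewrite /p ler_pM2r ?invr_gt0// ler_nat.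
  have /andP[si _] := sp i; have /andP[sj _] := sp j.
  apply/val_inj/eqP => /=; rewrite eqn_leq; apply/andP; split; rewrite leqNgt; apply/negP.
    by move=> /ndp; rewrite leNgt => /negP; apply; exact: le_lt_trans si h2.
  by move=> /ndp; rewrite leNgt => /negP; apply; exact: le_lt_trans sj h3.
have ecvg x : 0 < x < 1 -> derivable u x 1 ->
    e n x @[n --> \oo] --> derive1 u x ^+ 2 * x ^+ 2.
  move=> x01 dux.
  pose i n := Num.truncn (N n * x).
  have pq n : p n (i n) <= x < p n (i n).+1.
    by have [_ -> ->] := truncn_grid n x01.
  have N_0 : (N n)^-1 @[n --> \oo] --> 0 by exact: cvg_harmonic.
  have xN0 : x - (N n)^-1 @[n --> \oo] --> x.
    by rewrite -{2}(subr0 x); apply: cvgB => //; exact: cvg_cst.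
  have xN1 : x + (N n)^-1 @[n --> \oo] --> x.
    by rewrite -{2}(addr0 x); apply: cvgD => //; exact: cvg_cst.
  have px : p n (i n) @[n --> \oo] --> x.
    apply: squeeze_cvgr xN0 (cvg_cst x); apply: nearW => n.
    move: (p n (i n)) (p n (i n).+1) ((N n)^-1) (pq n) (pS n (i n)) => P Q S.
    by move=> /andP[? ?] ?; apply/andP; split; lra.
  have qx : p n (i n).+1 @[n --> \oo] --> x.
    apply: squeeze_cvgr (cvg_cst x) xN1; apply: nearW => n.
    move: (p n (i n)) (p n (i n).+1) ((N n)^-1) (pq n) (pS n (i n)) => P Q S.
    by move=> /andP[? ?] ?; apply/andP; split; lra.
  have sl := straddle_cvg dux pq px qx.
  have -> : (fun n => e n x) = (fun n => ((u (p n (i n).+1) - u (p n (i n))) / (p n (i n).+1 - p n (i n))) ^+ 2 * (p n (i n) * p n (i n).+1)).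
    by apply/funext => n; rewrite eE.
  by rewrite !expr2; apply: cvgM; [exact: cvgM|exact: cvgM].
have me n : measurable_fun (`]0%R, 1%R[%classic : set (measurableTypeR R)) (fun x => (e n x)%:E).
  apply/measurable_EFinP; apply: measurable_sum => i.
  by apply: measurable_funM => //; exact: measurable_indic.
have e0 n x : (0 <= (e n x)%:E)%E.
  by rewrite lee_fin; apply: sumr_ge0 => i _; rewrite mulr_ge0// indicE.
rewrite (@ae_congr_integral _ _ _ leb _ _ (fun x => limn_einf (fun n => (e n x)%:E))); last first.
  apply: filterS uae; first exact: (ae_filter_ringOfSetsType leb).
  move=> x H x01; have [dux <-] := H x01.
  have x01' : 0 < x < 1 by move: x01; rewrite /= in_itv.
  have : (e n x)%:E @[n --> \oo] --> (derive1 u x ^+ 2 * x ^+ 2)%:E.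
    by apply/fine_cvgP; split; [exact: nearW|exact: ecvg].
  by move=> /cvg_limn_einf_sup[-> _].
apply: le_trans (fatou leb m01 (fun n => me n) (fun n x _ => e0 n x)) _.
rewrite limn_einf_lim; apply: lime_le; first exact: is_cvg_einfs.
apply: nearW => n; apply: le_trans (eint n).
by apply: ereal_inf_lbound; exists n => //=.
Qed.

End variational_energy.

(** * Square-integrable functions *)

Section L2_generic.
Context d (T : measurableType d) (R : realType).
Variable mu : {measure set T -> \bar R}.
Implicit Types (f g : L2 mu) (s : nat -> L2 mu).

Lemma Lnorm2_sqr (f : T -> R) :
  ('N[mu]_2[EFin \o f] * 'N[mu]_2[EFin \o f] = \int[mu]_x (f x ^+ 2)%:E)%E.
Proof.
have N0 : (0 <= 'N[mu]_2[EFin \o f])%E by exact: Lnorm_ge0.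
have -> : (\int[mu]_x (f x ^+ 2)%:E = 'N[mu]_2[EFin \o f] `^ 2)%E.
  rewrite poweR_Lnorm//; apply: eq_integral => x _ /=.
  by rewrite powR_mulrn// real_normK// num_real.
case: ('N[mu]_2[EFin \o f])%E N0 => [r| |//] r0.
  by rewrite poweR_EFin powR_mulrn -?lee_fin// -EFinM expr2.
by rewrite mulyy poweRyr.
Qed.

Lemma L2_sqr_lty f : (\int[mu]_x (f x ^+ 2)%:E < +oo)%E.
Proof.
rewrite -Lnorm2_sqr; have : ('N[mu]_2[EFin \o f] < +oo)%E by exact: Lfunction_finite.
have : (0 <= 'N[mu]_2[EFin \o f])%E by exact: Lnorm_ge0.
by case: ('N[mu]_2[EFin \o f])%E => [r _ _|_|//]; rewrite -?EFinM ?ltry ?ltxx.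
Qed.

Lemma mk_L2 (f : T -> R) : measurable_fun setT f ->
  (\int[mu]_x (f x ^+ 2)%:E < +oo)%E -> exists g : L2 mu, g = f :> (T -> R).
Proof.
move=> mf; rewrite -Lnorm2_sqr => fi.
have fL : f \in Lfun mu 2%:E.
  apply/andP; split; first by rewrite inE.
  rewrite inE/= /finite_norm; move: fi.
  have : (0 <= 'N[mu]_2[EFin \o f])%E by exact: Lnorm_ge0.
  by case: ('N[mu]_2[EFin \o f])%E => [r| |//] r0; rewrite ?ltry// mulyy.
by exists (Lfun_Sub (lee1n 2) fL).
Qed.

Lemma L2_mul_integrable f g : mu.-integrable setT (EFin \o (fun x => f x * g x)).
Proof.
by apply/Lfun1_integrable; apply: Lfun2_mul_Lfun1; exact: LfunP.
Qed.

Lemma L2_BE f g x : (f - g)%R x = f x - g x.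
Proof. by []. Qed.

Lemma ge0_cvge0P (u : nat -> \bar R) : (forall n, 0 <= u n)%E ->
  (u @ \oo --> 0%E) <-> (forall e : R, 0 < e -> \forall n \near \oo, (u n <= e%:E)%E).
Proof.
move=> u0; split=> [/fine_cvgP[uf uc] e e0|H].
  move/cvgr0Pnorm_le : uc => /(_ _ e0); apply: filterS2 uf => n un.
  by rewrite ger0_norm ?fine_ge0//= -lee_fin fineK.
have fin : \forall n \near \oo, u n \is a fin_num.
  by apply: filterS (H 1 ltr01) => n un; rewrite ge0_fin_numE// (le_lt_trans un) ?ltry.
apply/fine_cvgP; split => //; apply/cvgr0Pnorm_le => e e0.
apply: filterS2 fin (H e e0) => n un ue /=.
by rewrite ger0_norm ?fine_ge0// -lee_fin fineK.
Qed.

Lemma L2_cvg_sqr s f : L2_cvg s f <-> (forall e : R, 0 < e ->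
  \forall n \near \oo, (\int[mu]_x ((s n x - f x) ^+ 2)%:E <= e%:E)%E).
Proof.
have N0 n : (0 <= 'N[mu]_2[EFin \o (s n - f)%R])%E by exact: Lnorm_ge0.
rewrite /L2_cvg (ge0_cvge0P N0); split=> H e e0.
  have /H : 0 < Num.sqrt e by rewrite sqrtr_gt0.
  apply: filterS => n Ne; have /= <- := Lnorm2_sqr (s n - f)%R.
  by rewrite -(sqr_sqrtr (ltW e0)) expr2 EFinM; exact: (lee_pmul (N0 n) (N0 n) Ne Ne).
have /H : 0 < e ^+ 2 by rewrite exprn_gt0.
apply: filterS => n; have /= <- := Lnorm2_sqr (s n - f)%R.
case: ('N[mu]_2[EFin \o (s n - f)%R])%E (N0 n) => [r| |//] r0.
  rewrite -EFinM !lee_fin -expr2 ler_pXn2r// nnegrE ?(ltW e0)//.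
by rewrite mulyy.
Qed.

(** Young's inequality [2 |h g| <= t h ^+ 2 + t^-1 g ^+ 2] with a large [t]. *)
Lemma L2_cvg_weak s f : L2_cvg s f -> L2_weak_cvg s f.
Proof.
move=> /L2_cvg_sqr sf g; apply/cvgrPdist_le => e e0.
pose B := \int[mu]_x (g x * g x).
have B0 : 0 <= B by apply: Rintegral_ge0 => x _; rewrite -expr2 sqr_ge0.
pose t := (B + 1) / e; have t0 : 0 < t by rewrite divr_gt0// ltr_wpDl.
have /sf : 0 < e / t by rewrite divr_gt0.
apply: filterS => n hn.
pose h : L2 mu := (s n - f)%R.
have hE : \int[mu]_x (h x * h x) <= e / t.
  rewrite -lee_fin /Rintegral fineK; last exact: (integrable_fin_num measurableT (L2_mul_integrable h h)).
  by apply: le_trans hn; rewrite le_eqVlt; apply/orP; left; apply/eqP; apply: eq_integral => x _; rewrite expr2.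
have -> : \int[mu]_x (f x * g x) - \int[mu]_x (s n x * g x) = - \int[mu]_x (h x * g x).
  rewrite -RintegralB//; [|exact: L2_mul_integrable|exact: L2_mul_integrable].
  rewrite -[RHS]mulN1r -RintegralZl//; last exact: L2_mul_integrable.
  by apply: eq_Rintegral => x _; rewrite /h L2_BE; ring.
rewrite normrN; apply: le_trans (le_normr_Rintegral measurableT (L2_mul_integrable h g)) _.
have i1 : mu.-integrable setT (EFin \o (fun x => t / 2 * (h x * h x))).
  exact: (@integrableZl _ _ _ _ _ measurableT (t / 2) _ (L2_mul_integrable h h)).
have i2 : mu.-integrable setT (EFin \o (fun x => t^-1 / 2 * (g x * g x))).
  exact: (@integrableZl _ _ _ _ _ measurableT (t^-1 / 2) _ (L2_mul_integrable g g)).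
apply: (@le_trans _ _ (\int[mu]_x (t / 2 * (h x * h x) + t^-1 / 2 * (g x * g x)))).
  apply: le_Rintegral => //.
  - exact: integrable_norm (L2_mul_integrable h g).
  - exact: (@integrableD _ _ _ _ _ measurableT _ _ i1 i2).
  move=> x _; move: (h x) (g x) => p q.
  have pq r : r ^+ 2 = 1 -> 0 <= t / 2 * (p * p) + t^-1 / 2 * (q * q) - r * (p * q).
    move=> r1; rewrite (_ : _ - _ = (t * p - r * q) ^+ 2 / (2 * t)); last first.
      rewrite (_ : (t * p - r * q) ^+ 2 = t ^+ 2 * p ^+ 2 - 2 * t * r * p * q + r ^+ 2 * q ^+ 2); last by ring.
      by rewrite r1; field; rewrite gt_eqF.
    by rewrite divr_ge0 ?sqr_ge0// mulr_ge0// ltW.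
  have := pq 1 (expr1n _ _); have := pq (-1) (etrans (sqrrN 1) (expr1n _ _)).
  by rewrite ler_norml; move=> *; apply/andP; split; lra.
rewrite RintegralD// RintegralZl//; last exact: L2_mul_integrable.
rewrite RintegralZl//; last exact: L2_mul_integrable.
rewrite -/B; have t2 : 0 < t / 2 by rewrite divr_gt0.
have -> : e = t / 2 * (e / t) + t^-1 / 2 * (e * t) by field; rewrite gt_eqF.
rewrite lerD// ler_pM2l//; last by rewrite divr_gt0// invr_gt0.
by rewrite /t mulrC -mulrA mulVf ?gt_eqF// mulr1 lerDl.
Qed.

End L2_generic.

(** * Discrete energy bounds *)

Section mu_facts.
Context {R : realType}.
Implicit Types (u f g : R -> R) (C : R).
Local Notation leb := (@lebesgue_measure R).

Lemma cvg_bigsum (I : eqType) (r : seq I) (F : I -> nat -> R) (l : I -> R) :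
  (forall i, i \in r -> F i @ \oo --> l i) ->
  (\sum_(i <- r) F i n) @[n --> \oo] --> \sum_(i <- r) l i.
Proof.
elim: r => [|i r IH] Fl.
  by rewrite big_nil; under eq_fun do rewrite big_nil; exact: cvg_cst.
rewrite big_cons; under eq_fun do rewrite big_cons.
apply: cvgD; first by apply: Fl; rewrite mem_head.
by apply: IH => j jr; apply: Fl; rewrite inE jr orbT.
Qed.

Lemma sqr_le_inv_cvg0 (f : nat -> R) C : (forall k, (0 < k)%N -> f k ^+ 2 <= C / k%:R) ->
  f k @[k --> \oo] --> (0 : R).
Proof.
move=> fC; have C0 : 0 <= C by have := fC 1%N isT; rewrite divr1; apply: le_trans; exact: sqr_ge0.
apply/cvgrPdist_le => e e0.
exists (Num.bound (C / e ^+ 2)).+1 => // k /= kn.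
have k0 : (0 < k)%N by apply: leq_trans kn.
rewrite sub0r normrN -ler_sqr ?nnegrE ?(ltW e0)// real_normK ?num_real//.
apply: (le_trans (fC k k0)); rewrite ler_pdivrMr ?ltr0n// mulrC -ler_pdivrMr ?exprn_gt0//.
have De : 0 <= C / e ^+ 2 by rewrite divr_ge0// sqr_ge0.
by rewrite (le_trans (ltW (archi_boundP De)))// ler_nat ltnW.
Qed.

Lemma weight01 (x : R) : 0 < x < 1 -> weight x = x ^+ 2.
Proof. by move=> x01; rewrite /weight indicE mem_set ?mulr1//= in_itv/=. Qed.

(** Only values on [`]0, 1]] and at the atoms are involved, so that the bound
    makes sense for any version of an element of L2. *)
Definition energy_le f C : Prop := forall (I : finType) (s t : I -> R) (K : nat),
  (forall i, s i <= t i /\ `[s i, t i] `<=` `]0, 1]) ->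
  trivIset setT (fun i => `]s i, t i[%classic) ->
  \sum_i (f (t i) - f (s i)) ^+ 2 / ((s i)^-1 - (t i)^-1) +
  \sum_(1 <= k < K) (k * k.+1)%:R * (f k.+1%:R - f k%:R) ^+ 2 <= C.

Lemma jump_sum_ge0 f K : 0 <= \sum_(1 <= k < K) (k * k.+1)%:R * (f k.+1%:R - f k%:R) ^+ 2.
Proof. by apply: sumr_ge0 => k _; rewrite mulr_ge0// sqr_ge0. Qed.

Lemma energy_le_var f C : energy_le f C -> var_le `]0, 1] f C.
Proof.
move=> fC I s t st tst; apply: le_trans (fC I s t 0%N st tst).
by rewrite lerDl jump_sum_ge0.
Qed.

Lemma energy_le_jumps f C K : energy_le f C ->
  \sum_(1 <= k < K) (k * k.+1)%:R * (f k.+1%:R - f k%:R) ^+ 2 <= C.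
Proof.
move=> fC; have := fC void (fun=> 0) (fun=> 0) K.
by rewrite big_pred0; [rewrite add0r; apply; case|case].
Qed.

Lemma energy_le_ge0 f C : energy_le f C -> 0 <= C.
Proof. by move=> /energy_le_var/var_le_ge0. Qed.

Lemma energy_le_loc_abs_cont f C : energy_le f C -> loc_abs_cont `]0, 1] f.
Proof. by move=> /energy_le_var/var_le_loc_abs_cont. Qed.

Lemma energy_leW f C C' : C <= C' -> energy_le f C -> energy_le f C'.
Proof. by move=> CC fC I s t K st tst; apply: le_trans (fC I s t K st tst) CC. Qed.

Lemma eq_energy_le f g C : (forall x, 0 < x <= 1 -> f x = g x) ->
  (forall k, (0 < k)%N -> f k%:R = g k%:R) -> energy_le f C -> energy_le g C.
Proof.
move=> fg fgk fC I s t K st tst.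
have sub i : f (s i) = g (s i) /\ f (t i) = g (t i).
  have [sti stA] := st i; have [s0 s1 t0 t1] := itvcc_01 sti stA.
  by split; apply: fg; apply/andP.
apply: le_trans (fC I s t K st tst); rewrite le_eqVlt; apply/orP; left; apply/eqP.
congr (_ + _); first by apply: eq_bigr => i _; have [-> ->] := sub i.
by apply: eq_big_nat => k /andP[k0 _]; rewrite !fgk.
Qed.

Lemma energy_le_cvg (u : nat -> R -> R) f C :
  (forall x, 0 < x <= 1 -> u n x @[n --> \oo] --> f x) ->
  (forall k, (0 < k)%N -> u n k%:R @[n --> \oo] --> f k%:R) ->
  (forall n, energy_le (u n) C) -> energy_le f C.
Proof.
move=> uf ufk uC I s t K st tst.
have sub i : (0 < s i <= 1) /\ (0 < t i <= 1).
  by have [sti stA] := st i; have [-> -> -> ->] := itvcc_01 sti stA.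
have sqrc (v : nat -> R) (l : R) : v @ \oo --> l -> v n ^+ 2 @[n --> \oo] --> l ^+ 2.
  by move=> vl; rewrite expr2; under eq_fun do rewrite expr2; exact: cvgM.
have : (\sum_i (u n (t i) - u n (s i)) ^+ 2 / ((s i)^-1 - (t i)^-1) +
  \sum_(1 <= k < K) (k * k.+1)%:R * (u n k.+1%:R - u n k%:R) ^+ 2) @[n --> \oo] -->
  \sum_i (f (t i) - f (s i)) ^+ 2 / ((s i)^-1 - (t i)^-1) +
  \sum_(1 <= k < K) (k * k.+1)%:R * (f k.+1%:R - f k%:R) ^+ 2.
  apply: cvgD.
    apply: cvg_bigsum => i _; apply: cvgM; last exact: cvg_cst.
    by apply: sqrc; apply: cvgB; apply: uf; have [] := sub i.
  apply: cvg_bigsum => k; rewrite mem_index_iota => /andP[k0 _].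
  apply: cvgM; first exact: cvg_cst.
  by apply: sqrc; apply: cvgB; apply: ufk.
move=> lim; rewrite -(cvg_lim _ lim)//; apply: limr_le; first exact: cvgP lim.
by apply: nearW => n; exact: uC.
Qed.

(** The parameter [t] of Young's inequality stays free: a perturbation of
    small energy [C'] must change [C] only slightly. *)
Lemma energy_leD f g C C' t : 0 < t -> energy_le f C -> energy_le g C' ->
  energy_le (f \+ g) ((1 + t) * C + (1 + t^-1) * C').
Proof.
move=> t0 fC gC I s v K sv tsv.
have sq (x y : R) : (x + y) ^+ 2 <= (1 + t) * x ^+ 2 + (1 + t^-1) * y ^+ 2.
  rewrite -subr_ge0 (_ : _ - _ = (t * x - y) ^+ 2 / t); last by field; rewrite gt_eqF.
  by rewrite divr_ge0 ?sqr_ge0// ltW.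
have := fC I s v K sv tsv; have := gC I s v K sv tsv.
set Sg := \sum_i _; set Jg := \sum_(1 <= k < K) _.
set Sf := \sum_i _; set Jf := \sum_(1 <= k < K) _ => gC' fC'.
have t1 : 0 < 1 + t by rewrite addr_gt0.
have t2 : 0 < 1 + t^-1 by rewrite addr_gt0// invr_gt0.
apply: (@le_trans _ _ (((1 + t) * Sf + (1 + t^-1) * Sg) + ((1 + t) * Jf + (1 + t^-1) * Jg))); last first.
  rewrite addrACA -!mulrDr; apply: lerD; rewrite ler_pM2l//.
apply: lerD.
  rewrite /Sf /Sg !mulr_sumr -big_split/=; apply: ler_sum => i _.
  have [svi svA] := sv i.
  rewrite [X in _ <= X + _]mulrA [X in _ <= _ + X]mulrA -mulrDl; apply: ler_wpM2r.
    by have [s0 _ _ _] := itvcc_01 svi svA; rewrite invr_ge0 inv_sub_ge0.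
  by rewrite (_ : _ - _ = (f (v i) - f (s i)) + (g (v i) - g (s i))); [exact: sq|ring].
rewrite /Jf /Jg !mulr_sumr -big_split/=; apply: ler_sum => k _.
rewrite !(mulrCA _ (_ * _)%:R) -mulrDr; apply: ler_wpM2l => //.
by rewrite (_ : _ - _ = (f k.+1%:R - f k%:R) + (g k.+1%:R - g k%:R)); [exact: sq|ring].
Qed.

Lemma energy_leN f C : energy_le f C -> energy_le (\- f) C.
Proof.
move=> fC I s t K st tst; apply: le_trans (fC I s t K st tst).
rewrite le_eqVlt; apply/orP; left; apply/eqP; congr (_ + _); apply: eq_bigr => i _ /=.
  by rewrite -opprD sqrrN.
by rewrite -opprD sqrrN.
Qed.

(** Cauchy-Schwarz on the atoms; [1 / (k (k + 1))] telescopes. *)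
Lemma jumps_cauchy f C k m : energy_le f C -> (0 < k)%N -> (k <= m)%N ->
  (f m%:R - f k%:R) ^+ 2 <= C * (k%:R^-1 - m%:R^-1).
Proof.
move=> fC k0; rewrite leq_eqVlt => /predU1P[<-|km].
  by rewrite !subrr expr0n mulr0.
have m0 : (0 < m)%N by rewrite (leq_trans k0)// ltnW.
have D0 : (0 : R) < k%:R^-1 - m%:R^-1 by apply: inv_sub_gt0; rewrite ?ltr0n// ltr_nat.
set D := _ - _ in D0 *; pose c := (f m%:R - f k%:R) / D.
have cell j : (k <= j < m)%N -> 2 * c * (f j.+1%:R - f j%:R) <=
    (j * j.+1)%:R * (f j.+1%:R - f j%:R) ^+ 2 + c ^+ 2 * (- j.+1%:R^-1 - - j%:R^-1).
  move=> /andP[kj _]; have j0 : (0 : R) < j%:R by rewrite ltr0n (leq_trans k0).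
  have j1 : (0 : R) < j.+1%:R by rewrite ltr0n.
  rewrite (_ : - j.+1%:R^-1 - - j%:R^-1 = (j * j.+1)%:R^-1 :> R); last first.
    by rewrite natrM -(natr1 j); field; rewrite natr1 !gt_eqF.
  rewrite natrM; move: (f j.+1%:R - f j%:R) j0 j1; move: (j%:R : R) (j.+1%:R : R) => p q w p0 q0.
  rewrite -subr_ge0 (_ : _ - _ = p * q * (w - c / (p * q)) ^+ 2).
    by rewrite mulr_ge0 ?sqr_ge0// mulr_ge0 ?ltW.
  by field; rewrite !gt_eqF.
have : 2 * c * (f m%:R - f k%:R) <= C + c ^+ 2 * D.
  have <- : \sum_(k <= j < m) (f j.+1%:R - f j%:R) = f m%:R - f k%:R.
    exact: (telescope_sumr (fun j => f j%:R) (ltnW km)).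
  have telD : \sum_(k <= j < m) (- j.+1%:R^-1 - - j%:R^-1) = D :> R.
    by rewrite (telescope_sumr (fun j => - j%:R^-1) (ltnW km)) opprK addrC.
  rewrite mulr_sumr.
  apply: (@le_trans _ _ (\sum_(k <= j < m) ((j * j.+1)%:R * (f j.+1%:R - f j%:R) ^+ 2 + c ^+ 2 * (- j.+1%:R^-1 - - j%:R^-1)))).
    by rewrite big_nat [leRHS]big_nat; apply: ler_sum => j; exact: cell.
  rewrite big_split/= -mulr_sumr telD lerD2r.
  apply: le_trans (energy_le_jumps m fC).
  rewrite [leRHS](big_cat_nat _ (n := k))//=; last exact: ltnW.
  by rewrite lerDr jump_sum_ge0.
clear cell; rewrite /c; move: (f m%:R - f k%:R) => w h.
rewrite -ler_pdivrMr//; move: h.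
rewrite (_ : 2 * (w / D) * w = 2 * (w ^+ 2 / D)); last by field; rewrite gt_eqF.
rewrite (_ : (w / D) ^+ 2 * D = w ^+ 2 / D); last by field; rewrite gt_eqF.
by move: (w ^+ 2 / D) => v; lra.
Qed.

End mu_facts.

(** * The measure and the maximal form *)

Section max_energy_facts.
Context {R : realType}.
Implicit Types (u f g : R -> R) (C : R).
Local Notation leb := (@lebesgue_measure R).
Variable a : nat -> {posnum R}.
Local Notation mua := (mu a).

Lemma mu_disc_ge (A : set (measurableTypeR R)) (k : nat) : (0 < k)%N -> A k%:R ->
  ((a k)%:num%:E <= mu_disc a A)%E.
Proof.
move=> k0 Ak; rewrite /mu_disc/= /mseries.
apply: le_trans (nneseries_lim_ge k.+1 _); last first.
  by move=> j _ _; rewrite /mscale mule_ge0// lee_fin.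
rewrite big_nat_recr//= /mscale/= diracE mem_set// mule1 leeDr//.
by apply: sume_ge0 => j _; rewrite mule_ge0// lee_fin.
Qed.

Lemma mu_disc_null (A : set (measurableTypeR R)) :
  (forall k : nat, (0 < k)%N -> ~ A k%:R) -> mu_disc a A = 0%E.
Proof.
move=> Ak; rewrite /mu_disc/= /mseries eseries0// => k k0 _.
transitivity ((a k)%:num%:E * (\d_(k%:R : measurableTypeR R) A))%E => //.
by rewrite diracE memNset ?mule0//; exact: Ak.
Qed.

Lemma muE (A : set (measurableTypeR R)) : mua A = (@mu_ac R A + mu_disc a A)%E.
Proof. exact: measure_addE. Qed.

Lemma measurable_posnats : measurable (@posnats R : set (measurableTypeR R)).
Proof.
have -> : @posnats R = \bigcup_(k in [set k | (0 < k)%N]) [set k%:R].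
  by apply/seteqP; split=> [_ [k k0 <-]|_ [k k0 ->]]; [exists k|exists k].
by apply: bigcup_measurable => k _; exact: measurable_set1.
Qed.

(** The weight is positive on [`]0, 1[], where null sets are therefore those
    of Lebesgue measure, and each atom has positive mass. *)
Lemma ae_muP (P : R -> Prop) : {ae mua, forall x, P x} <->
  (forall k : nat, (0 < k)%N -> P k%:R) /\ {ae leb, forall x, 0 < x < 1 -> P x}.
Proof.
split=> [[N [mN + PN]]|[Pk [N [mN N0 PN]]]].
  rewrite muE => /eqP; rewrite padde_eq0// => /andP[/eqP N_ac /eqP N_disc]; split.
    move=> k k0; apply: contrapT => nP; have := mu_disc_ge k0 (PN _ nP).
    by rewrite N_disc lee_fin leNgt => /negP; apply.
  have mw : measurable_fun N (EFin \o @weight R).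
    by apply/measurable_EFinP; apply: measurable_funTS; exact: measurable_weight.
  have : (\int[leb]_(x in N) `|(EFin \o @weight R) x| = 0)%E.
    rewrite -N_ac; apply: eq_integral => x _ /=.
    by rewrite ger0_norm// weight_ge0.
  move=> /(ae_eq_integral_abs leb mN mw) aeN.
  apply: filterS aeN => x H x01; apply: contrapT => nP; have := H (PN _ nP).
  by move=> [/eqP]; rewrite weight01// sqrf_eq0; move/andP : x01 => [/gt_eqF ->].
pose M : set (measurableTypeR R) := (N `|` ~` `]0%R, 1%R[%classic) `\` @posnats R.
have m01 : measurable (`]0%R, 1%R[%classic : set (measurableTypeR R)) by exact: measurable_itv.
have mM : measurable M.
  apply: measurableD; last exact: measurable_posnats.
  by apply: measurableU => //; exact: measurableC.
exists M; split => //.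
  rewrite muE mu_disc_null ?adde0; last by move=> k k0 [_]; apply; exists k.
  rewrite /mu_ac/= /density.
  rewrite (@ae_congr_integral _ _ _ leb _ _ (cst 0%E)) ?integral0//.
  exists N; split => // x /= /not_implyP[[[Nx|x01] _] wx] //.
  by exfalso; apply: wx; rewrite /weight indicE memNset// mulr0.
move=> x /= nPx; split.
  have [x01|x01] := pselect (0 < x < 1); last first.
    by right => /=; rewrite in_itv.
  by left; apply: PN => /= H; apply: nPx; exact: H.
by move=> [k k0 kx]; apply: nPx; rewrite -kx; exact: Pk.
Qed.

Let G f := dini (f \_ `]0, 1]).

Lemma max_energyE f : loc_abs_cont `]0, 1] f ->
  (max_energy f = \int[leb]_(x in `]0%R, 1%R[) (G f x ^+ 2 * x ^+ 2)%:E +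
   \sum_(1 <= k <oo) ((k * k.+1)%:R * (f k.+1%:R - f k%:R) ^+ 2)%:E)%E.
Proof.
move=> /has_density_01[mG fG _]; congr (_ + _)%E.
have m01 : measurable (`]0%R, 1%R[%classic : set (measurableTypeR R)) by exact: measurable_itv.
transitivity (\int[mu_ac]_(x in `]0%R, 1%R[) (G f x ^+ 2)%:E)%E.
  apply: ae_congr_integral; apply: ae_density.
  apply: filterS fG; first exact: (ae_filter_ringOfSetsType leb).
  by move=> x H /H[_ ->].
rewrite ge0_integral_density//.
- apply: eq_integral => x; rewrite inE/= in_itv/= => x01.
  by rewrite weight01.
- by apply/measurable_EFinP/measurable_funX; exact: measurable_funTS.
- by move=> x _; rewrite lee_fin sqr_ge0.
Qed.

(** Both inequalities between the integral and the supremum over cells: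
    [has_density_cells] and [var_le_energy]. *)
Lemma max_energy_le f C : loc_abs_cont `]0, 1] f ->
  (max_energy f <= C%:E)%E <-> energy_le f C.
Proof.
move=> fac; have fG := has_density_01 fac.
rewrite (max_energyE fac).
have J0 k : (1 <= k)%N -> true -> (0 <= ((k * k.+1)%:R * (f k.+1%:R - f k%:R) ^+ 2)%:E)%E.
  by move=> _ _; rewrite lee_fin mulr_ge0// sqr_ge0.
set Gi := (\int[leb]_(x in _) _)%E.
have Gi0 : (0 <= Gi)%E by apply: integral_ge0 => x _; rewrite lee_fin mulr_ge0// sqr_ge0.
have sub01 : `]0%R, 1%R]%classic `<=` (`]0, +oo[%classic : set R).
  by move=> x; rewrite /= !in_itv/= => /andP[->].
split=> [fC I s t K st tst|fC].
  rewrite -lee_fin; apply: le_trans fC; rewrite EFinD; apply: leeD.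
    apply: (has_density_cells fG sub01 _ st _ tst) => // i.
    have [_ stA] := st i => x; rewrite /= in_itv/= => /andP[sx xt].
    have st' : s i < t i := lt_trans sx xt.
    by have [] := itvcc_01 (ltW st') stA; rewrite /= in_itv/=; lra.
  rewrite -sumEFin; exact: nneseries_lim_ge.
have GK K : (Gi + (\sum_(1 <= k < K) (k * k.+1)%:R * (f k.+1%:R - f k%:R) ^+ 2)%:E <= C%:E)%E.
  rewrite -leeBrDr// -EFinB; apply: (var_le_energy fG) => I s t st tst.
  by rewrite lerBrDr; exact: fC.
have GC : (Gi <= C%:E)%E by have := GK 0%N; rewrite big_geq// adde0.
have Gfin : Gi \is a fin_num by rewrite ge0_fin_numE// (le_lt_trans GC) ?ltry.
rewrite addeC -leeBrDr//; apply: lime_le; first exact: is_cvg_nneseries.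
by apply: nearW => K; rewrite sumEFin leeBrDr// addeC; exact: GK.
Qed.

Lemma eq_ereal_le (x y : \bar R) : (0 <= x)%E -> (0 <= y)%E ->
  (forall C : R, (x <= C%:E)%E <-> (y <= C%:E)%E) -> x = y.
Proof.
move=> + + xy; case: x xy => [x| |//] xy _; case: y xy => [y| |//] xy _ //.
- by apply/eqP; rewrite eq_le; apply/andP; split; apply/xy; rewrite lexx.
- by have := (xy x).1 (lexx _).
- by have := (xy y).2 (lexx _).
Qed.

Lemma max_energy_ge0 f : (0 <= max_energy f)%E.
Proof.
apply: adde_ge0; first by apply: integral_ge0 => x _; rewrite lee_fin sqr_ge0.
by apply: nneseries_ge0 => k _ _; rewrite lee_fin mulr_ge0// sqr_ge0.
Qed.

Lemma ae_leb_dense (P : R -> Prop) (x y : R) : {ae leb, forall z, P z} -> x < y ->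
  exists2 z, x < z < y & P z.
Proof.
move=> [N [mN N0 PN]] xy; apply: contrapT => nP.
have : (leb `]x, y[ <= leb N)%E.
  apply: le_measure; rewrite ?inE//.
  move=> z; rewrite /= in_itv/= => xzy; apply: PN => Pz; apply: nP.
  by exists z.
rewrite lebesgue_measure_itv/= lte_fin xy.
by have -> : lebesgue_measure N = 0%E := N0; rewrite -EFinB lee_fin subr_le0 leNgt xy.
Qed.

(** Continuity propagates equality from a dense set, up to the end point 1. *)
Lemma loc_abs_cont_ae_eq f g : loc_abs_cont `]0, 1] f -> loc_abs_cont `]0, 1] g ->
  {ae leb, forall x, 0 < x < 1 -> f x = g x} -> forall x, 0 < x <= 1 -> f x = g x.
Proof.
move=> fac gac fg x /andP[x0 x1].
have sub : `[x / 2, x] `<=` `]0, 1].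
  by move=> z; rewrite /= !in_itv/= => /andP[xz zx]; apply/andP; split; lra.
apply/eqP; rewrite -subr_eq0 -normr_le0; apply/ler_addgt0Pr => e e0; rewrite add0r.
have e2 : 0 < e / 2 by rewrite divr_gt0.
have [d d0 Hf] := abs_cont_unif (fac _ _ sub) e2.
have [d' d'0 Hg] := abs_cont_unif (gac _ _ sub) e2.
pose r := Num.min (Num.min d d') (x / 2).
have [rd rd' rx r0] : [/\ r <= d, r <= d', r <= x / 2 & 0 < r].
  rewrite /r !ge_min !lexx !orbT/= !lt_min d0 d'0/=; split => //.
  by rewrite divr_gt0.
have xr : x - r < x by rewrite ltrBlDr ltrDl.
have [z /andP[xz zx] fgz] := ae_leb_dense fg xr.
have {}fgz : f z = g z by apply: fgz; apply/andP; split; lra.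
have xzr : `|x - z| < r by rewrite gtr0_norm; lra.
have xin : x / 2 <= x <= x by apply/andP; split; lra.
have zin : x / 2 <= z <= x by apply/andP; split; lra.
have h1 := Hf x z xin zin (lt_le_trans xzr rd).
have h2 := Hg x z xin zin (lt_le_trans xzr rd').
rewrite (_ : f x - g x = (f x - f z) - (g x - g z)); last by rewrite fgz; ring.
by apply: le_trans (ler_normB _ _) _; rewrite ltW// (splitr e) ltrD.
Qed.

Lemma version_energy_le (psi : L2 mua) f g C :
  is_version f psi -> is_version g psi ->
  loc_abs_cont `]0, 1] g -> energy_le f C -> energy_le g C.
Proof.
move=> /ae_muP[fk fae] /ae_muP[gk gae] gac fC.
have fac := energy_le_loc_abs_cont fC.
apply: eq_energy_le fC => [x x01|k k0]; last by rewrite fk// gk.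
apply: loc_abs_cont_ae_eq => //; move: fae gae.
apply: filterS2; first exact: (ae_filter_ringOfSetsType leb).
by move=> z fz gz z01; rewrite fz// gz.
Qed.

(** Replaces the derivative in [max_form] by finite sums of increments, which
    pass to pointwise limits. *)
Lemma max_form_le (psi : L2 mua) C :
  (max_form psi <= C%:E)%E <-> exists2 f, is_version f psi & energy_le f C.
Proof.
rewrite /max_form; split.
  case: xgetP => [e _ [f [fpsi fac ->]] fC|_]; last by [].
  by exists f => //; exact/max_energy_le.
move=> [f fpsi fC]; have fac := energy_le_loc_abs_cont fC.
case: xgetP => [e _ [g [gpsi gac ->]]|/(_ (max_energy f))].
  by apply/max_energy_le => //; exact: version_energy_le fpsi gpsi gac fC.
by case; exists f.
Qed.

Lemma max_form_ge0 (psi : L2 mua) : (0 <= max_form psi)%E.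
Proof.
by rewrite /max_form; case: xgetP => [e _ [f [_ _ ->]]|//]; exact: max_energy_ge0.
Qed.

End max_energy_facts.

(** * Weak lower semicontinuity *)

Section weak_convergence.
Context {R : realType}.
Implicit Types (u g : R -> R) (C : R).
Local Notation leb := (@lebesgue_measure R).
Variable a : nat -> {posnum R}.
Local Notation mua := (mu a).
Implicit Types (s : nat -> L2 mua) (f psi : L2 mua).

Lemma L2_indic (A : set (measurableTypeR R)) : measurable A -> (mua A < +oo)%E ->
  exists g : L2 mua, g = \1_A :> (R -> R).
Proof.
move=> mA Afin; apply: mk_L2; first exact: measurable_indic.
rewrite (eq_integral (fun x => (\1_A x)%:E)).
  by rewrite integral_indic// setIT.
by move=> x _; rewrite indicE; case: (_ \in _); rewrite ?expr1n ?expr0n.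
Qed.

Lemma Rintegral_mul_indic (A : set (measurableTypeR R)) (h : R -> R) :
  \int[mua]_x (h x * \1_A x) = \int[mua]_(x in A) h x.
Proof.
rewrite [RHS]Rintegral_mkcond; apply: eq_Rintegral => x _.
by rewrite patchE indicE; case: ifPn => _; rewrite ?mulr1 ?mulr0.
Qed.

Lemma L2_integrable_on psi (A : set (measurableTypeR R)) : measurable A ->
  (mua A < +oo)%E -> mua.-integrable A (EFin \o psi).
Proof.
move=> mA Afin; have [g gE] := L2_indic mA Afin.
have := L2_mul_integrable psi g; rewrite gE => psig.
rewrite integrable_mkcond//; apply: eq_integrable psig => // x _.
by rewrite patchE /= indicE; case: ifPn => _; rewrite ?mulr1 ?mulr0.
Qed.

Lemma weak_cvg_on s f (A : set (measurableTypeR R)) : L2_weak_cvg s f ->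
  measurable A -> (mua A < +oo)%E ->
  \int[mua]_(x in A) s n x @[n --> \oo] --> \int[mua]_(x in A) f x.
Proof.
move=> sf mA Afin; have [g gE] := L2_indic mA Afin.
have := sf g; rewrite gE Rintegral_mul_indic.
by under eq_fun do rewrite Rintegral_mul_indic.
Qed.

Lemma mu_atom_lty (k : nat) : (mua [set k%:R] < +oo)%E.
Proof.
rewrite muE; apply: lte_add_pinfty.
  by rewrite /mu_ac/= /density integral_set1 ltry.
apply: le_lt_trans (ltry (a k)%:num).
rewrite /mu_disc/= /mseries; apply: lime_le.
  by apply: is_cvg_nneseries => j _ _; rewrite /mscale mule_ge0// lee_fin.
apply: nearW => n; rewrite (eq_bigr (fun j => if j == k then (a k)%:num%:E else 0%E)); last first.
  move=> j _; transitivity ((a j)%:num%:E * (\d_(j%:R : measurableTypeR R) [set k%:R]))%E => //.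
  rewrite diracE; case: (eqVneq j k) => [->|jk]; first by rewrite mem_set// mule1.
  rewrite memNset ?mule0// => /= /eqP; rewrite eqr_nat; exact/negP.
elim: n => [|n IH]; first by rewrite big_geq.
have [n0|n0] := posnP n; first by rewrite n0 big_geq// lee_fin.
rewrite big_nat_recr//=; case: eqP => [->|_]; last by rewrite adde0.
rewrite big_nat big1 ?add0e// => j /andP[_ jk].
by rewrite (ltn_eqF jk).
Qed.

Lemma mu_atom_gt0 (k : nat) : (0 < k)%N -> (0 < mua [set k%:R])%E.
Proof.
move=> k0; rewrite muE; apply: (@lt_le_trans _ _ (a k)%:num%:E); first by rewrite lte_fin.
apply: (le_trans (@mu_disc_ge _ a [set k%:R] k k0 _)) => //.
by rewrite leeDr// measure_ge0.
Qed.

Lemma Rintegral_atom (h : R -> R) (k : nat) :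
  \int[mua]_(x in [set k%:R]) h x = h k%:R * fine (mua [set k%:R]).
Proof.
rewrite -Rintegral_cst; last exact: measurable_set1.
by apply: eq_Rintegral => x; rewrite inE => ->.
Qed.

Lemma weak_cvg_atom s f (k : nat) : (0 < k)%N -> L2_weak_cvg s f ->
  s n k%:R @[n --> \oo] --> f k%:R.
Proof.
move=> k0 sf; have m0 : fine (mua [set k%:R]) != 0.
  by rewrite gt_eqF// fine_gt0// mu_atom_gt0//= mu_atom_lty.
have := weak_cvg_on sf (measurable_set1 (k%:R : R)) (mu_atom_lty k).
rewrite Rintegral_atom; under eq_fun do rewrite Rintegral_atom.
move: (fine _) m0 => m m0 h.
have : s n k%:R * m / m @[n --> \oo] --> f k%:R * m / m.
  by apply: cvgM => //; exact: cvg_cst.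
by rewrite mulfK//; under eq_fun do rewrite mulfK//.
Qed.

Lemma leb_itvoo (x y : R) : x < y -> leb `]x, y[%classic = (y - x)%:E.
Proof. by move=> xy; rewrite lebesgue_measure_itv/= lte_fin xy. Qed.

Lemma mu01_lty : (mua `]0%R, 1%R[%classic < +oo)%E.
Proof.
rewrite muE mu_disc_null ?adde0; last first.
  by move=> [//|k] _; rewrite /= in_itv/= ltrn1 => /andP[].
have m01 : measurable (`]0%R, 1%R[%classic : set (measurableTypeR R)) by exact: measurable_itv.
rewrite /mu_ac/= /density.
apply: (@le_lt_trans _ _ (\int[leb]_(x in `]0%R, 1%R[) (cst 1%:E x))%E).
  apply: ge0_le_integral => //.
  - by move=> x _; rewrite lee_fin weight_ge0.
  - by apply/measurable_EFinP; apply: measurable_funTS; exact: measurable_weight.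
  - move=> x; rewrite /= in_itv/= => x01; rewrite weight01// lee_fin.
    by rewrite expr_le1//; [move/andP : x01 => [_ /ltW]|move/andP : x01 => [/ltW]].
rewrite integral_cst// mul1e [X in (X < _)%E](_ : _ = (1 - 0)%:E) ?ltry//.
exact: leb_itvoo.
Qed.

Lemma mu_itv_gt0 (x y : R) : 0 < x -> x < y -> y <= 1 -> (0 < mua `]x, y[%classic)%E.
Proof.
move=> x0 xy y1; rewrite muE.
apply: (@lt_le_trans _ _ (mu_ac `]x, y[%classic)); last by rewrite leeDl// measure_ge0.
have mxy : measurable (`]x, y[%classic : set (measurableTypeR R)) by exact: measurable_itv.
apply: (@lt_le_trans _ _ (\int[leb]_(z in `]x, y[) (cst (x ^+ 2)%:E z))%E).
  rewrite integral_cst// [X in (_ * X)%E](_ : _ = (y - x)%:E); last exact: leb_itvoo.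
  rewrite -EFinM lte_fin.
  by rewrite mulr_gt0 ?subr_gt0// exprn_gt0.
apply: ge0_le_integral => //.
- by move=> z _; rewrite lee_fin sqr_ge0.
- by apply/measurable_EFinP; apply: measurable_funTS; exact: measurable_weight.
- move=> z; rewrite /= in_itv/= => /andP[xz zy]; rewrite weight01 ?lee_fin.
    by rewrite ler_pXn2r// ?nnegrE ltW// (lt_trans x0).
  by rewrite (lt_trans x0 xz) (lt_le_trans zy).
Qed.

(** Equicontinuity turns a mean value over a small interval into a point
    value. *)
Lemma mean_value_close psi u C (x y e : R) : is_version u psi -> energy_le u C ->
  0 < y -> y < x -> x <= 1 -> C * (y^-1 - x^-1) <= e ^+ 2 -> 0 <= e ->
  `|\int[mua]_(z in `]y, x[) psi z - u x * fine (mua `]y, x[%classic)| <=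
  e * fine (mua `]y, x[%classic).
Proof.
move=> upsi uC y0 yx x1 Ce e0.
set A : set (measurableTypeR R) := `]y, x[%classic.
have mA : measurable A by exact: measurable_itv.
have Afin : (mua A < +oo)%E.
  apply: le_lt_trans mu01_lty; apply: le_measure; rewrite ?inE//.
  move=> z; rewrite /A /= !in_itv/= => /andP[yz zx].
  by rewrite (lt_trans y0 yz) (lt_le_trans zx x1).
have Afin' : mua A \is a fin_num by rewrite ge0_fin_numE// measure_ge0.
have psiA := L2_integrable_on psi mA Afin.
have cA (c : R) : mua.-integrable A (EFin \o cst c).
  by apply: measurable_bounded_integrable => //; exact: bounded_cst.
rewrite -!Rintegral_cst// -RintegralB//; last exact: cA.
have dA : mua.-integrable A (EFin \o (fun z => psi z - u x)).
  exact: (@integrableB _ _ _ _ _ mA _ _ psiA (cA (u x))).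
apply: le_trans (le_normr_Rintegral mA dA) _.
rewrite /Rintegral fine_le//.
- by apply: (integrable_fin_num mA); exact: integrable_norm dA.
- by apply: (integrable_fin_num mA); exact: cA.
apply: ae_ge0_le_integral => //.
- by apply/measurable_EFinP; apply: measurableT_comp => //; apply/measurable_EFinP; exact: measurable_int dA.
apply: filterS upsi; first exact: (ae_filter_ringOfSetsType mua).
move=> z uz Az; rewrite lee_fin -uz.
have /andP[yz zx] : y < z < x by move: Az; rewrite /A /= in_itv.
have z0 : 0 < z := lt_trans y0 yz.
rewrite -(@ler_pXn2r _ 2%N)// ?nnegrE// real_normK ?num_real// -sqrrN opprB.
have var := energy_le_var uC.
apply: le_trans (var_le_cell _ var (ltW zx) _) _.
- by move=> w; rewrite /= !in_itv/= => /andP[->].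
- move=> w; rewrite /= !in_itv/= => /andP[zw wx].
  by rewrite (lt_le_trans z0 zw) (le_trans wx x1).
apply: le_trans Ce; apply: ler_wpM2l; first exact: energy_le_ge0 uC.
by rewrite lerD2r lef_pV2 ?posrE// ltW.
Qed.

(** The means over a short interval to the left of [x] converge, and they are
    uniformly close to the values at [x]. *)
Lemma weak_energy_cvg s f (u : nat -> R -> R) C : L2_weak_cvg s f ->
  (forall n, is_version (u n) (s n)) -> (forall n, energy_le (u n) C) ->
  forall x, 0 < x <= 1 -> cvgn (fun n => u n x).
Proof.
move=> sf us uC x /andP[x0 x1]; have C0 := energy_le_ge0 (uC 0%N).
apply/cauchy_cvgP/cauchy_exP => e e0.
pose r := e / 8; have r0 : 0 < r by rewrite divr_gt0.
(* Near [x] in the scale [- 1 / x], so that the oscillation of every [u n] on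
   [`[y, x]] is at most [r]. *)
pose y := (x^-1 + r ^+ 2 / (C + 1))^-1.
have C1 : 0 < C + 1 by rewrite ltr_wpDl.
have q0 : 0 < r ^+ 2 / (C + 1) by rewrite divr_gt0// exprn_gt0.
have y0 : 0 < y by rewrite invr_gt0 addr_gt0// invr_gt0.
have yx : y < x.
  by rewrite /y -[ltRHS]invrK ltf_pV2 ?posrE ?addr_gt0 ?invr_gt0// ltrDl.
have Cr : C * (y^-1 - x^-1) <= r ^+ 2.
  rewrite /y invrK addrC addKr mulrA ler_pdivrMr// mulrC ler_wpM2l ?sqr_ge0//.
  by rewrite lerDl.
pose A : set (measurableTypeR R) := `]y, x[%classic.
have mA : measurable A by exact: measurable_itv.
have Afin : (mua A < +oo)%E.
  apply: le_lt_trans mu01_lty; apply: le_measure; rewrite ?inE//.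
  move=> z; rewrite /A /= !in_itv/= => /andP[yz zx].
  by rewrite (lt_trans y0 yz) (lt_le_trans zx x1).
have m0 : 0 < fine (mua A) by rewrite fine_gt0// mu_itv_gt0.
have := weak_cvg_on sf mA Afin.
set l := \int[mua]_(z in A) f z => /cvgrPdist_le/(_ (r * fine (mua A))).
move=> /(_ (mulr_gt0 r0 m0))[N _ HN].
have close n := mean_value_close (us n) (uC n) y0 yx x1 Cr (ltW r0).
exists (u N x); exists N => // n /= Nn.
rewrite /ball/=; apply: (@le_lt_trans _ _ (4 * r)); last by rewrite /r; lra.
rewrite -(ler_pM2r m0) -(gtr0_norm m0) -normrM (gtr0_norm m0).
have := HN N (leqnn N); have := HN n Nn; have := close n; have := close N.
rewrite -/A; move: (fine _) (Rintegral _ A (s n)) (Rintegral _ A (s N)) => m In IN.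
rewrite !ler_norml => /andP[? ?] /andP[? ?] /andP[? ?] /andP[? ?].
by apply/andP; split; lra.
Qed.

(** Bounded energy makes the functions equicontinuous on compact parts of
    [`]0, 1]], so that weak convergence improves to pointwise convergence. *)
Lemma weak_energy_lsc s f (u : nat -> R -> R) C : L2_weak_cvg s f ->
  (forall n, is_version (u n) (s n)) -> (forall n, energy_le (u n) C) ->
  exists2 g, is_version g f & energy_le g C.
Proof.
move=> sf us uC; have C0 := energy_le_ge0 (uC 0%N).
pose g x := limn (fun n => u n x).
have ug x : 0 < x <= 1 -> u n x @[n --> \oo] --> g x.
  by move=> x01; exact: weak_energy_cvg sf us uC x x01.
have atoms n : forall k, (0 < k)%N -> u n k%:R = s n k%:R by have /ae_muP[] := us n.
have ufk k : (0 < k)%N -> u n k%:R @[n --> \oo] --> f k%:R.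
  by move=> k0; under eq_fun do rewrite atoms//; exact: weak_cvg_atom.
have gfk k : (0 < k)%N -> g k%:R = f k%:R by move=> /ufk/cvg_lim; exact.
have ugk k : (0 < k)%N -> u n k%:R @[n --> \oo] --> g k%:R.
  by move=> k0; rewrite gfk//; exact: ufk.
have gC : energy_le g C := energy_le_cvg ug ugk uC.
exists g => //; apply/ae_muP; split => //.
have gac := energy_le_loc_abs_cont gC.
have m01 : measurable (`]0%R, 1%R[%classic : set (measurableTypeR R)) by exact: measurable_itv.
suff H d : 0 < d -> {ae mua, forall x, d <= x < 1 -> g x = f x}.
  have : {ae mua, forall x (n : nat), n.+1%:R^-1 <= x < 1 -> g x = f x}.
    by apply: ae_foralln => n; apply: H; rewrite invr_gt0.
  move=> /ae_muP[_]; apply: filterS; first exact: (ae_filter_ringOfSetsType leb).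
  move=> x Hx x01; have /andP[x0 x1] := x01.
  by have [n /andP[/ltW nx _]] := exhaust_pos x0; apply: (Hx x01 n); rewrite nx.
move=> d0; pose D : set (measurableTypeR R) := `[d, 1[%classic.
have D01 x : D x -> 0 < x < 1.
  by rewrite /D /= in_itv/= => /andP[dx ->]; rewrite (lt_le_trans d0).
have mD : measurable D by exact: measurable_itv.
have Dfin : (mua D < +oo)%E.
  by apply: le_lt_trans mu01_lty; apply: le_measure; rewrite ?inE// => x /D01; rewrite /= in_itv.
have mgD : measurable_fun D g.
  apply: (@measurable_funS _ _ _ _ (`[d, 1]%classic : set (measurableTypeR R))).
  - exact: measurable_itv.
  - by move=> x; rewrite /D /= !in_itv/= => /andP[-> /ltW].
  apply: subspace_continuous_measurable_fun; first exact: measurable_itv.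
  apply: abs_cont_continuous; apply: gac => x; rewrite /= !in_itv/= => /andP[dx ->].
  by rewrite (lt_le_trans d0).
pose gD := g \_ D.
have mg : measurable_fun setT gD by exact/(measurable_restrictT g mD).
have mfg : measurable_fun setT (fun x => f x - gD x) by exact: measurable_funB.
(* Testing with a truncation of [f - g] on [`[d, 1[] shows that [f = g] there:
   dominated convergence identifies the limit of the pairings by [g]. *)
pose h := cst (-1) \max (cst 1 \min (fun x => f x - gD x)) : R -> R.
have mh : measurable_fun setT h by apply: measurable_maxr => //; exact: measurable_minr.
have h1 x : `|h x| <= 1.
  rewrite ler_norml /h /=; apply/andP; split; first by rewrite le_max lexx.
  by rewrite ge_max ge_min lexx andbT; lra.
pose phi x := h x * \1_D x.
have mphi : measurable_fun setT phi by apply: measurable_funM => //; exact: measurable_indic.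
have phi1 x : `|phi x| <= \1_D x.
  by rewrite /phi normrM indicE; case: (_ \in _); rewrite ?mulr1n ?mulr0n ?normr1 ?normr0 ?mulr1 ?mulr0.
have [|phi2 phi2E] := mk_L2 (mu := mua) mphi.
  apply: (@le_lt_trans _ _ (\int[mua]_x (\1_D x)%:E)%E).
    apply: ge0_le_integral => //.
    - by move=> x _; rewrite lee_fin sqr_ge0.
    - by apply/measurable_EFinP; exact: measurable_funX.
    - by apply/measurable_EFinP; exact: measurable_indic.
    - move=> x _; rewrite lee_fin -real_normK ?num_real//.
      have := phi1 x; rewrite indicE; case: (_ \in _) => /= p1.
        by rewrite expr_le1.
      by rewrite (_ : `|phi x| = 0) ?expr0n//; apply/eqP; rewrite eq_le p1 normr_ge0.
  by rewrite integral_indic// setIT.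
have [M uM] : exists M, forall n x, D x -> `|u n x| <= M.
  have c1 : cvgn (fun n => u n 1) by apply/cvg_ex; exists (g 1); apply: ug; rewrite ltr01 lexx.
  have [M0 [_ HM]] := cvg_seq_bounded c1.
  exists (M0 + 1 + (1 + C * d^-1)) => n x Dx; have /andP[x0 x1] := D01 _ Dx.
  have dx : d <= x by move: Dx; rewrite /D /= in_itv/= => /andP[].
  have M1 : `|u n 1| <= M0 + 1 by apply: HM => //; rewrite ltrDl.
  have : (u n 1 - u n x) ^+ 2 <= C * d^-1.
    have var := energy_le_var (uC n).
    apply: le_trans (var_le_cell _ var (ltW x1) _) _.
    - by move=> w; rewrite /= !in_itv/= => /andP[->].
    - by move=> w; rewrite /= !in_itv/= => /andP[xw ->]; rewrite (lt_le_trans x0 xw).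
    apply: ler_wpM2l => //; rewrite invr1.
    have : x^-1 <= d^-1 by rewrite lef_pV2 ?posrE.
    by move=> xd; rewrite lerBlDr (le_trans xd)// lerDl.
  move=> sq; have d1 : `|u n 1 - u n x| <= 1 + C * d^-1.
    rewrite -real_normK ?num_real// in sq.
    by move: (`|_|) (normr_ge0 (u n 1 - u n x)) sq => w w0 sq; nra.
  rewrite (_ : u n x = u n 1 - (u n 1 - u n x)); last by ring.
  by apply: le_trans (ler_normB _ _) _; exact: lerD.
have usn : {ae mua, forall x n, u n x = s n x} by apply: ae_foralln => n; exact: us.
have gphi x : gD x * phi x = (g x * h x) * \1_D x.
  by rewrite /gD /phi patchE indicE; case: ifPn => _; rewrite ?mulr1 ?mulr0.
have [] := @dominated_convergence _ _ _ mua setT measurableT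
   (fun n x => (s n x * phi x)%:E) (fun x => (gD x * phi x)%:E) (fun x => (M * \1_D x)%:E).
- by move=> n; apply/measurable_EFinP; exact: measurable_funM.
- by apply/measurable_EFinP; exact: measurable_funM.
- apply: filterS usn; first exact: (ae_filter_ringOfSetsType mua).
  move=> x usx _; apply/fine_cvgP; split; first exact: nearW.
  rewrite /=; have [xD|xD] := pselect (D x); last first.
    rewrite {2}/phi indicE memNset// !mulr0.
    rewrite [X in X @ _ --> _](_ : _ = cst 0); first exact: cvg_cst.
    by apply/funext => n; rewrite /= /phi indicE memNset// !mulr0.
  rewrite /gD patchE mem_set//.
  rewrite [X in X @ _ --> _](_ : _ = fun n => u n x * phi x); last first.
    by apply/funext => n; rewrite /= usx.
  apply: cvgM; last exact: cvg_cst.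
  by apply: ug; have /andP[-> /ltW ->] := D01 _ xD.
- apply: (@integrableZl _ _ _ mua setT measurableT M (fun x => (\1_D x)%:E)).
  apply/integrableP; split; first by apply/measurable_EFinP; exact: measurable_indic.
  rewrite (eq_integral (fun x => (\1_D x)%:E)); first by rewrite integral_indic// setIT.
  by move=> x _; rewrite /= ger0_norm// indicE.
- apply: filterS usn; first exact: (ae_filter_ringOfSetsType mua).
  move=> x usx n _; rewrite lee_fin -usx normrM.
  have := phi1 x; rewrite indicE; case: (boolP (x \in D)) => [/set_mem xD|_] /= p1.
    by rewrite mulr1 -[leRHS]mulr1 ler_pM// uM.
  rewrite mulr0 (_ : `|phi x| = 0) ?mulr0//.
  by apply/eqP; rewrite eq_le p1 normr_ge0.
move=> ig _ lim.
have if_ : mua.-integrable setT (EFin \o (fun x => f x * phi x)).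
  by rewrite -phi2E; exact: L2_mul_integrable.
have Ifg : \int[mua]_x (f x * phi x) = \int[mua]_x (gD x * phi x).
  have l1 := sf phi2; rewrite phi2E in l1.
  have l2 : \int[mua]_x (s n x * phi x) @[n --> \oo] --> \int[mua]_x (gD x * phi x).
    by apply: fine_cvg; rewrite /Rintegral fineK//; exact: integrable_fin_num ig.
  exact: (cvg_unique _ l1 l2).
pose F := fun x : R => f x * phi x - gD x * phi x.
have idif : mua.-integrable setT (EFin \o F).
  exact: (@integrableB _ _ _ _ _ measurableT _ _ if_ ig).
have nn x : 0 <= F x.
  rewrite /F -mulrBl /phi mulrA; apply: mulr_ge0; last by rewrite indicE.
  rewrite /h /=; move: (f x - gD x) => w; case: (leP 0 w) => w0.
    by rewrite mulr_ge0// le_max; apply/orP; right; rewrite le_min ler01.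
  apply: mulr_le0; first exact: ltW.
  by rewrite ge_max ge_min (ltW w0) orbT andbT; lra.
have I0 : (\int[mua]_x `|(EFin \o F) x| = 0)%E.
  transitivity (\int[mua]_x (F x)%:E)%E.
    by apply: eq_integral => x _; rewrite /= ger0_norm.
  have F0 : \int[mua]_x F x = 0 by rewrite RintegralB// Ifg subrr.
  apply: (etrans (esym (fineK (integrable_fin_num measurableT idif)))).
  exact: (congr1 EFin F0).
have I1 := ae_eq_integral_abs mua measurableT (measurable_int _ idif).
have {}I0 := I1.1 I0.
apply: filterS I0 => x /(_ Logic.I) /= [/eqP] + dx1.
have Dx : D x by rewrite /D /= in_itv.
rewrite /F -mulrBl /phi mulf_eq0 indicE mem_set// mulr1 /h /gD /= patchE mem_set//.
rewrite subr_eq0 => /orP[/eqP ->//|].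
have [w0 /eqP|w0 /eqP|/eqP] := ltgtP 0 (f x - g x).
- by rewrite max_r ?le_min; [|lra]; rewrite /Num.min; case: ifP => _; lra.
- by rewrite /Num.min; case: ifP => ?; rewrite /Num.max; case: ifP => ?; lra.
- by rewrite eq_sym subr_eq0 => /eqP ->.
Qed.

End weak_convergence.

(** * The Bessel form on its domain *)

Section bessel_dom_facts.
Context {R : realType}.
Implicit Types (u v w z : R -> R) (C lam : R).
Local Notation leb := (@lebesgue_measure R).
Local Notation P := (`]0%R, +oo[%classic : set (measurableTypeR R)).

(** A Borel version of the derivative on the half-line, for which the form is
    the integral of an integrable function. *)
Definition bdens u : R -> R := dini (u \_ `]0, +oo[).

Lemma measurable_P : measurable P.
Proof. exact: measurable_itv. Qed.

Lemma bdensP u : loc_abs_cont `]0, +oo[ u -> has_density `]0, +oo[ `]0, +oo[ u (bdens u).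
Proof. exact: has_density_pos. Qed.

Lemma measurable_bdens u (D : set (measurableTypeR R)) :
  loc_abs_cont `]0, +oo[ u -> measurable_fun D (bdens u).
Proof. by move=> /bdensP[mG _ _]; exact: measurable_funTS. Qed.

Lemma ae_bdens u : loc_abs_cont `]0, +oo[ u ->
  {ae leb, forall x, P x -> derivable u x 1 /\ derive1 u x = bdens u x}.
Proof. by move=> /bdensP[]. Qed.

Lemma ge0_integrableP (D : set (measurableTypeR R)) (f : R -> R) :
  (forall x, D x -> 0 <= f x) -> measurable_fun D f ->
  leb.-integrable D (EFin \o f) <-> (\int[leb]_(x in D) (f x)%:E < +oo)%E.
Proof.
move=> f0 mf.
have E : (\int[leb]_(x in D) `|(EFin \o f) x| = \int[leb]_(x in D) (f x)%:E)%E.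
  by apply: eq_integral => x /set_mem Dx; rewrite /= ger0_norm// f0.
split=> [/integrableP[_]|fi]; first by rewrite E.
by apply/integrableP; split; [exact/measurable_EFinP|rewrite E].
Qed.

Lemma integral_speed u : loc_abs_cont `]0, +oo[ u ->
  (\int[bessel_speed]_(x in `]0%R, +oo[) (u x ^+ 2)%:E =
   \int[leb]_(x in P) (u x ^+ 2 * (2 * x ^+ 2))%:E)%E.
Proof.
move=> uac; rewrite ge0_integral_density//.
- by apply/measurable_EFinP; apply: measurable_funX; exact: measurable_pos.
- by move=> x _; rewrite lee_fin sqr_ge0.
Qed.

Lemma sqr_speed_ge0 (y x : R) : 0 <= y ^+ 2 * (2 * x ^+ 2).
Proof. by rewrite mulr_ge0 ?sqr_ge0// mulr_ge0// sqr_ge0. Qed.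

Lemma bessel_domP u : bessel_dom u <->
  [/\ loc_abs_cont `]0, +oo[ u,
      leb.-integrable P (EFin \o (fun x => u x ^+ 2 * (2 * x ^+ 2))) &
      leb.-integrable P (EFin \o (fun x => bdens u x ^+ 2 * x ^+ 2))].
Proof.
rewrite /bessel_dom.
have key : loc_abs_cont `]0, +oo[ u ->
   [/\ (\int[bessel_speed]_(x in `]0%R, +oo[) (u x ^+ 2)%:E < +oo)%E <->
      leb.-integrable P (EFin \o (fun x => u x ^+ 2 * (2 * x ^+ 2))) &
      (\int[leb]_(x in P) (derive1 u x ^+ 2 * x ^+ 2)%:E < +oo)%E <->
      leb.-integrable P (EFin \o (fun x => bdens u x ^+ 2 * x ^+ 2))].
  move=> uac; rewrite integral_speed// !ge0_integrableP; [split => //| | | |].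
  - rewrite (@ae_congr_integral _ _ _ leb P _ (fun x => (bdens u x ^+ 2 * x ^+ 2)%:E))//.
    by apply: filterS (ae_bdens uac) => x H /H[_ ->].
  - by move=> x _; rewrite mulr_ge0// sqr_ge0.
  - by apply: measurable_funM; apply: measurable_funX => //; exact: measurable_bdens.
  - by move=> x _; exact: sqr_speed_ge0.
  - apply: measurable_funM; first by apply: measurable_funX; exact: measurable_pos.
    by apply: measurable_funM => //; exact: measurable_funX.
by split=> [[uac u1 u2]|[uac u1 u2]]; have [k1 k2] := key uac; split => //;
  [exact/k1|exact/k2|exact/k1|exact/k2].
Qed.

Definition bform lam u v x : R :=
  bdens u x * bdens v x * x ^+ 2 + lam * (u x * v x * (2 * x ^+ 2)).

Lemma bform_ge0 lam u x : 0 <= lam -> 0 <= bform lam u u x.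
Proof.
move=> lam0; rewrite /bform -!expr2 addr_ge0//; first by rewrite mulr_ge0 ?sqr_ge0.
by rewrite mulr_ge0// sqr_speed_ge0.
Qed.

Lemma measurable_bform lam u v : loc_abs_cont `]0, +oo[ u ->
  loc_abs_cont `]0, +oo[ v -> measurable_fun P (bform lam u v).
Proof.
move=> uac vac; apply: measurable_funD.
  apply: measurable_funM; last exact: measurable_funX.
  by apply: measurable_funM; exact: measurable_bdens.
apply: measurable_funM => //; apply: measurable_funM.
  by apply: measurable_funM; exact: measurable_pos.
by apply: measurable_funM => //; exact: measurable_funX.
Qed.

Lemma integrable_sqr_mul (w f g : R -> R) : measurable_fun P w -> (forall x, 0 <= w x) ->
  measurable_fun P f -> measurable_fun P g ->
  leb.-integrable P (EFin \o (fun x => f x ^+ 2 * w x)) ->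
  leb.-integrable P (EFin \o (fun x => g x ^+ 2 * w x)) ->
  leb.-integrable P (EFin \o (fun x => f x * g x * w x)).
Proof.
move=> mw w0 mf mg fi gi.
have S : leb.-integrable P (EFin \o (fun x => f x ^+ 2 * w x + g x ^+ 2 * w x)).
  exact: (@integrableD _ _ _ _ _ measurable_P _ _ fi gi).
apply: le_integrable S; first exact: measurable_P.
  by apply/measurable_EFinP; apply: measurable_funM => //; exact: measurable_funM.
move=> x _ /=; rewrite lee_fin -mulrDl normrM [leRHS]normrM (ger0_norm (w0 x)) ler_wpM2r//.
rewrite [leRHS]ger0_norm ?addr_ge0 ?sqr_ge0//.
by rewrite ler_norml; apply/andP; split; nra.
Qed.

Lemma bessel_form_lamE lam u v : bessel_dom u -> bessel_dom v ->
  leb.-integrable P (EFin \o bform lam u v) /\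
  bessel_form_lam lam u v = \int[leb]_(x in P) bform lam u v x.
Proof.
move=> /bessel_domP[uac u1 u2] /bessel_domP[vac v1 v2].
have mx2 : measurable_fun P (fun x : R => x ^+ 2) by exact: measurable_funX.
have m2x2 : measurable_fun P (fun x : R => 2 * x ^+ 2) by exact: measurable_funM.
have i1 : leb.-integrable P (EFin \o (fun x => bdens u x * bdens v x * x ^+ 2)).
  apply: integrable_sqr_mul => //; [|exact: measurable_bdens|exact: measurable_bdens].
  by move=> x; exact: sqr_ge0.
have i2 : leb.-integrable P (EFin \o (fun x => u x * v x * (2 * x ^+ 2))).
  apply: integrable_sqr_mul => //; [|exact: measurable_pos|exact: measurable_pos].
  by move=> x; rewrite mulr_ge0// sqr_ge0.
have i3 : leb.-integrable P (EFin \o (fun x => lam * (u x * v x * (2 * x ^+ 2)))).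
  exact: (@integrableZl _ _ _ _ _ measurable_P lam _ i2).
split; first exact: (@integrableD _ _ _ _ _ measurable_P _ _ i1 i3).
rewrite /bform RintegralD// RintegralZl//.
rewrite /bessel_form_lam /bessel_form; congr (_ + _ * _).
  apply: ae_congr_Rintegral; move: (ae_bdens uac) (ae_bdens vac).
  apply: filterS2.
  by move=> x Hu Hv Px; have [_ ->] := Hu Px; have [_ ->] := Hv Px.
rewrite Rintegral_density//.
by apply: measurable_funM; exact: measurable_pos.
Qed.

Lemma bessel_form_lamC lam u v : bessel_dom u -> bessel_dom v ->
  bessel_form_lam lam u v = bessel_form_lam lam v u.
Proof.
move=> ud vd; have [_ ->] := bessel_form_lamE lam ud vd.
have [_ ->] := bessel_form_lamE lam vd ud.
by apply: eq_Rintegral => x _; rewrite /bform; ring.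
Qed.

Lemma ae_bdensB u v : loc_abs_cont `]0, +oo[ u -> loc_abs_cont `]0, +oo[ v ->
  {ae leb, forall x, P x -> bdens (u \- v) x = bdens u x - bdens v x}.
Proof.
move=> uac vac.
have uvac : loc_abs_cont `]0, +oo[ (u \- v).
  by move=> s t st; apply: abs_contB; [exact: uac|exact: vac].
move: (ae_bdens uac) (ae_bdens vac) (ae_bdens uvac).
apply: filterS3 => x Hu Hv Huv Px; have [du <-] := Hu Px; have [dv <-] := Hv Px.
by have [_ <-] := Huv Px; rewrite !derive1E deriveB.
Qed.

Lemma bessel_domB u v : bessel_dom u -> bessel_dom v -> bessel_dom (u \- v).
Proof.
move=> /bessel_domP[uac u1 u2] /bessel_domP[vac v1 v2].
have uvac : loc_abs_cont `]0, +oo[ (u \- v).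
  by move=> s t st; apply: abs_contB; [exact: uac|exact: vac].
have sq (x y : R) : (x - y) ^+ 2 <= 2 * x ^+ 2 + 2 * y ^+ 2.
  rewrite -subr_ge0 (_ : _ - _ = (x + y) ^+ 2); first exact: sqr_ge0.
  by ring.
have dbl (f g : R -> R) : leb.-integrable P (EFin \o f) -> leb.-integrable P (EFin \o g) ->
    leb.-integrable P (EFin \o (fun x => 2 * f x + 2 * g x)).
  move=> fi gi.
  have f2 := @integrableZl _ _ _ _ _ measurable_P 2 _ fi.
  have g2 := @integrableZl _ _ _ _ _ measurable_P 2 _ gi.
  exact: (@integrableD _ _ _ _ _ measurable_P _ _ f2 g2).
apply/bessel_domP; split => //.
  apply: le_integrable (dbl _ _ u1 v1); first exact: measurable_P.
    apply/measurable_EFinP; apply: measurable_funM; last by apply: measurable_funM => //; exact: measurable_funX.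
    by apply: measurable_funX; exact: measurable_pos.
  move=> x _ /=; rewrite lee_fin; have w0 : 0 <= 2 * x ^+ 2 by rewrite mulr_ge0// sqr_ge0.
  rewrite (mulrA 2) (mulrA 2 (v x ^+ 2)) -mulrDl normrM [leRHS]normrM ler_wpM2r//.
  rewrite ger0_norm ?sqr_ge0// ger0_norm; first exact: sq.
  exact: le_trans (sqr_ge0 _) (sq _ _).
apply: ae_eq_le_integrable (dbl _ _ u2 v2); first exact: measurable_P.
  by apply/measurable_EFinP; apply: measurable_funM; apply: measurable_funX => //; exact: measurable_bdens.
apply: filterS (ae_bdensB uac vac).
move=> x H Px /=; rewrite lee_fin H// (mulrA 2) (mulrA 2 (bdens v x ^+ 2)) -mulrDl normrM [leRHS]normrM ler_wpM2r//.
rewrite ger0_norm ?sqr_ge0// ger0_norm; first exact: sq.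
exact: le_trans (sqr_ge0 _) (sq _ _).
Qed.

Lemma bessel_form_lamBl lam u v w : bessel_dom u -> bessel_dom v -> bessel_dom w ->
  bessel_form_lam lam (u \- v) w = bessel_form_lam lam u w - bessel_form_lam lam v w.
Proof.
move=> ud vd wd; have uvd := bessel_domB ud vd.
have [_ ->] := bessel_form_lamE lam uvd wd.
have [ui ->] := bessel_form_lamE lam ud wd.
have [vi ->] := bessel_form_lamE lam vd wd.
rewrite -RintegralB//.
apply: ae_congr_Rintegral.
have [uac _ _] := ud; have [vac _ _] := vd.
apply: filterS (ae_bdensB uac vac).
by move=> x H Px; rewrite /bform H//=; ring.
Qed.

Lemma bessel_form_lam_ge0 lam u : 0 <= lam -> bessel_dom u -> 0 <= bessel_form_lam lam u u.
Proof.
move=> lam0 ud; have [_ ->] := bessel_form_lamE lam ud ud.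
by apply: Rintegral_ge0 => x _; exact: bform_ge0.
Qed.

End bessel_dom_facts.

(** * Solutions on an interval *)

Section pieces.
Context {R : realType}.
Implicit Types (a b c k lam : R) (f u w g q p : R -> R).
Local Notation leb := (@lebesgue_measure R).

Lemma derive_abs_cont a b f df (M : R) : (forall x : R, is_derive x 1 f (df x)) ->
  (forall x, a <= x <= b -> `|df x| <= M) -> abs_cont `[a, b] f.
Proof.
move=> fdf dfM; apply: (@lipschitz_abs_cont _ _ _ M) => x y xy xyab.
have cf : {within `[x, y], continuous f}.
  apply: continuous_subspaceT => z; apply: differentiable_continuous.
  exact/derivable1_diffP.
have [z zxy ->] := MVT_segment xy (fun z _ => fdf z) cf.
rewrite normrM (ger0_norm (_ : 0 <= y - x)) ?subr_ge0// ler_wpM2r ?subr_ge0//.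
by apply: dfM; have := xyab z zxy; rewrite /= in_itv.
Qed.

Lemma cst_abs_cont a b c : abs_cont `[a, b] (fun=> c).
Proof. by apply: (@lipschitz_abs_cont _ _ _ 0) => x y _ _; rewrite subrr normr0 mul0r. Qed.

Lemma id_abs_cont a b : abs_cont `[a, b] (fun x : R => x).
Proof.
by apply: (@lipschitz_abs_cont _ _ _ 1) => x y xy _; rewrite mul1r ger0_norm ?subr_ge0.
Qed.

Lemma inv_abs_cont_pos a b : 0 < a -> abs_cont `[a, b] (fun x => x^-1).
Proof.
move=> a0; have := abs_contB (@cst_abs_cont a b 0) (inv_abs_cont b a0).
by apply: abs_cont_eq => x _ /=; rewrite sub0r opprK.
Qed.

Definition cexp c k x : R := c * expR (k * x).

Lemma is_derive_cexp c k (x : R) : is_derive x 1 (cexp c k) (k * cexp c k x).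
Proof.
have d1 : is_derive x 1 (fun y => k * y) k.
  have := is_deriveZ k (is_derive_id x (1 : R)).
  by rewrite /GRing.scale/= mulr1.
have d2 := is_derive1_comp (is_derive_expR (k * x)) d1.
have := is_deriveZ c d2; rewrite /cexp /GRing.scale/= => d3.
by apply: is_derive_eq; ring.
Qed.

Lemma cexp_abs_cont a b c k : abs_cont `[a, b] (cexp c k).
Proof.
apply: (@derive_abs_cont _ _ _ (fun x => k * cexp c k x)
   (`|k| * (`|c| * (expR (k * a) + expR (k * b))))) => [x|x /andP[ax xb]].
  exact: is_derive_cexp.
rewrite /cexp !normrM ler_wpM2l// ler_wpM2l// ger0_norm ?expR_ge0//.
have [k0|k0] := leP 0 k.
  by rewrite ler_wpDl ?expR_ge0// ler_expR ler_wpM2l.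
by rewrite ler_wpDr ?expR_ge0// ler_expR ler_wnM2l// ltW.
Qed.

(** [p] is the flux [x ^+ 2 q'] of a solution of
    [(x ^+ 2 q')' = 2 lam x ^+ 2 q]. Keeping it as a separate function avoids
    second derivatives. *)
Definition is_piece lam a b q p : Prop :=
  [/\ abs_cont `[a, b] q, abs_cont `[a, b] p &
      forall x, a < x < b -> is_derive x 1 q (p x / x ^+ 2) /\
        is_derive x 1 p (lam * (q x * (2 * x ^+ 2)))].

(** With [q = S / x] the equation becomes [S'' = 2 lam S] and the flux is
    [x S' - S]. The boundary values determine the two exponentials in [S]. *)
Lemma exists_piece lam a b ya yb : 0 < lam -> 0 < a -> a < b ->
  exists q p, [/\ is_piece lam a b q p, q a = ya & q b = yb].
Proof.
move=> lam0 a0 ab; have b0 := lt_trans a0 ab.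
pose c := Num.sqrt (2 * lam); have c2 : c ^+ 2 = 2 * lam by rewrite sqr_sqrtr// mulr_ge0// ltW.
have c0 : 0 < c by rewrite sqrtr_gt0 mulr_gt0.
pose E := expR (c * a); pose F := expR (c * b).
have E0 : 0 < E by exact: expR_gt0.
have F0 : 0 < F by exact: expR_gt0.
have EF : E < F by rewrite ltr_expR ltr_pM2l.
have D0 : E ^+ 2 - F ^+ 2 != 0.
  by rewrite subr_eq0 eqrXn2 ?ltW// lt_eqF.
pose A := (a * ya * E - b * yb * F) / (E ^+ 2 - F ^+ 2).
pose B := a * ya * E - A * E ^+ 2.
pose S := cexp A c \+ cexp B (- c); pose T := cexp A c \- cexp B (- c).
have dS (x : R) : is_derive x 1 S (c * T x).
  have := is_deriveD (is_derive_cexp A c x) (is_derive_cexp B (- c) x).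
  by rewrite /S /T/= mulNr -mulrBr.
have dT (x : R) : is_derive x 1 T (c * S x).
  have := is_deriveB (is_derive_cexp A c x) (is_derive_cexp B (- c) x).
  by rewrite /S /T/= mulNr opprK -mulrDr.
have aS : abs_cont `[a, b] S by apply: abs_contD; exact: cexp_abs_cont.
have aT : abs_cont `[a, b] T by apply: abs_contB; exact: cexp_abs_cont.
exists (fun x => S x * x^-1), (fun x => c * x * T x - S x); split.
- split.
  + exact: (abs_contM_itv aS (inv_abs_cont_pos b a0)).
  + have := abs_contB (abs_contM_itv (abs_contM_itv (@cst_abs_cont a b c) (@id_abs_cont a b)) aT) aS.
    exact.
  + move=> x /andP[ax xb]; have x0 : x != 0 by rewrite gt_eqF// (lt_trans a0).
    split.
      have := is_deriveM (dS x) (is_deriveV x0 (is_derive_id x (1 : R))).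
      rewrite /GRing.scale/= => d.
      by apply: is_derive_eq; field.
    have d1 : is_derive x 1 (fun y => c * y) c.
      have := is_deriveZ c (is_derive_id x (1 : R)).
      by rewrite /GRing.scale/= mulr1.
    have := is_deriveB (is_deriveM d1 (dT x)) (dS x).
    rewrite /GRing.scale/= => d.
    have lamE : lam = c ^+ 2 / 2 by rewrite c2; field.
    by apply: is_derive_eq; rewrite lamE; field.
- rewrite /S /cexp /= mulNr expRN -/E /B.
  by field; rewrite !gt_eqF.
- rewrite /S /cexp /= mulNr expRN -/F /B /A.
  by field; rewrite D0 !gt_eqF.
Qed.

(** The function with these boundary values that is affine in the scale
    [- 1 / x]. *)
Definition harm a b ya yb x : R := ya + (yb - ya) / (a^-1 - b^-1) * (a^-1 - x^-1).

Lemma harm_l a b ya yb : harm a b ya yb a = ya.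
Proof. by rewrite /harm subrr mulr0 addr0. Qed.

Lemma harm_r a b ya yb : 0 < a -> a < b -> harm a b ya yb b = yb.
Proof.
move=> a0 ab; rewrite /harm mulfVK ?subrKC// gt_eqF// inv_sub_gt0//.
Qed.

Lemma harm0 a b x : harm a b 0 0 x = 0.
Proof. by rewrite /harm subrr !mul0r addr0. Qed.

Lemma is_piece_harm a b ya yb : 0 < a ->
  is_piece 0 a b (harm a b ya yb) (fun=> (yb - ya) / (a^-1 - b^-1)).
Proof.
move=> a0; set K := _ / _; split; [|exact: cst_abs_cont|].
  apply: (abs_contD (@cst_abs_cont a b ya)).
  apply: (abs_contM_itv (@cst_abs_cont a b K)).
  exact: (abs_contB (@cst_abs_cont a b a^-1) (inv_abs_cont_pos b a0)).
move=> x /andP[ax xb]; have x0 : x != 0 by rewrite gt_eqF// (lt_trans a0).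
split; last by apply: is_derive_eq; rewrite mul0r.
have d1 := is_deriveV x0 (is_derive_id x (1 : R)).
have d2 := is_deriveD (is_derive_cst ya x 1) (is_deriveZ K (is_deriveB (is_derive_cst a^-1 x 1) d1)).
move: d2; rewrite /GRing.scale/= => d.
by apply: is_derive_eq; field.
Qed.

Lemma abs_cont_measurable a b f : abs_cont `[a, b] f ->
  measurable_fun (`[a, b]%classic : set (measurableTypeR R)) f.
Proof.
move=> fab; apply: subspace_continuous_measurable_fun; first exact: measurable_itv.
exact: abs_cont_continuous.
Qed.

(** The product [p * w] has derivative [p w' + 2 lam x ^+ 2 q w]. *)
Lemma piece_ipp lam a b q p w g : a < b -> is_piece lam a b q p ->
  abs_cont `[a, b] w -> measurable_fun setT g ->
  {ae leb, forall x, a < x < b -> derivable w x 1 /\ derive1 w x = g x} ->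
  leb.-integrable `[a, b] (EFin \o (fun x => p x * g x + lam * (q x * w x * (2 * x ^+ 2)))) /\
  \int[leb]_(x in `[a, b]) (p x * g x + lam * (q x * w x * (2 * x ^+ 2))) = p b * w b - p a * w a.
Proof.
move=> ab [qab pab qp] wab mg wg.
apply: (abs_cont_ftc_ae ab (abs_contM_itv pab wab)).
  apply: measurable_funD.
    by apply: measurable_funM; [exact: abs_cont_measurable|exact: measurable_funTS].
  apply: measurable_funM => //; apply: measurable_funM.
    by apply: measurable_funM; exact: abs_cont_measurable.
  by apply: measurable_funM => //; exact: measurable_funX.
apply: filterS wg; first exact: (ae_filter_ringOfSetsType leb).
move=> x H xab; have [dw <-] := H xab.
have [_ dp] := qp x xab.
have dw' : is_derive x 1 w (derive1 w x) by rewrite derive1E; apply/derivableP.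
have := is_deriveM dp dw'; rewrite /GRing.scale/= derive1E => d.
have [_ dE] := d; rewrite [LHS]derive1E.
transitivity ('D_1 (p * w) x) => //; rewrite dE; ring.
Qed.

End pieces.

(** * Values of the approximating traces *)

Section trace_value.
Context {R : realType}.
Variable a : nat -> {posnum R}.
Implicit Types (u v w z : R -> R) (lam : R).
Local Notation mua := (mu a).
Implicit Types psi : L2 mua.

Lemma bessel_dom_01 u : bessel_dom u -> loc_abs_cont `]0, 1] u.
Proof.
move=> [uac _ _] s t st; apply: uac => x /st; rewrite /= !in_itv/= andbT.
by case/andP.
Qed.

Lemma version_eq01 u v psi : loc_abs_cont `]0, 1] u -> loc_abs_cont `]0, 1] v ->
  is_version u psi -> is_version v psi -> forall x, 0 < x <= 1 -> u x = v x.
Proof.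
move=> uac vac /ae_muP[_ upsi] /ae_muP[_ vpsi].
apply: loc_abs_cont_ae_eq => //; move: upsi vpsi; apply: filterS2; first exact: (ae_filter_ringOfSetsType (@lebesgue_measure R)).
by move=> x H H' x01; rewrite H// H'.
Qed.

Lemma version_atom u psi k : is_version u psi -> (0 < k)%N -> u k%:R = psi k%:R.
Proof. by move=> /ae_muP[+ _] k0; apply. Qed.

Lemma version_kerJ u v psi : bessel_dom u -> bessel_dom v ->
  is_version u psi -> is_version v psi -> ker_J (u \- v).
Proof.
move=> ud vd upsi vpsi; split; first exact: bessel_domB.
  move=> x /andP[x0 x1] /=.
  rewrite (version_eq01 (bessel_dom_01 ud) (bessel_dom_01 vd) upsi vpsi) ?subrr//.
  by rewrite x0 ltW.
by move=> _ [k k0 <-] /=; rewrite (version_atom upsi k0) (version_atom vpsi k0) subrr.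
Qed.

(** An extension [v0] of [psi] that is orthogonal to [ker_J] gives the value.
    The functions [v0] and [v] of any other admissible pair have the same
    products with everything orthogonal to [ker_J], in particular with each
    other. *)
Lemma trace_lamE lam psi v0 : bessel_dom v0 -> is_version v0 psi ->
  (forall z, ker_J z -> bessel_form_lam lam v0 z = 0) ->
  trace_lam lam psi = (bessel_form_lam lam v0 v0)%:E.
Proof.
move=> vd vpsi vz; rewrite /trace_lam; case: xgetP => [e _|].
  move=> [u [v [ud upsi [[vd' vker] [uvd uvker]] ->]]]; congr EFin.
  have u0 : ker_J (u \- v0) := version_kerJ ud vd upsi vpsi.
  have u0d : bessel_dom (u \- v0) by case: u0.
  have H w : bessel_dom w -> (forall z, ker_J z -> bessel_form_lam lam w z = 0) ->
      bessel_form_lam lam v w = bessel_form_lam lam v0 w.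
    move=> wd wz; have := uvker w (conj wd wz); rewrite (bessel_form_lamBl lam ud vd' wd) => e1.
    have := wz _ u0; rewrite (bessel_form_lamC lam wd u0d) (bessel_form_lamBl lam ud vd wd) => e2.
    by move: (bessel_form_lam _ _ _) (bessel_form_lam _ _ _) (bessel_form_lam _ _ _) e1 e2 => x y z; lra.
  by rewrite (H v vd' vker) (bessel_form_lamC lam vd vd') (H v0 vd vz).
move=> /(_ (bessel_form_lam lam v0 v0)%:E) /=.
suff : exists u v, [/\ bessel_dom u, is_version u psi,
    is_orth_proj lam (orth_compl lam (@ker_J R)) u v
    & (bessel_form_lam lam v0 v0)%:E = (bessel_form_lam lam v v)%:E].
  by move=> H /(_ H).
exists v0, v0; split; [exact: vd|exact: vpsi| |by []]; split; first exact: (conj vd vz).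
have k0 := version_kerJ vd vd vpsi vpsi.
have k0d : bessel_dom (v0 \- v0) by case: k0.
split; first exact: k0d.
by move=> w [wd wz]; rewrite (bessel_form_lamC lam k0d wd); exact: wz.
Qed.

Lemma trace_lam_off lam psi : ~ ran_J psi -> trace_lam lam psi = +oo%E.
Proof.
move=> npsi; rewrite /trace_lam; case: xgetP => // e _ [u [v [ud upsi _ _]]].
by case: npsi; exists u.
Qed.

(** Expanding the form at [v0 + (w - v0)], the cross term vanishes. *)
Lemma trace_lam_min lam psi v0 w : 0 <= lam -> bessel_dom v0 -> is_version v0 psi ->
  (forall z, ker_J z -> bessel_form_lam lam v0 z = 0) ->
  bessel_dom w -> is_version w psi ->
  bessel_form_lam lam v0 v0 <= bessel_form_lam lam w w.
Proof.
move=> lam0 vd vpsi vz wd wpsi.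
have k := version_kerJ wd vd wpsi vpsi; have [kd _ _] := k.
have := bessel_form_lam_ge0 lam0 kd; have := vz _ k.
rewrite (bessel_form_lamC _ vd kd) (bessel_form_lamBl _ wd vd vd) (bessel_form_lamBl _ wd vd kd).
rewrite (bessel_form_lamC _ wd kd) (bessel_form_lamC _ vd kd) !(bessel_form_lamBl _ wd vd) //.
rewrite (bessel_form_lamC _ vd wd).
move: (bessel_form_lam _ _ _) (bessel_form_lam _ _ _) (bessel_form_lam _ _ _) => x y z; lra.
Qed.

End trace_value.

(** * Functions given gap by gap *)

Section cells.
Context {R : realType}.
Implicit Types (f : R -> R).
Local Notation leb := (@lebesgue_measure R).
Local Notation P := (`]0%R, +oo[%classic : set (measurableTypeR R)).

(** Open on the left, so that the cells partition the half-line and cell 0 is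
    [`]0, 1]]. *)
Definition cell (n : nat) : set (measurableTypeR R) := `]n%:R, n.+1%:R]%classic.

Lemma measurable_cell n : measurable (cell n).
Proof. exact: measurable_itv. Qed.

Lemma cell_truncn n (x : R) : cell n x -> n%:R < x <= n.+1%:R.
Proof. by rewrite /cell /= in_itv. Qed.

Lemma bigcup_cell : P = \bigcup_n cell n.
Proof.
apply/seteqP; split=> x /=; last first.
  move=> [n _ /cell_truncn/andP[nx _]]; rewrite in_itv/= andbT; exact: le_lt_trans nx.
rewrite in_itv/= andbT => x0.
have [N Nx] : exists N : nat, x <= N%:R by exists (Num.bound x); exact: ltW (archi_boundP (ltW x0)).
have : exists n, (x <= n%:R) by exists N.
move=> /ex_minnP[[|n]]; first by rewrite leNgt x0.
move=> xn nmin; exists n => //; rewrite /cell/= in_itv/= xn andbT ltNge.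
by apply/negP => /nmin; rewrite ltnn.
Qed.

Lemma trivIset_cell : trivIset setT cell.
Proof.
apply/trivIsetP => i j _ _ ij; apply/seteqP; split=> x //= [].
move=> /cell_truncn/andP[ix xi] /cell_truncn/andP[jx xj].
have : (i < j.+1)%N by rewrite -(ltr_nat R) (lt_le_trans ix).
have : (j < i.+1)%N by rewrite -(ltr_nat R) (lt_le_trans jx).
by rewrite !ltnS => ji ij'; move: ij; rewrite eqn_leq ji ij'.
Qed.

Lemma Rintegral_cells0 f : leb.-integrable P (EFin \o f) ->
  (forall n, \int[leb]_(x in cell n) f x = 0) -> \int[leb]_(x in P) f x = 0.
Proof.
move=> fi f0; rewrite /Rintegral bigcup_cell integral_bigcup//.
- rewrite eseries0// => n _ _.
  have : leb.-integrable (cell n) (EFin \o f).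
    apply: integrableS fi; [exact: measurable_P|exact: measurable_cell|].
    by rewrite bigcup_cell; exact: bigcup_sup.
  move=> /(integrable_fin_num (@measurable_cell n)) fn.
  by rewrite -[LHS]fineK//; congr EFin; exact: f0.
- exact: trivIset_cell.
- exact: measurable_cell.
- by rewrite -bigcup_cell.
Qed.

Lemma ge0_integral_cells f : measurable_fun P f -> (forall x, 0 <= f x) ->
  (\int[leb]_(x in P) (f x)%:E = \sum_(0 <= n <oo) \int[leb]_(x in cell n) (f x)%:E)%E.
Proof.
move=> mf f0; rewrite bigcup_cell ge0_integral_bigcup//.
- exact: measurable_cell.
- by rewrite -bigcup_cell; exact/measurable_EFinP.
- by move=> x _; rewrite lee_fin.
- exact: trivIset_cell.
Qed.

Lemma ae_cell n (Q : R -> Prop) : {ae leb, forall x, n%:R < x < n.+1%:R -> Q x} ->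
  {ae leb, forall x, cell n x -> Q x}.
Proof.
have := ae_neq (n.+1%:R : R); apply: filterS2; first exact: (ae_filter_ringOfSetsType leb).
move=> x xt H /cell_truncn/andP[sx xt']; apply: H.
by rewrite sx lt_neqAle xt xt'.
Qed.

Lemma integrable_cell n f :
  leb.-integrable `[n%:R, n.+1%:R] (EFin \o f) -> leb.-integrable (cell n) (EFin \o f).
Proof.
apply: integrableS; [exact: measurable_itv|exact: measurable_cell|].
by move=> x; rewrite /cell/= !in_itv/= => /andP[/ltW -> ->].
Qed.

Lemma Rintegral_cell n f : leb.-integrable `[n%:R, n.+1%:R] (EFin \o f) ->
  \int[leb]_(x in cell n) f x = \int[leb]_(x in `[n%:R, n.+1%:R]) f x.
Proof. by move=> /integrable_cell fi; rewrite /cell Rintegral_itv_obnd_cbnd. Qed.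

End cells.

Section piecewise.
Context {R : realType}.
Local Notation leb := (@lebesgue_measure R).
Local Notation P := (`]0%R, +oo[%classic : set (measurableTypeR R)).

Definition pw (u : R -> R) (q : nat -> R -> R) (x : R) : R :=
  if x <= 1 then u x else q (Num.truncn x) x.

Variables (lam : R) (u : R -> R) (q p : nat -> R -> R).
Hypotheses (uac : loc_abs_cont `]0, 1] u)
  (qp : forall n, (0 < n)%N -> is_piece lam n%:R n.+1%:R (q n) (p n))
  (ql : forall n, (0 < n)%N -> q n n%:R = u n%:R)
  (qr : forall n, (0 < n)%N -> q n n.+1%:R = u n.+1%:R).
Local Notation v := (pw u q).

Lemma pw_01 x : x <= 1 -> v x = u x.
Proof. by rewrite /pw => ->. Qed.

(** Neighbouring pieces agree at the atoms, so each formula holds on a closed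
    gap. *)
Lemma pw_cell n x : (0 < n)%N -> n%:R <= x <= n.+1%:R -> v x = q n x.
Proof.
move=> n0 /andP[nx xn]; rewrite /pw; case: ifPn => [x1|].
  have n1 : (1 : R) <= n%:R by rewrite ler1n.
  have xE : x = n%:R by apply/eqP; rewrite eq_le nx (le_trans x1 n1).
  by rewrite xE ql.
rewrite -ltNge => x1; move: xn; rewrite le_eqVlt => /predU1P[->|xn].
  by rewrite natrK ql// qr.
have /truncn_itv/andP[tx xt] : 0 <= x by rewrite (le_trans _ (ltW x1)).
suff -> : Num.truncn x = n by [].
apply/eqP; rewrite eqn_leq; apply/andP; split; rewrite -ltnS -(ltr_nat R).
  exact: le_lt_trans tx xn.
exact: le_lt_trans nx xt.
Qed.

Lemma pw_atom k : (0 < k)%N -> v k%:R = u k%:R.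
Proof. by move=> k0; rewrite (@pw_cell k) ?ql// lexx ler_nat leqnSn. Qed.

Lemma pw_loc_abs_cont : loc_abs_cont `]0, +oo[ v.
Proof.
move=> s t st; have [s0|s0] := leP s 0.
  have [ts|ts] := ltP t s.
    move=> e e0; exists 1 => // n x y xy _ _; rewrite big1// => i _.
    have [xyi xyA] := xy i; have [+ _] := itvcc_ends xyi xyA.
    by rewrite /= in_itv/= => /andP[sx /(le_trans sx)]; rewrite leNgt ts.
  by have := st s; rewrite /= !in_itv/= lexx ts andbT => /(_ isT); rewrite ltNge s0.
pose s' := Num.min s 1; have s'0 : 0 < s' by rewrite lt_min s0 ltr01.
have s'1 : s' <= 1 by rewrite ge_min lexx orbT.
have key n : abs_cont `[s', n.+1%:R] v.
  elim: n => [|n IH].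
    apply: (@abs_cont_eq _ _ u); last first.
      apply: uac => x; rewrite /= !in_itv/= => /andP[+ ->].
      by rewrite andbT; exact: lt_le_trans.
    by move=> x; rewrite inE/= in_itv/= => /andP[_ x1]; rewrite pw_01.
  have n1 : (1 : R) <= n.+1%:R by rewrite ler1n.
  apply: (abs_cont_glue (le_trans s'1 n1) _ IH); first by rewrite ler_nat.
  have [qac _ _] := qp (ltn0Sn n); apply: abs_cont_eq qac.
  by move=> x; rewrite inE/= in_itv/= => xn; rewrite (@pw_cell n.+1).
apply: abs_contS (key (Num.bound t)) => x; rewrite /= !in_itv/= => /andP[sx xt].
rewrite ge_min sx/=; apply: (le_trans xt).
have [t0|t0] := leP 0 t; last by rewrite (le_trans (ltW t0)).
by apply: (le_trans (ltW (archi_boundP t0))); rewrite ler_nat leqnSn.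
Qed.

Lemma pw_density0 : {ae leb, forall x, 0 < x < 1 -> bdens v x = dini (u \_ `]0, 1]) x}.
Proof.
have [_ uae _] := has_density_01 uac.
move: (ae_bdens pw_loc_abs_cont) uae; apply: filterS2.
move=> x Hv Hu /andP[x0 x1].
have [_ <-] := Hv ltac:(by rewrite /= in_itv/= x0).
have [_ <-] := Hu ltac:(by rewrite /= in_itv/= x0).
apply: near_eq_derive1; near=> y; rewrite pw_01//.
by apply: ltW; near: y; exact: lt_nbhsl.
Unshelve. all: by end_near. Qed.

Lemma pw_density n : (0 < n)%N ->
  {ae leb, forall x, n%:R < x < n.+1%:R -> bdens v x = p n x / x ^+ 2}.
Proof.
move=> n0; have [_ _ dq] := qp n0.
apply: filterS (ae_bdens pw_loc_abs_cont).
move=> x Hv /[dup] xn /andP[nx xn'].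
have x0 : 0 < x by exact: le_lt_trans nx.
have [_ <-] := Hv ltac:(by rewrite /= in_itv/= x0).
have [[_ <-] _] := dq x xn; rewrite -derive1E.
apply: near_eq_derive1; near=> y; rewrite (@pw_cell n)//.
apply/andP; split; apply: ltW; near: y; [exact: lt_nbhsr|exact: lt_nbhsl].
Unshelve. all: by end_near. Qed.

End piecewise.

(** * The orthogonal projection *)

Section piecewise_energy.
Context {R : realType}.
Implicit Types (z w : R -> R).
Local Notation leb := (@lebesgue_measure R).
Local Notation P := (`]0%R, +oo[%classic : set (measurableTypeR R)).

Variables (lam : R) (u : R -> R) (q p : nat -> R -> R).
Hypotheses (uac : loc_abs_cont `]0, 1] u)
  (qp : forall n, (0 < n)%N -> is_piece lam n%:R n.+1%:R (q n) (p n))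
  (ql : forall n, (0 < n)%N -> q n n%:R = u n%:R)
  (qr : forall n, (0 < n)%N -> q n n.+1%:R = u n.+1%:R).
Local Notation v := (pw u q).

Let vac : loc_abs_cont `]0, +oo[ v := pw_loc_abs_cont uac qp ql qr.

Let cell_pos n (x : R) : (0 < n)%N -> n%:R <= x <= n.+1%:R -> 0 < x.
Proof. by move=> n0 /andP[+ _]; apply: lt_le_trans; rewrite ltr0n. Qed.

Let cell_loc n w : (0 < n)%N -> loc_abs_cont `]0, +oo[ w -> abs_cont `[n%:R, n.+1%:R] w.
Proof.
move=> n0; apply => x; rewrite /= !in_itv/= andbT; exact: cell_pos.
Qed.

Let ltnat n : (n%:R : R) < n.+1%:R.
Proof. by rewrite ltr_nat. Qed.

(** Green's formula: on a gap the form reduces to boundary terms. *)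
Lemma pw_green n w : (0 < n)%N -> loc_abs_cont `]0, +oo[ w ->
  leb.-integrable `[n%:R, n.+1%:R] (EFin \o bform lam v w) /\
  \int[leb]_(x in `[n%:R, n.+1%:R]) bform lam v w x =
    p n n.+1%:R * w n.+1%:R - p n n%:R * w n%:R.
Proof.
move=> n0 wac; have [mG wae _] := bdensP wac.
have wae' : {ae leb, forall x, n%:R < x < n.+1%:R -> derivable w x 1 /\ derive1 w x = bdens w x}.
  apply: filterS wae; first exact: (ae_filter_ringOfSetsType leb).
  move=> x H /andP[nx xn]; apply: H; rewrite /= in_itv/= andbT.
  by apply: (@cell_pos n); rewrite // !ltW.
have [Xi XE] := piece_ipp (ltnat n) (qp n0) (cell_loc n0 wac) mG wae'.
have E : {ae leb, forall x, `[n%:R, n.+1%:R]%classic x ->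
    p n x * bdens w x + lam * (q n x * w x * (2 * x ^+ 2)) = bform lam v w x}.
  apply: ae_itvcc; move: (pw_density uac qp ql qr n0).
  apply: filterS; first exact: (ae_filter_ringOfSetsType leb).
  move=> x H xn; rewrite /bform H//.
  have xn' : n%:R <= x <= n.+1%:R by case/andP: xn => /ltW -> /ltW ->.
  rewrite (pw_cell ql qr n0 xn'); congr (_ + _).
  by field; rewrite gt_eqF//; exact: cell_pos xn'.
split; last by rewrite -XE; apply/esym/ae_congr_Rintegral.
apply: ae_eq_integrable Xi.
  have mP := measurable_bform lam vac wac.
  apply/measurable_EFinP; apply: measurable_funS mP; first exact: measurable_P.
  by move=> x; rewrite /= !in_itv/= andbT; exact: cell_pos.
apply: filterS E; first exact: (ae_filter_ringOfSetsType leb).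
by move=> x H /H /= ->.
Qed.

(** On [`]0, 1]] the function [z] vanishes, and on each gap the boundary terms
    do. *)
Lemma pw_orth z : bessel_dom v -> ker_J z -> bessel_form_lam lam v z = 0.
Proof.
move=> vd [zd z01 zat]; have [zac _ _] := zd.
have [fi ->] := bessel_form_lamE lam vd zd.
apply: Rintegral_cells0 => // -[|n]; last first.
  have [Xi XE] := pw_green (ltn0Sn n) zac.
  rewrite Rintegral_cell// XE !zat ?mulr0 ?subrr//; first by exists n.+1.
  by exists n.+2.
transitivity (\int[leb]_(x in @cell R 0) (cst 0 x)); last first.
  by rewrite Rintegral_cst ?mul0r//; exact: measurable_cell.
apply: ae_congr_Rintegral; apply: ae_cell.
apply: filterS (ae_bdens zac) => x H /[dup] x01 /andP[x0 x1].
have [_ zE] := H ltac:(by rewrite /= in_itv/= x0).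
rewrite /bform -zE z01// mulr0 mul0r mulr0 addr0 (_ : derive1 z x = 0) ?mulr0 ?mul0r//.
rewrite (@near_eq_derive1 _ _ (cst 0)) ?derive1_cst//.
near=> y; apply: z01; apply/andP; split; near: y; [exact: lt_nbhsr|exact: lt_nbhsl].
Unshelve. all: by end_near. Qed.

End piecewise_energy.

Section projection.
Context {R : realType}.
Local Notation leb := (@lebesgue_measure R).
Local Notation P := (`]0%R, +oo[%classic : set (measurableTypeR R)).
Variables (lam : R) (u : R -> R) (q p : nat -> R -> R).
Hypotheses (lam_gt0 : 0 < lam) (ud : bessel_dom u)
  (qp : forall n, (0 < n)%N -> is_piece lam n%:R n.+1%:R (q n) (p n))
  (ql : forall n, (0 < n)%N -> q n n%:R = u n%:R)
  (qr : forall n, (0 < n)%N -> q n n.+1%:R = u n.+1%:R).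
Local Notation v := (pw u q).

Let uac : loc_abs_cont `]0, +oo[ u. Proof. by case: ud. Qed.
Let uac1 : loc_abs_cont `]0, 1] u := bessel_dom_01 ud.
Let vac : loc_abs_cont `]0, +oo[ v := pw_loc_abs_cont uac1 qp ql qr.

Let lam_ge0 : 0 <= lam := ltW lam_gt0.
Let bform0 w x : 0 <= bform lam w w x := @bform_ge0 R lam w x lam_ge0.

Let cellP n : @cell R n `<=` P.
Proof. by rewrite bigcup_cell; exact: bigcup_sup. Qed.

(** On a gap the solution has least energy among functions with its boundary
    values, as the cross term vanishes by Green's formula. *)
Lemma pw_cell_le n : (\int[leb]_(x in cell n) (bform lam v v x)%:E <=
  \int[leb]_(x in cell n) (bform lam u u x)%:E)%E.
Proof.
have [->|n0] := posnP n.
  suff -> : (\int[leb]_(x in cell 0) (bform lam v v x)%:E =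
    \int[leb]_(x in cell 0) (bform lam u u x)%:E)%E by [].
  apply: ae_congr_integral; apply: ae_cell.
  move: (ae_bdens uac) (ae_bdens vac); apply: filterS2.
  move=> x Hu Hv /andP[x0 x1].
  have [_ uE] := Hu ltac:(by rewrite /= in_itv/= x0).
  have [_ vE] := Hv ltac:(by rewrite /= in_itv/= x0).
  rewrite /bform (pw_01 _ _ (ltW x1)) -uE -vE; do 3 f_equal.
    suff -> : derive1 v x = derive1 u x by [].
    apply: near_eq_derive1; near=> y; rewrite pw_01//.
    by apply: ltW; near: y; exact: lt_nbhsl.
have wac : loc_abs_cont `]0, +oo[ (u \- v).
  by move=> s t st; apply: abs_contB; [exact: uac|exact: vac].
have [Xi XE] := pw_green uac1 qp ql qr n0 wac.
have [Vi VE] := pw_green uac1 qp ql qr n0 vac.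
have X0 : \int[leb]_(x in cell n) bform lam v (u \- v) x = 0.
  rewrite (Rintegral_cell Xi) XE /= !(pw_atom ql qr) //.
  by rewrite !subrr !mulr0 subrr.
have X2 := @integrableZl _ _ _ _ _ (@measurable_cell R n) 2 _ (integrable_cell Xi).
have S : (\int[leb]_(x in cell n) (bform lam v v x)%:E =
   \int[leb]_(x in cell n) (bform lam v v x + 2 * bform lam v (u \- v) x)%:E)%E.
  have fV := integrable_fin_num (@measurable_cell R n) (integrable_cell Vi).
  have iS := @integrableD _ _ _ _ _ (@measurable_cell R n) _ _ (integrable_cell Vi) X2.
  have fS := integrable_fin_num (@measurable_cell R n) iS.
  rewrite -[LHS]fineK// -[RHS]fineK//; congr EFin.
  rewrite -/(Rintegral _ _ _) -/(Rintegral _ _ _) RintegralD//; last 2 first.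
  - exact: measurable_cell.
  - exact: integrable_cell.
  by rewrite RintegralZl//; [rewrite X0 mulr0 addr0|exact: measurable_cell|exact: integrable_cell].
pose U' x := bform lam v v x + 2 * bform lam v (u \- v) x + bform lam (u \- v) (u \- v) x.
have UE : {ae leb, forall x, cell n x -> (bform lam u u x)%:E = (U' x)%:E}.
  move: (ae_bdensB uac vac); apply: filterS => x H /cellP/H E.
  by congr EFin; rewrite /U' /bform E /=; ring.
have mcell (w w' : R -> R) : loc_abs_cont `]0, +oo[ w -> loc_abs_cont `]0, +oo[ w' ->
    measurable_fun (@cell R n) (bform lam w w').
  move=> ? ?; apply: measurable_funS (@cellP n) _; first exact: measurable_P.
  exact: measurable_bform.
have Ui : leb.-integrable (@cell R n) (EFin \o U').
  have [Ui _] := bessel_form_lamE lam ud ud.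
  have Ui' := integrableS (measurable_P) (@measurable_cell R n) (@cellP n) Ui.
  apply: ae_eq_integrable Ui'; last exact: UE.
  apply/measurable_EFinP; apply: measurable_funD; last exact: mcell.
  by apply: measurable_funD; [exact: mcell|apply: measurable_funM => //; exact: mcell].
rewrite S (ae_congr_integral UE); apply: le_integral.
- exact: measurable_cell.
- exact: (@integrableD _ _ _ _ _ (@measurable_cell R n) _ _ (integrable_cell Vi) X2).
- exact: Ui.
- by move=> x _; rewrite lee_fin lerDl bform0.
Unshelve. all: by end_near. Qed.

(** Membership in the domain comes from the comparison with [u] on each gap. *)
Lemma bessel_dom_pw : bessel_dom v.
Proof.
have [Ui _] := bessel_form_lamE lam ud ud.
have fin : (\int[leb]_(x in P) (bform lam v v x)%:E < +oo)%E.
  apply: (@le_lt_trans _ _ (\int[leb]_(x in P) (bform lam u u x)%:E)%E); last first.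
    by apply/(ge0_integrableP _ (measurable_bform lam uac uac)) => // x _; exact: bform0.
  rewrite !ge0_integral_cells; [|exact: measurable_bform|exact: bform0|exact: measurable_bform|exact: bform0].
  apply: lee_nneseries => [n _|n _]; last exact: pw_cell_le.
  by move=> _; apply: integral_ge0 => x _; rewrite lee_fin bform0.
have Vi : leb.-integrable P (EFin \o bform lam v v).
  by apply/(ge0_integrableP _ (measurable_bform lam vac vac)) => // x _; exact: bform0.
have g0 (x : R) : 0 <= v x ^+ 2 * (2 * x ^+ 2) by exact: sqr_speed_ge0.
have d0 (x : R) : 0 <= bdens v x ^+ 2 * x ^+ 2 by rewrite mulr_ge0 ?sqr_ge0.
apply/bessel_domP; split; first exact: vac.
  have Vi' := @integrableZl _ _ _ _ _ measurable_P lam^-1 _ Vi.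
  apply: le_integrable Vi'; first exact: measurable_P.
    apply/measurable_EFinP; apply: measurable_funM; first by apply: measurable_funX; exact: measurable_pos.
    by apply: measurable_funM => //; exact: measurable_funX.
  move=> x _ /=; rewrite lee_fin ger0_norm// ger0_norm; last first.
    by apply: mulr_ge0; [rewrite invr_ge0 ltW|exact: bform0].
  rewrite ler_pdivlMl// /bform -!expr2 lerDr.
  exact: d0.
apply: le_integrable Vi; first exact: measurable_P.
  by apply/measurable_EFinP; apply: measurable_funM; apply: measurable_funX => //; exact: measurable_bdens.
move=> x _ /=; rewrite lee_fin ger0_norm// ger0_norm ?bform0//.
by rewrite /bform -!expr2 lerDl; apply: mulr_ge0; [exact: ltW|exact: g0].
Qed.

End projection.

(** * Bounds for the approximating traces *)

Section trace_bounds.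
Context {R : realType}.
Variable a : nat -> {posnum R}.
Implicit Types (u v w z : R -> R) (lam C : R).
Local Notation leb := (@lebesgue_measure R).
Local Notation P := (`]0%R, +oo[%classic : set (measurableTypeR R)).
Local Notation mua := (mu a).
Implicit Types psi : L2 mua.

Lemma exists_projection lam u : 0 < lam -> bessel_dom u ->
  exists v, [/\ bessel_dom v, forall x, x <= 1 -> v x = u x,
    forall k, (0 < k)%N -> v k%:R = u k%:R &
    forall z, ker_J z -> bessel_form_lam lam v z = 0].
Proof.
move=> lam0 ud; have uac1 := bessel_dom_01 ud.
have H n : exists qp : (R -> R) * (R -> R), (0 < n)%N ->
    [/\ is_piece lam n%:R n.+1%:R qp.1 qp.2, qp.1 n%:R = u n%:R & qp.1 n.+1%:R = u n.+1%:R].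
  have [->|n0] := posnP n; first by exists (cst 0, cst 0).
  have [q [p qpP]] := @exists_piece R lam n%:R n.+1%:R (u n%:R) (u n.+1%:R) lam0
    ltac:(by rewrite ltr0n) ltac:(by rewrite ltr_nat).
  by exists (q, p).
have [qp qpP] := choice H; pose q n := (qp n).1; pose p n := (qp n).2.
have qpi n : (0 < n)%N -> is_piece lam n%:R n.+1%:R (q n) (p n) by move=> /qpP[].
have ql n : (0 < n)%N -> q n n%:R = u n%:R by move=> /qpP[].
have qr n : (0 < n)%N -> q n n.+1%:R = u n.+1%:R by move=> /qpP[].
have vd := bessel_dom_pw lam0 ud qpi ql qr.
exists (pw u q); split=> //.
- by move=> x; exact: pw_01.
- by move=> k; exact: pw_atom.
- by move=> z; exact: (pw_orth uac1 qpi ql qr vd).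
Qed.

Lemma is_version_ext u v psi : (forall x, x <= 1 -> v x = u x) ->
  (forall k, (0 < k)%N -> v k%:R = u k%:R) -> is_version u psi -> is_version v psi.
Proof.
move=> v01 vk /ae_muP[uk u01]; apply/ae_muP; split=> [k k0|]; first by rewrite vk// uk.
apply: filterS u01; first exact: (ae_filter_ringOfSetsType leb).
by move=> x H /[dup] /andP[_ /ltW x1] /H; rewrite v01.
Qed.

Lemma trace_lam_ranJ lam psi : 0 < lam -> ran_J psi ->
  exists v, [/\ bessel_dom v, is_version v psi,
    trace_lam lam psi = (bessel_form_lam lam v v)%:E &
    forall w, bessel_dom w -> is_version w psi ->
      (trace_lam lam psi <= (bessel_form_lam lam w w)%:E)%E].
Proof.
move=> lam0 [u ud upsi]; have [v [vd v01 vk vz]] := exists_projection lam0 ud.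
have vpsi := is_version_ext v01 vk upsi.
exists v; split=> // [|w wd wpsi]; first exact: trace_lamE.
rewrite (trace_lamE vd vpsi vz) lee_fin.
exact: (trace_lam_min (ltW lam0) vd vpsi vz wd wpsi).
Qed.

Lemma bessel_form0E u : bessel_dom u -> bessel_form_lam 0 u u =
  \int[leb]_(x in P) (bdens u x ^+ 2 * x ^+ 2).
Proof.
move=> ud; have [_ ->] := bessel_form_lamE 0 ud ud.
by apply: eq_Rintegral => x _; rewrite /bform mul0r addr0 expr2.
Qed.

Lemma bessel_form_lam_split lam u : bessel_dom u ->
  bessel_form_lam lam u u = bessel_form_lam 0 u u +
    lam * \int[leb]_(x in P) (u x ^+ 2 * (2 * x ^+ 2)).
Proof.
move=> ud; have /bessel_domP[uac u1 u2] := ud.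
rewrite /bessel_form_lam mul0r addr0; congr (_ + _ * _).
rewrite Rintegral_density//.
by apply: measurable_funM; exact: measurable_pos.
Qed.

Lemma bessel_form_lam_le0 lam u : 0 <= lam -> bessel_dom u ->
  bessel_form_lam 0 u u <= bessel_form_lam lam u u.
Proof.
move=> lam0 ud; rewrite (bessel_form_lam_split lam ud) lerDl mulr_ge0//.
by apply: Rintegral_ge0 => x _; exact: sqr_speed_ge0.
Qed.

Lemma bessel_form0_ereal u : bessel_dom u ->
  (\int[leb]_(x in P) (bdens u x ^+ 2 * x ^+ 2)%:E = (bessel_form_lam 0 u u)%:E)%E.
Proof.
move=> ud; rewrite bessel_form0E// /Rintegral fineK//.
have /bessel_domP[_ _ u2] := ud.
exact: (integrable_fin_num measurable_P u2).
Qed.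

Lemma sum_jumps u K : \sum_(1 <= k < K.+1) (k * k.+1)%:R * (u k.+1%:R - u k%:R) ^+ 2 =
  \sum_(i < K) (u i.+2%:R - u i.+1%:R) ^+ 2 / (i.+1%:R^-1 - i.+2%:R^-1).
Proof.
rewrite big_add1/= big_mkord; apply: eq_bigr => i _.
rewrite mulrC natrM; congr (_ * _).
set x : R := i.+1%:R; have -> : (i.+2%:R : R) = x + 1 by rewrite -[i.+2]addn1 natrD.
have x0 : 0 < x by rewrite ltr0n.
have -> : x^-1 - (x + 1)^-1 = (x * (x + 1))^-1 by field; rewrite !gt_eqF// addr_gt0.
by rewrite invrK.
Qed.

(** The cells of [`]0, 1]] and the gaps between atoms are disjoint, and
    [k * k.+1] is the inverse of the length of a gap in the scale [- 1 / x]. *)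
Lemma bessel_dom_energy u : bessel_dom u -> energy_le u (bessel_form_lam 0 u u).
Proof.
move=> ud I s t K stA tst; have [uac _ _] := ud.
apply: (@le_trans _ _ (\sum_i (u (t i) - u (s i)) ^+ 2 / ((s i)^-1 - (t i)^-1) +
  \sum_(1 <= k < K.+1) (k * k.+1)%:R * (u k.+1%:R - u k%:R) ^+ 2)).
  rewrite lerD2l; case: K => [|K]; first by rewrite !big_geq.
  by rewrite [leRHS]big_nat_recr//= lerDl mulr_ge0// sqr_ge0.
rewrite sum_jumps -lee_fin -bessel_form0_ereal//.
pose S (j : I + 'I_K) : R := match j with inl i => s i | inr i => i.+1%:R end.
pose T (j : I + 'I_K) : R := match j with inl i => t i | inr i => i.+2%:R end.
have uG := bdensP uac.
have -> : \sum_i (u (t i) - u (s i)) ^+ 2 / ((s i)^-1 - (t i)^-1) +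
    \sum_(i < K) (u i.+2%:R - u i.+1%:R) ^+ 2 / (i.+1%:R^-1 - i.+2%:R^-1) =
    \sum_j (u (T j) - u (S j)) ^+ 2 / ((S j)^-1 - (T j)^-1) by rewrite big_sumType.
have sP i : `[s i, t i] `<=` (P : set R).
  have [_ st] := stA i; move=> x /st; rewrite /= !in_itv/= andbT.
  by case/andP.
apply: (has_density_cells uG).
- by [].
- exact: measurable_P.
- case=> i; first by have [st _] := stA i; split=> //; exact: sP.
  split; first by rewrite ler_nat.
  move=> x; rewrite /= !in_itv/= andbT => /andP[+ _]; apply: lt_le_trans.
  by rewrite ltr0n.
- case=> i x; rewrite /= => xi.
    by apply: (sP i); move: xi; rewrite /= !in_itv/= => /andP[/ltW -> /ltW ->].
  by move: xi; rewrite !in_itv/= andbT => /andP[+ _]; apply: lt_trans; rewrite ltr0n.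
- have le1 i x : s i < x < t i -> x <= 1.
    move=> /andP[/ltW sx /ltW xt]; have [_ st] := stA i.
    by have : `]0, 1]%classic x; [apply: st|]; rewrite /= in_itv/= ?sx//; case/andP.
  move=> [i|i] [j|j] _ _ /= [x []] /=; rewrite !in_itv/= => xi xj.
  + by congr inl; apply: (tst _ _ Logic.I Logic.I); exists x; split; rewrite /= in_itv.
  + have := le1 i x xi; case/andP: xj => jx _.
    by rewrite leNgt (le_lt_trans _ jx)// ler1n.
  + have := le1 j x xj; case/andP: xi => jx _.
    by rewrite leNgt (le_lt_trans _ jx)// ler1n.
  + congr inr; apply/val_inj/eqP; move: xi xj => /andP[ix xi] /andP[jx xj].
    have := lt_trans ix xj; have := lt_trans jx xi; rewrite !ltr_nat !ltnS => ij ji.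
    by rewrite eqn_leq ij ji.
Qed.

End trace_bounds.

Section decay_and_harmonic.
Context {R : realType}.
Variable a : nat -> {posnum R}.
Implicit Types (u v w z : R -> R) (lam C : R).
Local Notation leb := (@lebesgue_measure R).
Local Notation P := (`]0%R, +oo[%classic : set (measurableTypeR R)).
Local Notation mua := (mu a).
Implicit Types psi : L2 mua.

Lemma leb_cell n : leb (@cell R n) = 1%E.
Proof.
rewrite /cell lebesgue_measure_itv/= lte_fin ltr_nat ltnSn.
by rewrite -EFinB -[n.+1]addn1 natrD addrAC subrr add0r.
Qed.

Lemma bessel_dom_osc u k (x : R) : bessel_dom u -> (0 < k)%N -> k%:R < x ->
  (u x - u k%:R) ^+ 2 <= bessel_form_lam 0 u u / k%:R.
Proof.
move=> ud k0 kx; have [uac _ _] := ud.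
have k0' : (0 : R) < k%:R by rewrite ltr0n.
have C0 := bessel_form_lam_ge0 (lexx 0) ud.
have := @has_density_cells _ _ _ _ _ (bdensP uac) (fun x => id) unit (fun=> k%:R) (fun=> x) measurable_P.
have sub y : `[k%:R, x]%classic y -> (P : set R) y.
  by rewrite /= !in_itv/= andbT => /andP[+ _]; exact: lt_le_trans.
have H1 (i : unit) : k%:R <= x /\ `[k%:R, x] `<=` (`]0, +oo[%classic : set R).
  by split; [exact: ltW|exact: sub].
have H2 (i : unit) : `]k%:R, x[ `<=` (`]0, +oo[%classic : set R).
  by move=> y; rewrite /= in_itv/= => /andP[/ltW ky /ltW yx]; apply: sub; rewrite /= in_itv/= ky.
have H3 : trivIset [set: unit] (fun=> `]k%:R, x[%classic : set R) by move=> [] [].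
move=> /(_ H1 H2 H3); rewrite bessel_form0_ereal// lee_fin.
rewrite (big_pred1 tt); last by case.
rewrite ler_pdivrMr ?inv_sub_gt0// => /le_trans; apply.
rewrite ler_wpM2l// lerBlDr lerDl invr_ge0 ltW//.
exact: lt_trans kx.
Qed.

(** On the gap above [k] the function differs from its value at [k] by at most
    [sqrt (C / k)], and it is square-integrable there for the weight
    [2 x ^+ 2 >= 2 k ^+ 2]. *)
Lemma bessel_dom_decay u : bessel_dom u -> u k%:R @[k --> \oo] --> (0 : R).
Proof.
move=> ud; have /bessel_domP[uac u1 u2] := ud.
pose L := \int[leb]_(x in P) (u x ^+ 2 * (2 * x ^+ 2)); pose C := bessel_form_lam 0 u u.
have f0 (x : R) : 0 <= u x ^+ 2 * (2 * x ^+ 2) by exact: sqr_speed_ge0.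
have C0 : 0 <= C by exact: bessel_form_lam_ge0.
have L0 : 0 <= L by apply: Rintegral_ge0.
have LE : (\int[leb]_(x in P) (u x ^+ 2 * (2 * x ^+ 2))%:E = L%:E)%E.
  by rewrite /L /Rintegral fineK//; exact: (integrable_fin_num measurable_P u1).
have key k : (0 < k)%N -> u k%:R ^+ 2 <= (L + 2 * C) / k%:R.
  move=> k0; have k0' : (0 : R) < k%:R by rewrite ltr0n.
  pose c := (u k%:R ^+ 2 - 2 * (C / k%:R)) * k%:R ^+ 2.
  have cL : c <= L.
    have [c0|c0] := leP 0 c; last by rewrite (le_trans (ltW c0)).
    rewrite -lee_fin -LE; apply: (@le_trans _ _ (\int[leb]_(x in cell k) (u x ^+ 2 * (2 * x ^+ 2))%:E)%E).
      have <- : (\int[leb]_(x in cell k) (cst c%:E x) = c%:E)%E.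
        rewrite integral_cst; last exact: measurable_cell.
        rewrite [X in (_ * X)%E](_ : _ = 1%E) ?mule1//; exact: leb_cell.
      apply: ge0_le_integral.
      - exact: measurable_cell.
      - by move=> x _; rewrite lee_fin.
      - exact: measurable_cst.
      - apply/measurable_EFinP; apply: measurable_funM; last by apply: measurable_funM => //; exact: measurable_funX.
        apply: measurable_funX; apply: measurable_funS (measurable_pos uac); first exact: measurable_P.
        by rewrite bigcup_cell; exact: bigcup_sup.
      - move=> x /cell_truncn/andP[kx _]; rewrite lee_fin /c.
        have := bessel_dom_osc ud k0 kx; rewrite -/C; move: (C / k%:R) (u k%:R) (u x) => D A B BA.
        have h1 : A ^+ 2 - 2 * D <= 2 * B ^+ 2.
          have := sqr_ge0 (B + (B - A)); move: BA; rewrite !expr2; lra.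
        have h2 : k%:R ^+ 2 <= x ^+ 2 by rewrite ler_sqr ?nnegrE ?ltW// (lt_trans k0').
        apply: (@le_trans _ _ (2 * B ^+ 2 * k%:R ^+ 2)); first by rewrite ler_wpM2r ?sqr_ge0.
        by rewrite mulrA (mulrC _ 2) ler_wpM2l// mulr_ge0 ?sqr_ge0.
    apply: ge0_subset_integral.
    - exact: measurable_cell.
    - exact: measurable_P.
    - by case/integrableP: u1.
    - by move=> x _; rewrite lee_fin.
    - by rewrite bigcup_cell; exact: bigcup_sup.
  move: cL; rewrite /c -ler_pdivlMr ?exprn_gt0// lerBlDr => /le_trans; apply.
  rewrite [leRHS]mulrDl; apply: lerD; last by rewrite mulrA.
  rewrite ler_wpM2l// lef_pV2 ?posrE ?exprn_gt0// ler_eXnr ?ler1n//.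
exact: sqr_le_inv_cvg0 key.
Qed.

Lemma indicator_bound_integrable (f : R -> R) (K N : R) : measurable_fun P f ->
  (forall x, 0 < x -> 0 <= f x) -> (forall x, 0 < x -> f x <= K) ->
  (forall x, N < x -> f x = 0) -> leb.-integrable P (EFin \o f).
Proof.
move=> mf f0 fK fN.
have K0 : 0 <= K by rewrite (le_trans (f0 1 ltr01))// fK.
have iI := integrableS (@measurableT _ _) measurable_P (@subsetT _ _)
  (@integrable_indic_itv R 0 N true false).
have iK := @integrableZl _ _ _ _ _ measurable_P K _ iI.
apply: le_integrable iK; first exact: measurable_P.
  exact/measurable_EFinP.
move=> x; rewrite /= in_itv/= andbT => x0; rewrite lee_fin ger0_norm ?f0//.
rewrite indicE; have [xN|xN] := leP x N.
  rewrite mem_set ?mulr1 ?ger0_norm ?fK//=.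
  by rewrite in_itv/= xN ltW.
by rewrite fN// normr_ge0.
Qed.

(** Interpolating by [harm] attains the jump term on every gap, by Green's
    formula. The result is square-integrable because it vanishes far out, and
    because finite energy gives [x * f x ^+ 2] bounded near 0. *)
Lemma harmonic_extension (f : R -> R) psi C N : is_version f psi -> energy_le f C ->
  (forall k, (N <= k)%N -> f k%:R = 0) ->
  exists h, [/\ bessel_dom h, is_version h psi & bessel_form_lam 0 h h <= C].
Proof.
move=> fpsi fC fN; have fac := energy_le_loc_abs_cont fC; have C0 := energy_le_ge0 fC.
pose q n := @harm R n%:R n.+1%:R (f n%:R) (f n.+1%:R).
pose p n (x : R) := (f n.+1%:R - f n%:R) / (n%:R^-1 - n.+1%:R^-1).
have qp n : (0 < n)%N -> is_piece 0 n%:R n.+1%:R (q n) (p n).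
  by move=> n0; apply: is_piece_harm; rewrite ltr0n.
have ql n : (0 < n)%N -> q n n%:R = f n%:R by move=> n0; exact: harm_l.
have qr n : (0 < n)%N -> q n n.+1%:R = f n.+1%:R.
  by move=> n0; apply: harm_r; rewrite ?ltr0n// ltr_nat.
pose v := pw f q; have vac : loc_abs_cont `]0, +oo[ v := pw_loc_abs_cont fac qp ql qr.
have d0 (x : R) : 0 <= bdens v x ^+ 2 * x ^+ 2 by rewrite mulr_ge0 ?sqr_ge0.
have md : measurable_fun P (fun x => bdens v x ^+ 2 * x ^+ 2).
  by apply: measurable_funM; apply: measurable_funX => //; exact: measurable_bdens.
have EC : (\int[leb]_(x in P) (bdens v x ^+ 2 * x ^+ 2)%:E <= C%:E)%E.
  have /(max_energy_le _ fac) := fC; rewrite max_energyE//; apply: le_trans.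
  rewrite ge0_integral_cells//.
  rewrite nneseries_recl//; last by move=> k _; apply: integral_ge0 => x _; rewrite lee_fin.
  apply: leeD.
    pose G := dini (f \_ `]0, 1]).
    suff -> : (\int[leb]_(x in cell 0) (bdens v x ^+ 2 * x ^+ 2)%:E =
       \int[leb]_(x in `]0%R, 1%R[) (G x ^+ 2 * x ^+ 2)%:E)%E by [].
    transitivity (\int[leb]_(x in cell 0) (G x ^+ 2 * x ^+ 2)%:E)%E.
      apply: ae_congr_integral; apply: ae_cell.
      apply: filterS (pw_density0 fac qp ql qr); first exact: (ae_filter_ringOfSetsType leb).
      by move=> x H /H; rewrite /v => ->.
    rewrite /cell integral_itv_bndo_bndc//; apply: measurable_funTS.
    have [mG _ _] := has_density_01 fac.
    by apply/measurable_EFinP; apply: measurable_funM; apply: measurable_funX.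
  rewrite [leLHS]eseries_cond [leRHS]eseries_cond.
  apply: lee_nneseries => [n _ _|n /= n0]; first by apply: integral_ge0 => x _; rewrite lee_fin.
  have [Vi VE] := pw_green fac qp ql qr n0 vac.
  have bE x : bdens v x ^+ 2 * x ^+ 2 = bform 0 v v x by rewrite /bform mul0r addr0 expr2.
  under eq_integral do rewrite bE.
  have fV := integrable_fin_num (@measurable_cell R n) (integrable_cell Vi).
  rewrite -[leLHS]fineK// lee_fin.
  have -> : fine (\int[leb]_(x in cell n) (bform 0 v v x)%:E) = \int[leb]_(x in cell n) bform 0 v v x by [].
  rewrite (Rintegral_cell Vi) VE /v !(pw_atom ql qr)// /p -mulrBr.
  case: n n0 {Vi VE fV} => // n _; have := sum_jumps f n.+1; have := sum_jumps f n.
  rewrite [in X in _ -> X]big_nat_recr//= [in X in _ -> X](big_ord_recr n)/= => ->.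
  by move/addrI => ->; rewrite mulrAC expr2.
have sub1 (n : nat) : `[1, n%:R]%classic `<=` (`]0, +oo[%classic : set R).
  by move=> x; rewrite /= !in_itv/= andbT => /andP[+ _]; exact: lt_le_trans.
have [M vM] := abs_cont_bounded (vac _ _ (sub1 N.+1)).
pose n1 := N.+1.
have v0 (x : R) : n1%:R < x -> v x = 0.
  move=> n1x; have x0 : 0 <= x by rewrite (le_trans _ (ltW n1x))// ler0n.
  pose n := Num.truncn x; have /andP[nx xn] := truncn_itv x0.
  have n1n : (n1 <= n)%N by rewrite -ltnS -(ltr_nat R) (lt_trans n1x).
  have n0 : (0 < n)%N by apply: leq_trans n1n.
  have Nn : (N <= n)%N by apply: leq_trans n1n; exact: leqnSn.
  rewrite /v (pw_cell ql qr n0) ?nx ?ltW//.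
  by rewrite /q !fN ?harm0// (leq_trans Nn).
have b0 (x : R) : 0 < x <= 1 -> v x ^+ 2 * (2 * x ^+ 2) <= 4 * (f 1 ^+ 2 + C).
  move=> /andP[x0 x1]; rewrite /v pw_01//.
  have := var_le_cell (A := `]0, 1]) _ (energy_le_var fC) x1 _.
  have s1 : `]0, 1]%classic `<=` (`]0, +oo[%classic : set R).
    by move=> y; rewrite /= !in_itv/= => /andP[->].
  have s2 : `[x, 1]%classic `<=` (`]0, 1]%classic : set R).
    by move=> y; rewrite /= !in_itv/= => /andP[/(lt_le_trans x0) -> ->].
  move=> /(_ s1 s2); rewrite invr1 => h.
  have h1 : f x ^+ 2 <= 2 * f 1 ^+ 2 + 2 * (C * (x^-1 - 1)).
    have := sqr_ge0 (f x - 2 * f 1); move: (C * _) h => D; rewrite !expr2; lra.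
  have x2 : 0 <= 2 * x ^+ 2 by rewrite mulr_ge0// sqr_ge0.
  apply: (le_trans (ler_wpM2r x2 h1)).
  have -> : (2 * f 1 ^+ 2 + 2 * (C * (x^-1 - 1))) * (2 * x ^+ 2) =
    4 * (f 1 ^+ 2 * x ^+ 2 + C * (x * (1 - x))) by field; rewrite gt_eqF.
  rewrite ler_wpM2l// lerD//.
    by rewrite ler_piMr ?sqr_ge0// expr_le1// ltW.
  by rewrite ler_piMr//; move: x0 x1; clear; nra.
have vL : leb.-integrable P (EFin \o (fun x => v x ^+ 2 * (2 * x ^+ 2))).
  pose K := 4 * (f 1 ^+ 2 + C) + M ^+ 2 * (2 * n1%:R ^+ 2).
  have K1 : 0 <= 4 * (f 1 ^+ 2 + C) by rewrite mulr_ge0// addr_ge0// sqr_ge0.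
  have K2 : 0 <= M ^+ 2 * (2 * n1%:R ^+ 2) :> R by exact: sqr_speed_ge0.
  apply: (@indicator_bound_integrable _ K n1%:R).
  - apply: measurable_funM; first by apply: measurable_funX; exact: measurable_pos.
    by apply: measurable_funM => //; exact: measurable_funX.
  - by move=> x _; exact: sqr_speed_ge0.
  - move=> x x0; have [x1|x1] := leP x 1; first by rewrite (le_trans (b0 x _)) ?x0// lerDl.
    have [xn|xn] := leP x n1%:R; last by rewrite v0// expr0n mul0r addr_ge0.
    apply: (@le_trans _ _ (M ^+ 2 * (2 * n1%:R ^+ 2))); last by rewrite lerDr.
    have x1n : x \in `[1, n1%:R] by rewrite in_itv/= (ltW x1).
    apply: ler_pM; [exact: sqr_ge0|by rewrite mulr_ge0// sqr_ge0| |].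
      have := vM x x1n => vxM; rewrite -(real_normK (num_real (v x))).
      by rewrite ler_sqr ?nnegrE// (le_trans _ vxM).
    by rewrite ler_wpM2l// ler_sqr ?nnegrE// ltW.
  - by move=> x /v0 ->; rewrite expr0n mul0r.
have vd : bessel_dom v.
  apply/bessel_domP; split => //; apply/(ge0_integrableP _ md) => //.
  exact: le_lt_trans EC (ltry C).
exists v; split=> //.
  apply: is_version_ext fpsi => [x x1|k k0]; first exact: pw_01.
  by rewrite /v (pw_atom ql qr).
by rewrite -lee_fin -bessel_form0_ereal.
Qed.

End decay_and_harmonic.

(** * The limit form *)

Section mosco_facts.
Context {R : realType}.
Implicit Types (u : nat -> \bar R).

(** Turns a bound on a lower limit into a bound along a subsequence, to which
    lower semicontinuity applies. *)
Lemma limn_einf_lt_subseq u (c : \bar R) : (limn_einf u < c)%E ->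
  exists m : nat -> nat, forall n, (n <= m n)%N /\ (u (m n) < c)%E.
Proof.
move=> uc; suff H n : exists m, (n <= m)%N /\ (u m < c)%E.
  by have [m mP] := choice H; exists m.
have : (einfs u n < c)%E.
  apply: le_lt_trans uc; rewrite limn_einf_lim (cvg_lim _ (@cvg_einfs_sup _ u))//.
  by apply: ereal_sup_ubound; exists n.
by move=> /ereal_inf_lt[_ [m nm <-] umc]; exists m.
Qed.

Lemma limn_esup_le u (c : \bar R) N : (forall n, (N <= n)%N -> (u n <= c)%E) ->
  (limn_esup u <= c)%E.
Proof.
move=> uc; rewrite limn_esup_lim (cvg_lim _ (@cvg_esups_inf _ u))//.
apply: (@le_trans _ _ (esups u N)); first by apply: ereal_inf_lbound; exists N.
by apply: ge_ereal_sup => _ [n Nn <-]; exact: uc.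
Qed.

Section uniqueness.
Context d (T : measurableType d).
Variable mu : {measure set T -> \bar R}.
Implicit Types (q : R -> L2 mu -> \bar R).

(** A recovery sequence for one limit is a competitor in the lower bound for
    the other. *)
Lemma mosco_limit_unique q Q Q' : mosco_limit q Q -> mosco_limit q Q' -> Q = Q'.
Proof.
pose lam n : R := n.+1%:R^-1.
have lam0 n : 0 < lam n by rewrite invr_gt0.
have lamc : lam @ \oo --> 0 by exact: cvg_harmonic.
suff H Q1 Q2 : mosco_limit q Q1 -> mosco_limit q Q2 -> forall f, (Q1 f <= Q2 f)%E.
  by move=> qQ qQ'; apply/funext => f; apply/eqP; rewrite eq_le !H.
move=> /(_ lam lam0 lamc)[liminf _] /(_ lam lam0 lamc)[_ rec] f.
have [s sf sQ] := rec f; apply: le_trans sQ.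
by apply: le_trans (limn_einf_sup _); apply: liminf; exact: L2_cvg_weak.
Qed.

Lemma L2_weak_cvg_sub (s : nat -> L2 mu) f (m : nat -> nat) : (forall n, (n <= m n)%N) ->
  L2_weak_cvg s f -> L2_weak_cvg (s \o m) f.
Proof.
move=> nm sf g; have := sf g; apply: cvg_comp => A [N _ NA].
by exists N => // n /= Nn; apply: NA => /=; exact: leq_trans (nm n).
Qed.

End uniqueness.
End mosco_facts.

Section trace_form.
Context {R : realType}.
Variable a : nat -> {posnum R}.
Local Notation leb := (@lebesgue_measure R).
Local Notation mua := (mu a).
Implicit Types (phi psi : L2 mua) (s : nat -> L2 mua) (C lam : R).

Definition vanishing psi : Prop := psi k%:R @[k --> \oo] --> (0 : R).

(** Functions in the Bessel domain vanish at infinity, and so do their limits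
    of bounded energy: the jumps beyond [k] contribute at most [sqrt (C / k)]. *)
Definition trace_form psi : \bar R :=
  if `[< vanishing psi >] then max_form psi else +oo%E.

Lemma trace_form_ge0 psi : (0 <= trace_form psi)%E.
Proof. by rewrite /trace_form; case: ifP => // _; exact: max_form_ge0. Qed.

Lemma trace_form_le psi C : (trace_form psi <= C%:E)%E <->
  vanishing psi /\ exists2 f, is_version f psi & energy_le f C.
Proof.
rewrite /trace_form; case: ifPn => [/asboolP v|/asboolP nv]; last by split=> // -[].
by rewrite max_form_le; split=> [|[]].
Qed.

Lemma trace_form_fin psi : (trace_form psi < +oo)%E ->
  exists2 C, 0 <= C & trace_form psi = C%:E.
Proof.
by case: trace_form (trace_form_ge0 psi) => [C C0 _| |]//; exists C; rewrite -?lee_fin.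
Qed.

(** Letting the second atom in [jumps_cauchy] go to infinity. The bound is
    uniform in the energy, so that vanishing survives weak limits. *)
Lemma vanishing_sqr_le psi f C k : vanishing psi -> is_version f psi -> energy_le f C ->
  (0 < k)%N -> psi k%:R ^+ 2 <= C / k%:R.
Proof.
move=> psi0 fpsi fC k0; have C0 := energy_le_ge0 fC.
have cv : (psi m%:R - psi k%:R) ^+ 2 @[m --> \oo] --> (0 - psi k%:R) ^+ 2.
  by rewrite !expr2; under eq_fun do rewrite expr2; apply: cvgM; apply: cvgB => //; exact: cvg_cst.
rewrite -sqrrN -[X in X ^+ 2]sub0r; apply: (@cvgr_to_le _ _ _ _ _ _ _ cv).
exists k => // m /= km; have m0 := leq_trans k0 km.
rewrite -(version_atom fpsi m0) -(version_atom fpsi k0).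
apply: (le_trans (jumps_cauchy fC k0 km)).
by rewrite ler_wpM2l// lerBlDr lerDl invr_ge0.
Qed.

Lemma trace_form_lsc s psi C : L2_weak_cvg s psi ->
  (forall n, (trace_form (s n) <= C%:E)%E) -> (trace_form psi <= C%:E)%E.
Proof.
move=> sf sC; have /choice[u uP] : forall n, exists f, is_version f (s n) /\ energy_le f C.
  by move=> n; have /trace_form_le[_ [f]] := sC n; exists f.
apply/trace_form_le; split.
  apply: (@sqr_le_inv_cvg0 _ _ C) => k k0.
  have cv : (s n k%:R) ^+ 2 @[n --> \oo] --> psi k%:R ^+ 2.
    by rewrite expr2; under eq_fun do rewrite expr2; apply: cvgM; exact: weak_cvg_atom.
  apply: (@cvgr_to_le _ _ _ _ _ _ _ cv); apply: nearW => n.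
  have /trace_form_le[sn _] := sC n; have [un uC] := uP n.
  exact: vanishing_sqr_le un uC k0.
by apply: (weak_energy_lsc sf (u := u)) => n; have [] := uP n.
Qed.

Lemma is_versionD f g phi psi : is_version f phi -> is_version g psi ->
  is_version (f \+ g) (phi + psi)%R.
Proof.
apply: filterS2; first exact: (ae_filter_ringOfSetsType mua).
by move=> x /= -> ->.
Qed.

Lemma is_versionN f psi : is_version f psi -> is_version (\- f) (- psi)%R.
Proof.
apply: filterS; first exact: (ae_filter_ringOfSetsType mua).
by move=> x /= ->.
Qed.

Lemma trace_formD phi psi C C' t : 0 < t ->
  (trace_form phi <= C%:E)%E -> (trace_form psi <= C'%:E)%E ->
  (trace_form (phi + psi)%R <= ((1 + t) * C + (1 + t^-1) * C')%:E)%E.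
Proof.
move=> t0 /trace_form_le[v [f fphi fC]] /trace_form_le[v' [g gpsi gC]].
apply/trace_form_le; split.
  by rewrite /vanishing -[X in _ --> X](addr0 0); exact: cvgD v v'.
by exists (f \+ g); [exact: is_versionD|exact: energy_leD].
Qed.

Lemma trace_formN psi : trace_form (- psi)%R = trace_form psi.
Proof.
have H phi C : (trace_form phi <= C%:E)%E -> (trace_form (- phi)%R <= C%:E)%E.
  move=> /trace_form_le[v [f fphi fC]]; apply/trace_form_le; split.
    by rewrite /vanishing -[X in _ --> X](oppr0); exact: cvgN v.
  by exists (\- f); [exact: is_versionN|exact: energy_leN].
apply: eq_ereal_le; [exact: trace_form_ge0|exact: trace_form_ge0|].
by move=> C; split=> /H//; rewrite opprK.
Qed.

Lemma trace_formBC phi psi : trace_form (phi - psi)%R = trace_form (psi - phi)%R.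
Proof. by rewrite -[in LHS]opprB trace_formN. Qed.

(** A perturbation of small energy changes the energy little, uniformly below
    a given level [A]. *)
Lemma trace_form_near (A e : R) : 0 <= A -> 0 < e -> exists2 d, 0 < d &
  forall B phi psi, B <= A -> (trace_form phi <= B%:E)%E ->
    (trace_form (psi - phi)%R <= d%:E)%E -> (trace_form psi <= (B + e)%:E)%E.
Proof.
move=> A0 e0; pose t := e / (2 * (A + 1)).
have A1 : 0 < 2 * (A + 1) by rewrite mulr_gt0// ltr_wpDl.
have t0 : 0 < t by rewrite divr_gt0.
have t1 : 0 < 1 + t^-1 by rewrite addr_gt0// invr_gt0.
exists (e / (2 * (1 + t^-1))); first by rewrite divr_gt0// mulr_gt0.
move=> B phi psi BA pB pd.
have -> : psi = (phi + (psi - phi))%R by rewrite addrCA subrr addr0.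
apply: (le_trans (trace_formD t0 pB pd)); rewrite lee_fin.
have -> : (1 + t^-1) * (e / (2 * (1 + t^-1))) = e / 2 by field; rewrite !gt_eqF// addr_gt0.
have tB : t * B <= e / 2.
  apply: (@le_trans _ _ (t * (A + 1))); first by rewrite ler_wpM2l ?ltW// (le_lt_trans BA)// ltrDl.
  have -> : t * (A + 1) = e / 2 by rewrite /t; field; rewrite gt_eqF// ltr_wpDl.
  by [].
by move: tB; rewrite mulrDl mul1r; move: (t * B) => tB; lra.
Qed.

(** The projection is an extension, and discrete energy never exceeds the
    Bessel energy. *)
Lemma trace_form_trace_lam lam psi : 0 < lam -> (trace_form psi <= trace_lam lam psi)%E.
Proof.
move=> lam0; have [psiJ|psiJ] := pselect (ran_J psi); last by rewrite trace_lam_off// leey.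
have [v [vd vpsi -> _]] := trace_lam_ranJ lam0 psiJ.
apply/trace_form_le; split.
  apply: cvg_trans (bessel_dom_decay vd); apply: near_eq_cvg.
  by exists 1%N => // k /= k0; rewrite (version_atom vpsi k0).
exists v => //; apply: energy_leW (bessel_dom_energy vd).
exact: bessel_form_lam_le0 (ltW lam0) vd.
Qed.

Lemma ran_J_vanishing psi : ran_J psi -> vanishing psi.
Proof.
move=> [v vd vpsi]; apply: cvg_trans (bessel_dom_decay vd); apply: near_eq_cvg.
by exists 1%N => // k /= k0; rewrite (version_atom vpsi k0).
Qed.

Lemma restrict_trace_form psi :
  restrict_form (@max_form R a) (@ran_J R a) psi = restrict_form trace_form (@ran_J R a) psi.
Proof.
rewrite /restrict_form; case: ifPn => // /asboolP/ran_J_vanishing v.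
by rewrite /trace_form; case: ifPn => // /asboolP.
Qed.

(** The harmonic extension competes with the projection, and its form exceeds
    its energy only by [lam] times its squared norm. *)
Lemma finite_support_trace psi C N : (trace_form psi <= C%:E)%E ->
  (forall k, (N <= k)%N -> psi k%:R = 0) ->
  ran_J psi /\ exists2 D, 0 <= D & forall lam, 0 < lam ->
    (trace_lam lam psi <= (C + lam * D)%:E)%E.
Proof.
move=> /trace_form_le[_ [f fpsi fC]] psiN.
have fN k : (N.+1 <= k)%N -> f k%:R = 0.
  by move=> Nk; rewrite (version_atom fpsi) ?psiN ?(ltnW Nk)//; apply: leq_ltn_trans Nk.
have [h [hd hpsi hC]] := harmonic_extension fpsi fC fN.
have psiJ : ran_J psi by exists h.
split=> //; exists (\int[leb]_(x in `]0, +oo[) (h x ^+ 2 * (2 * x ^+ 2))).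
  by apply: Rintegral_ge0 => x _; exact: sqr_speed_ge0.
move=> lam lam0; have [v [_ _ _ vmin]] := trace_lam_ranJ lam0 psiJ.
apply: (le_trans (vmin h hd hpsi)); rewrite lee_fin (bessel_form_lam_split lam hd).
by rewrite lerD2r.
Qed.

End trace_form.

(** * Approximation by finitely supported functions *)

Section approximation.
Context {R : realType}.
Variable a : nat -> {posnum R}.
Local Notation mua := (mu a).
Implicit Types (phi psi : L2 mua) (C d e : R) (f : R -> R).

Definition clamp d (y : R) : R := Num.max (- d) (Num.min d y).

Lemma clamp_le d y : 0 <= d -> `|clamp d y| <= d.
Proof.
move=> d0; rewrite ler_norml /clamp le_max lexx/= ge_max ge_min lexx/= andbT.
by rewrite (le_trans _ d0)// oppr_le0.
Qed.

Lemma clamp_id d y : `|y| <= d -> clamp d y = y.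
Proof. by rewrite ler_norml => /andP[dy yd]; rewrite /clamp min_r// max_r. Qed.

Lemma clamp_lip d y z : 0 <= d -> `|clamp d y - clamp d z| <= `|y - z|.
Proof.
move=> d0; wlog yz : y z / y <= z => [H|].
  case/orP: (le_total y z) => yz; first exact: H.
  by rewrite distrC (distrC y); exact: H.
have cyz : clamp d y <= clamp d z.
  by rewrite /clamp ge_max le_max lexx/= le_max; apply/orP; right; rewrite le_min !ge_min lexx yz/= orbT.
rewrite distrC (distrC y) !ger0_norm ?subr_ge0// /clamp.
by minmax.
Qed.

Lemma clamp_norm d y : 0 <= d -> `|clamp d y| <= `|y|.
Proof.
move=> d0; have := clamp_lip y 0 d0.
by rewrite (@clamp_id d 0) ?normr0// !subr0.
Qed.

(** The truncation acts beyond 1 only: on [`]0, 1]] the energy of a truncation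
    is not controlled by its size. *)
Definition small_part d (f : R -> R) (x : R) : R := \1_`]1, +oo[ x * clamp d (f x).

Lemma small_part_le1 d f x : x <= 1 -> small_part d f x = 0.
Proof.
by move=> x1; rewrite /small_part indicE memNset ?mul0r//= in_itv/= andbT ltNge x1.
Qed.

Lemma small_part_gt1 d f x : 1 < x -> small_part d f x = clamp d (f x).
Proof. by move=> x1; rewrite /small_part indicE mem_set ?mul1r//= in_itv/= andbT. Qed.

Lemma small_part_norm d f x : 0 <= d -> `|small_part d f x| <= `|f x|.
Proof.
move=> d0; have [x1|x1] := leP x 1; first by rewrite small_part_le1// normr0.
by rewrite small_part_gt1// clamp_norm.
Qed.

Lemma small_part_le d f x : 0 <= d -> `|small_part d f x| <= d.
Proof.
move=> d0; have [x1|x1] := leP x 1; first by rewrite small_part_le1// normr0.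
by rewrite small_part_gt1// clamp_le.
Qed.

Lemma measurable_small_part d psi : measurable_fun setT (small_part d psi).
Proof.
apply: measurable_funM; first by apply: measurable_indic; exact: measurable_itv.
have m1 : measurable_fun setT (fun x => Num.min d (psi x)) by exact: measurable_minr.
exact: (measurable_maxr (measurable_cst (- d)) m1).
Qed.

Lemma small_part_L2 d psi : 0 <= d -> exists g : L2 mua, g = small_part d psi :> (R -> R).
Proof.
move=> d0; apply: mk_L2; first exact: measurable_small_part.
apply: le_lt_trans (L2_sqr_lty psi); apply: ge0_le_integral => //.
- by move=> x _; rewrite lee_fin sqr_ge0.
- by apply/measurable_EFinP; apply: measurable_funX; exact: measurable_small_part.
- by apply/measurable_EFinP; apply: measurable_funX.
- move=> x _; rewrite lee_fin -(real_normK (num_real (small_part _ _ _))) -(real_normK (num_real (psi x))).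
  by rewrite ler_sqr ?nnegrE// small_part_norm.
Qed.

Lemma small_part_L2_cvg psi e : 0 < e -> \forall n \near \oo,
  (\int[mua]_x (small_part n.+1%:R^-1 psi x ^+ 2)%:E <= e%:E)%E.
Proof.
have h0 n : (0 : R) <= n.+1%:R^-1 by rewrite invr_ge0.
move=> e0; pose F n x := (small_part n.+1%:R^-1 psi x ^+ 2)%:E.
have : (\int[mua]_x F n x @[n --> \oo] --> 0)%E.
  rewrite -[X in _ --> X](integral0 mua setT).
  apply: (@dominated_cvg _ _ _ mua setT measurableT F (cst 0%E) (fun x => (psi x ^+ 2)%:E)).
  - by move=> n; apply/measurable_EFinP; apply: measurable_funX; exact: measurable_small_part.
  - move=> x _; apply/fine_cvgP; split; first exact: nearW.
    apply: (@squeeze_cvgr _ _ _ _ (cst 0) (fun n => n.+1%:R^-1 * n.+1%:R^-1)).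
    + apply: nearW => n /=; rewrite sqr_ge0/= -expr2 -(real_normK (num_real (small_part _ _ _))).
      by rewrite ler_sqr ?nnegrE// small_part_le.
    + exact: cvg_cst.
    + by rewrite -[X in _ --> X](mulr0 0); apply: cvgM; exact: cvg_harmonic.
  - by [].
  - have := L2_mul_integrable psi psi.
    by apply: eq_integrable => // x _ /=; rewrite expr2.
  - move=> n x _ /=; rewrite lee_fin ger0_norm ?sqr_ge0//.
    rewrite -(real_normK (num_real (small_part _ _ _))) -(real_normK (num_real (psi x))).
    by rewrite ler_sqr ?nnegrE// small_part_norm.
by move=> /ge0_cvge0P; apply => // n; apply: integral_ge0 => x _; rewrite lee_fin sqr_ge0.
Qed.

(** The jumps of the small part are at most [2 d] and at most those of [f].
    The first bound serves finitely many atoms, the second the tail. *)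
Lemma small_part_energy f C e : energy_le f C -> 0 < e -> \forall n \near \oo,
  energy_le (small_part n.+1%:R^-1 f) e.
Proof.
move=> fC e0; pose S K := \sum_(1 <= k < K) (k * k.+1)%:R * (f k.+1%:R - f k%:R) ^+ 2.
have SS : nondecreasing_seq S.
  move=> K L KL; rewrite /S; case: K KL => [|K] KL; first by rewrite big_geq// jump_sum_ge0.
  rewrite [leRHS](big_cat_nat (n := K.+1))//= lerDl.
  by apply: sumr_ge0 => k _; rewrite mulr_ge0// sqr_ge0.
have Sb : has_ubound (range S) by exists C => _ [K _ <-]; exact: energy_le_jumps.
have Sc := nondecreasing_cvgn SS Sb; set l := sup _ in Sc.
have Sl K : S K <= l by apply: ub_le_sup => //; exists K.
have [K0 [K02 K0l]] : exists K0, (2 <= K0)%N /\ l - e / 2 <= S K0.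
  have : \forall K \near \oo, l - e / 2 <= S K.
    by apply: (cvgr_ge _ Sc); rewrite ltrBlDr ltrDl divr_gt0.
  move=> [N _ NS]; exists (maxn 2 N); split; first exact: leq_maxl.
  by apply: NS; exact: leq_maxr.
pose D : R := \sum_(1 <= k < K0) (k * k.+1)%:R * 4.
have D0 : 0 <= D by apply: sumr_ge0 => k _; rewrite mulr_ge0.
have dD : \forall n \near \oo, n.+1%:R^-1 ^+ 2 * D <= e / 2.
  have cv : n.+1%:R^-1 ^+ 2 * D @[n --> \oo] --> (0 : R).
    rewrite -[X in _ --> X](mul0r D); apply: cvgM; last exact: cvg_cst.
    under eq_fun do rewrite expr2.
    have : n.+1%:R^-1 * n.+1%:R^-1 @[n --> \oo] --> (0 * 0 : R) by apply: cvgM; exact: cvg_harmonic.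
    by rewrite mulr0.
  by apply: (cvgr_le _ cv); rewrite divr_gt0.
apply: filterS dD => n nD; set d := n.+1%:R^-1 in nD *.
have d0 : 0 <= d by rewrite invr_ge0.
move=> I s t K st tst.
rewrite big1 ?add0r; last first.
  move=> i _; have [sti stA] := st i.
  have [_ s1 _ t1] := itvcc_01 sti stA.
  by rewrite !small_part_le1// subrr expr0n mul0r.
set g := small_part d f.
pose T m := \sum_(1 <= k < m) (k * k.+1)%:R * (g k.+1%:R - g k%:R) ^+ 2.
apply: (@le_trans _ _ (T (maxn K0 K))).
  rewrite /T; case: K => [|K]; first by rewrite big_geq// jump_sum_ge0.
  rewrite [leRHS](big_cat_nat (n := K.+1))//= ?leq_maxr// lerDl.
  by apply: sumr_ge0 => k _; rewrite mulr_ge0// sqr_ge0.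
rewrite /T (big_cat_nat (n := K0)) ?(ltnW K02)//= ?leq_maxl//.
have -> : e = e / 2 + e / 2 by field.
apply: lerD.
  apply: le_trans nD; rewrite /D mulr_sumr; apply: ler_sum => k _.
  rewrite [leRHS]mulrCA ler_wpM2l// -(real_normK (num_real (_ - _))).
  have -> : d ^+ 2 * 4 = (d + d) ^+ 2 by ring.
  rewrite ler_sqr ?nnegrE ?addr_ge0//.
  by apply: (le_trans (ler_normB _ _)); apply: lerD; exact: small_part_le.
have : S (maxn K0 K) - S K0 <= e / 2 by rewrite lerBlDr; move: (Sl (maxn K0 K)) K0l; lra.
have -> : S (maxn K0 K) - S K0 =
    \sum_(K0 <= k < maxn K0 K) (k * k.+1)%:R * (f k.+1%:R - f k%:R) ^+ 2.
  by rewrite /S (big_cat_nat (n := K0)) ?(ltnW K02)//= ?leq_maxl// [LHS]addrC addKr.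
apply: le_trans.
apply: ler_sum_nat => k /andP[K0k _]; rewrite ler_wpM2l//.
have k1 : (1 : R) < k%:R by rewrite ltr1n; exact: leq_trans K0k.
have k1' : (1 : R) < k.+1%:R by rewrite (lt_trans k1)// ltr_nat.
rewrite /g !small_part_gt1//.
rewrite -(real_normK (num_real (clamp _ _ - _))) -(real_normK (num_real (f _ - _))).
by rewrite ler_sqr ?nnegrE// clamp_lip.
Qed.

(** Soft thresholding at the atoms: a vanishing sequence has only finitely
    many values above the threshold. *)
Lemma finite_support_approx psi e : (trace_form psi < +oo)%E -> 0 < e ->
  exists phi : L2 mua, [/\ exists N, forall k, (N <= k)%N -> phi k%:R = 0,
    (trace_form (phi - psi)%R <= e%:E)%E &
    (\int[mua]_x ((phi x - psi x) ^+ 2)%:E <= e%:E)%E].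
Proof.
move=> /trace_form_fin[C C0 psiC] e0.
have /trace_form_le[v [f fpsi fC]] : (trace_form psi <= C%:E)%E by rewrite psiC.
have [N _ NP] := filterI (small_part_L2_cvg psi e0) (small_part_energy fC e0).
have [L2N EN] := NP N (leqnn N); set d := N.+1%:R^-1 in L2N EN.
have d0 : 0 < d by rewrite invr_gt0.
have [g gE] := small_part_L2 psi (ltW d0).
have gx x : g x = small_part d psi x by rewrite gE.
have E x : (psi - g)%R x - psi x = - small_part d psi x by rewrite L2_BE gx addrAC subrr sub0r.
exists (psi - g)%R; split.
- have : \forall k \near \oo, `|psi k%:R| <= d.
    move/cvgr0Pnorm_le : v; exact.
  move=> [M _ MP]; exists (maxn 2 M) => k; rewrite geq_max => /andP[k2 Mk].
  rewrite L2_BE gx small_part_gt1 ?ltr1n// clamp_id ?subrr//.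
  exact: MP.
- have -> : (psi - g - psi = - g)%R by rewrite addrAC subrr sub0r.
  rewrite trace_formN; apply/trace_form_le; split.
    apply/cvgr0Pnorm_le => r r0; move/cvgr0Pnorm_le : v => /(_ r r0).
    by apply: filterS => k; apply: le_trans; rewrite gx small_part_norm// ltW.
  exists (small_part d f) => //.
  apply: filterS fpsi; first exact: (ae_filter_ringOfSetsType mua).
  by move=> x fx; rewrite gx /small_part fx.
- by under eq_integral do rewrite E sqrrN.
Qed.

End approximation.

(** * Closure and Mosco convergence *)

Section closure.
Context {R : realType}.
Variable a : nat -> {posnum R}.
Local Notation mua := (mu a).
Implicit Types (phi psi : L2 mua) (s : nat -> L2 mua) (C e lam : R).
Local Notation q := (restrict_form (@max_form R a) (@ran_J R a)).

Lemma restrict_formE psi : ran_J psi -> q psi = trace_form psi.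
Proof.
by move=> psiJ; rewrite restrict_trace_form /restrict_form; case: ifPn => // /asboolP.
Qed.

Lemma restrict_form_lty psi : (q psi < +oo)%E -> ran_J psi.
Proof. by rewrite /restrict_form; case: ifPn => // /asboolP. Qed.

Lemma ran_JB phi psi : ran_J phi -> ran_J psi -> ran_J (phi - psi)%R.
Proof.
move=> [u ud upsi] [v vd vpsi]; exists (u \- v); first exact: bessel_domB.
exact: (is_versionD upsi (is_versionN vpsi)).
Qed.

Lemma L2_weak_cvgB s psi phi : L2_weak_cvg s psi ->
  L2_weak_cvg (fun n => phi - s n)%R (phi - psi)%R.
Proof.
move=> spsi g.
have E (h : L2 mua) : \int[mua]_x ((phi - h)%R x * g x) =
    \int[mua]_x (phi x * g x) - \int[mua]_x (h x * g x).
  rewrite -RintegralB//; [|exact: L2_mul_integrable|exact: L2_mul_integrable].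
  by apply: eq_Rintegral => x _; rewrite L2_BE mulrBl.
rewrite E; under eq_fun do rewrite E.
by apply: cvgB; [exact: cvg_cst|exact: spsi].
Qed.

(** Lower semicontinuity along [m] for [s n - s m], which converges to
    [s n - psi]. *)
Lemma trace_form_approx_cvg s psi e : form_approx q s psi -> 0 < e ->
  exists N, forall n, (N <= n)%N -> (trace_form (s n - psi)%R <= e%:E)%E.
Proof.
move=> [sfin scau spsi] e0; have [N NP] := scau e e0; exists N => n Nn.
have wk : L2_weak_cvg (s \o (addn N)) psi.
  by apply: (L2_weak_cvg_sub (fun m => leq_addl N m)); exact: L2_cvg_weak.
have wk2 := L2_weak_cvgB (phi := s n) wk.
apply: (trace_form_lsc wk2) => m /=.
rewrite -restrict_formE; first by apply: NP => //; exact: leq_addr.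
by apply: ran_JB; apply: restrict_form_lty.
Qed.

(** Energy Cauchy sequences converge in energy to their L2 limit, by
    [trace_form_approx_cvg], and [finite_support_approx] provides such a
    sequence in [ran_J] for every function of finite energy. *)
Lemma trace_form_closure : is_closure q (@trace_form R a).
Proof.
have fin s psi : form_approx q s psi -> (trace_form psi < +oo)%E.
  move=> H; have [N NP] := trace_form_approx_cvg H ltr01.
  have [sfin _ _] := H; have sJ := restrict_form_lty (sfin N).
  have := sfin N; rewrite (restrict_formE sJ) => /trace_form_fin[C C0 sC].
  have -> : psi = (s N + (psi - s N))%R by rewrite addrCA subrr addr0.
  apply: (@le_lt_trans _ _ ((1 + 1) * C + (1 + 1^-1) * 1)%:E); last exact: ltry.
  by apply: (trace_formD ltr01); [rewrite sC|rewrite trace_formBC; exact: NP].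
split=> [psi|s psi H].
  split=> [psifin|[s]]; last exact: fin.
  have ex n : exists phi : L2 mua, [/\ ran_J phi, (trace_form phi < +oo)%E,
      (trace_form (phi - psi)%R <= n.+1%:R^-1%:E)%E &
      (\int[mua]_x ((phi x - psi x) ^+ 2)%:E <= n.+1%:R^-1%:E)%E].
    have [phi [[N phiN] phiE phiL]] := finite_support_approx psifin
      (ltac:(by rewrite invr_gt0) : (0 : R) < n.+1%:R^-1).
    have [C C0 psiC] := trace_form_fin psifin.
    have psiC' : (trace_form psi <= C%:E)%E by rewrite psiC.
    have phiC := trace_formD ltr01 psiC' phiE; rewrite addrCA subrr addr0 in phiC.
    exists phi; split=> //; last exact: le_lt_trans phiC (ltry _).
    by have [] := finite_support_trace phiC phiN.
  have [s sP] := choice ex.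
  have inv_le e : 0 < e -> exists N, forall n, (N <= n)%N -> n.+1%:R^-1 <= e.
    move=> e0; have : \forall n \near \oo, n.+1%:R^-1 <= e.
      exact: (cvgr_le _ (@cvg_harmonic R)).
    by move=> [N _ NP]; exists N.
  exists s; split.
  - by move=> n; have [sJ sfin _ _] := sP n; rewrite restrict_formE.
  - move=> e e0; have [N NP] := inv_le (e / 4) ltac:(by rewrite divr_gt0).
    exists N => n m Nn Nm; have [nJ _ nE _] := sP n; have [mJ _ mE _] := sP m.
    rewrite restrict_formE; last exact: ran_JB.
    have -> : (s n - s m = (s n - psi) + (psi - s m))%R by rewrite addrA subrK.
    rewrite trace_formBC in mE.
    apply: (le_trans (trace_formD ltr01 nE mE)); rewrite lee_fin invr1.
    by move: (NP n Nn) (NP m Nm); move: (n.+1%:R^-1) (m.+1%:R^-1) => x y; lra.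
  - apply/L2_cvg_sqr => e e0; have [N NP] := inv_le e e0.
    exists N => // n /= Nn; have [_ _ _ nL] := sP n.
    by apply: (le_trans nL); rewrite lee_fin NP.
have [A A0 psiA] := trace_form_fin (fin s psi H).
have [sfin _ _] := H.
have sJ n := restrict_form_lty (sfin n).
under eq_fun do rewrite restrict_formE//.
have sfin' n : exists2 B, 0 <= B & trace_form (s n) = B%:E.
  by apply: trace_form_fin; rewrite -restrict_formE.
rewrite psiA; apply/fine_cvgP; split.
  by apply: nearW => n; have [B _ ->] := sfin' n.
apply/cvgrPdist_le => e e0.
have [d d0 dP] := trace_form_near a (ltac:(by rewrite addr_ge0// ltW) : 0 <= A + e) e0.
have [N NP] := trace_form_approx_cvg H d0.
exists N => // n /= Nn; have [B B0 nB] := sfin' n.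
have h1 : (trace_form (s n) <= (A + e)%:E)%E.
  by apply: (dP A psi); [rewrite lerDl ltW|rewrite psiA|exact: NP].
have h2 : (trace_form psi <= (B + e)%:E)%E.
  apply: (dP B (s n)); [by rewrite -lee_fin -nB|by rewrite nB|rewrite trace_formBC; exact: NP].
move: h1 h2; rewrite nB psiA !lee_fin /= ler_norml => ? ?.
by apply/andP; split; lra.
Qed.

End closure.

Section mosco.
Context {R : realType}.
Variable a : nat -> {posnum R}.
Local Notation mua := (mu a).
Implicit Types (phi psi : L2 mua) (s : nat -> L2 mua) (C e : R).

Lemma last_good (good : nat -> Prop) n : good 0%N ->
  exists N, good N /\ forall M, (M <= n)%N -> good M -> (M <= N)%N.
Proof.
move=> g0; elim: n => [|n [N [gN NP]]].
  by exists 0%N; split=> // M; rewrite leqn0 => /eqP ->.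
have [gn|gn] := pselect (good n.+1 /\ (N <= n.+1)%N).
  exists n.+1; split=> [|M Mn _]; [by case: gn|exact: Mn].
exists N; split=> // M; rewrite leq_eqVlt => /predU1P[-> gn1|]; last by rewrite ltnS => /NP; apply.
by rewrite leqNgt; apply/negP => /ltnW Nn; apply: gn.
Qed.

(** The lower bound follows from [trace_form_trace_lam] and lower
    semicontinuity. A recovery sequence is a diagonal one: finitely supported
    approximants, advancing slowly enough for the error [lam n * D] to tend to
    0. *)
Lemma trace_form_mosco : is_trace_form (@trace_form R a).
Proof.
move=> lam lam0 lamc; split=> [s psi spsi|psi].
  set l := limn_einf _.
  have [->|lfin] := eqVneq l +oo%E; first exact: leey.
  have key C : (l < C%:E)%E -> (trace_form psi <= C%:E)%E.
    move=> lC; have [m mP] := limn_einf_lt_subseq lC.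
    apply: (trace_form_lsc (L2_weak_cvg_sub (fun n => (mP n).1) spsi)) => n /=.
    exact: le_trans (trace_form_trace_lam _ (lam0 _)) (ltW (mP n).2).
  case: l lfin key => [r| |] // _ key.
    apply/lee_addgt0Pr => e e0; rewrite -EFinD; apply: key.
    by rewrite lte_fin ltrDl.
  have := le_trans (trace_form_ge0 psi) (key (-1) (ltNyr _)).
  by rewrite lee_fin oppr_ge0 ler10.
have [psifin|] := ltP (trace_form psi) +oo%E; last first.
  rewrite leye_eq => /eqP ->; exists (fun=> psi); last exact: leey.
  apply/L2_cvg_sqr => e e0; apply: nearW => n.
  under eq_integral do rewrite subrr expr0n.
  by rewrite integral0 lee_fin ltW.
have [A A0 psiA] := trace_form_fin psifin.
have ex N : exists phiD : L2 mua * R, [/\ 0 <= phiD.2,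
    (\int[mua]_x ((phiD.1 x - psi x) ^+ 2)%:E <= N.+1%:R^-1%:E)%E &
    forall l : R, 0 < l -> (trace_lam l phiD.1 <= (A + N.+1%:R^-1 + l * phiD.2)%:E)%E].
  have N0 : (0 : R) < N.+1%:R^-1 by rewrite invr_gt0.
  have [d d0 dP] := trace_form_near a A0 N0.
  have m0 : 0 < Num.min d N.+1%:R^-1 by rewrite lt_min d0.
  have [phi [[M phiM] phiE phiL]] := finite_support_approx psifin m0.
  have phiC : (trace_form phi <= (A + N.+1%:R^-1)%:E)%E.
    apply: (dP A psi phi) => //; first by rewrite psiA.
    by apply: (le_trans phiE); rewrite lee_fin ge_min lexx.
  have [_ [D D0 phiD]] := finite_support_trace phiC phiM.
  exists (phi, D); split=> //=.
  by apply: (le_trans phiL); rewrite lee_fin ge_min lexx orbT.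
have [pD pDP] := choice ex.
(* [K n] is the last approximant, among the first [n], whose error term is
   below its index level at the parameter [lam n]. *)
pose good n N := (N = 0)%N \/ lam n * (pD N).2 <= N.+1%:R^-1.
have [K KP] := choice (fun n => @last_good (good n) n (or_introl erefl)).
have big M : \forall n \near \oo, (M <= K n)%N.
  have : \forall n \near \oo, lam n * (pD M).2 <= M.+1%:R^-1.
    have cv : lam n * (pD M).2 @[n --> \oo] --> (0 : R).
      by rewrite -[X in _ --> X](mul0r (pD M).2); apply: cvgM => //; exact: cvg_cst.
    by apply: (cvgr_le _ cv); rewrite invr_gt0.
  move=> [N _ NP]; exists (maxn N M) => // n; rewrite /= geq_max => /andP[Nn Mn].
  by have [_ h] := KP n; apply: h => //; right; exact: NP.
have small e : 0 < e -> \forall n \near \oo, (K n).+1%:R^-1 <= e /\ (0 < K n)%N.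
  move=> e0; have [N _ NP] : \forall n \near \oo, n.+1%:R^-1 <= e.
    exact: (cvgr_le _ (@cvg_harmonic R)).
  apply: filterS (big (maxn N 1)) => n; rewrite geq_max => /andP[NK K0].
  by split=> //; exact: NP.
exists (fun n => (pD (K n)).1).
  apply/L2_cvg_sqr => e e0; apply: filterS (small e e0) => n [Ke _].
  by have [_ h _] := pDP (K n); apply: (le_trans h); rewrite lee_fin.
rewrite psiA; apply/lee_addgt0Pr => e e0; rewrite -EFinD.
have [N _ NP] := small (e / 2) ltac:(by rewrite divr_gt0).
apply: (@limn_esup_le _ _ _ N) => n /NP[Ke K0].
have [_ _ h] := pDP (K n); apply: (le_trans (h _ (lam0 n))); rewrite lee_fin.
have [[K00|gK] _] := KP n; first by rewrite K00 in K0.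
by move: Ke gK; move: ((K n).+1%:R^-1) (lam n * _) => x y; lra.
Qed.

End mosco.

(** * Infinite mass *)

Section infinite_mass.
Context {R : realType}.
Variable a : nat -> {posnum R}.
Local Notation mua := (mu a).
Implicit Types (psi : L2 mua).

Definition tail (k : nat) : set (measurableTypeR R) := [set n%:R | n in [set n | (k <= n)%N]].

Lemma measurable_tail k : measurable (tail k).
Proof.
rewrite /tail -bigcup_imset1; apply: bigcup_measurable => n _.
exact: measurable_set1.
Qed.

Lemma mu_tail k : mu_disc a (@posnats R) = +oo%E -> mua (tail k.+1) = +oo%E.
Proof.
move=> muoo; elim: k => [|k IH].
  by rewrite (_ : tail 1 = @posnats R)// muE muoo addey// -ltNye (lt_le_trans (ltNyr 0))// measure_ge0.
have : (mua (tail k.+1) <= mua ([set k.+1%:R] `|` tail k.+2))%E.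
  apply: le_measure; rewrite ?inE; [exact: measurable_tail| |].
    by apply: measurableU; [exact: measurable_set1|exact: measurable_tail].
  move=> _ [n /= + <-]; rewrite leq_eqVlt => /predU1P[<-|kn]; first by left.
  by right; exists n.
have fin := mu_atom_lty a k.+1.
have m1 : measurable ([set k.+1%:R] : set (measurableTypeR R)) by exact: measurable_set1.
move=> /le_trans/(_ (measureU2 mua m1 (measurable_tail k.+2))); rewrite IH.
have [tfin|] := ltP (mua (tail k.+2)) +oo%E; last by rewrite leye_eq => /eqP.
by rewrite leNgt (lte_add_pinfty fin tfin).
Qed.

(** Finite energy bounds the oscillation far out, so a sequence that does not
    vanish stays away from 0 on a set of atoms of infinite mass. *)
Lemma max_form_vanishing psi : mu_disc a (@posnats R) = +oo%E ->
  (max_form psi < +oo)%E -> vanishing psi.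
Proof.
move=> muoo psifin.
have [C /max_form_le[f fpsi fC]] : exists C : R, (max_form psi <= C%:E)%E.
  by move: psifin (max_form_ge0 psi); case: max_form => // r; exists r.
have C0 := energy_le_ge0 fC.
apply/cvgr0Pnorm_le => e e0; have e2 : 0 < (e / 2) ^+ 2 by rewrite exprn_gt0// divr_gt0.
exists (Num.bound (C / (e / 2) ^+ 2)).+1 => // k /= kn.
have k0 : (0 < k)%N by apply: leq_trans kn.
have Ck : C / k%:R <= (e / 2) ^+ 2.
  rewrite ler_pdivrMr ?ltr0n// mulrC -ler_pdivrMr//.
  have De : 0 <= C / (e / 2) ^+ 2 by rewrite divr_ge0// ltW.
  by rewrite (le_trans (ltW (archi_boundP De)))// ler_nat ltnW.
rewrite leNgt; apply/negP => ek.
have low m : (k <= m)%N -> (e / 2) ^+ 2 <= psi m%:R ^+ 2.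
  move=> km; have m0 := leq_trans k0 km.
  have : `|psi m%:R - psi k%:R| <= e / 2.
    rewrite -ler_sqr ?nnegrE ?divr_ge0 ?(ltW e0)// real_normK ?num_real//.
    rewrite -(version_atom fpsi m0) -(version_atom fpsi k0).
    apply: le_trans Ck; apply: (le_trans (jumps_cauchy fC k0 km)).
    by rewrite ler_wpM2l// lerBlDr lerDl invr_ge0.
  move=> h; rewrite -(real_normK (num_real (psi m%:R))) ler_sqr ?nnegrE ?divr_ge0 ?(ltW e0)//.
  have := ler_distD (psi m%:R) (psi k%:R) 0; rewrite !subr0 distrC => h'.
  move: h h' ek; move: `|_ - _| `|psi _| `|psi _| => x y z; lra.
have := L2_sqr_lty psi; rewrite ltNge => /negP; apply.
case: k k0 low {kn Ck ek} => // k _ low.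
apply: (@le_trans _ _ (\int[mua]_(x in tail k.+1) (cst ((e / 2) ^+ 2)%:E x))%E).
  rewrite integral_cst; last exact: measurable_tail.
  by rewrite mu_tail// gt0_muley// lte_fin.
apply: (@le_trans _ _ (\int[mua]_(x in tail k.+1) (psi x ^+ 2)%:E)%E).
  apply: ge0_le_integral.
  - exact: measurable_tail.
  - by move=> x _; rewrite lee_fin ltW.
  - exact: measurable_cst.
  - by apply/measurable_EFinP; apply: measurable_funX; exact: measurable_funTS.
  - by move=> _ [n /= kn <-]; rewrite lee_fin low.
apply: ge0_subset_integral => //; first exact: measurable_tail.
- by apply/measurable_EFinP; apply: measurable_funX.
- by move=> x _; rewrite lee_fin sqr_ge0.
Qed.

Lemma trace_form_max_form : mu_disc a (@posnats R) = +oo%E ->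
  @trace_form R a = @max_form R a.
Proof.
move=> muoo; apply/funext => psi; rewrite /trace_form; case: ifPn => // /asboolP nv.
have [/(max_form_vanishing muoo)//|] := ltP (max_form psi) +oo%E.
by rewrite leye_eq => /eqP ->.
Qed.

End infinite_mass.

Theorem theorem4p3 (R : realType) (a : nat -> {posnum R}) :
  (exists E : L2 (mu a) -> \bar R, is_trace_form E) /\
  forall E : L2 (mu a) -> \bar R, is_trace_form E ->
    is_closure (restrict_form (@max_form R a) (@ran_J R a)) E /\
    (mu_disc a (@posnats R) = +oo%E -> E = @max_form R a).
Proof.
split=> [|E ET]; first by exists (@trace_form R a); exact: trace_form_mosco.
have -> : E = @trace_form R a := mosco_limit_unique ET (trace_form_mosco a).
by split; [exact: trace_form_closure|exact: trace_form_max_form].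
Qed.
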